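(* Let $N\ge 2$, let $T_N$ be an admissible polynomial of degree $N$ with leading coefficient $c$, and let $K=T_N^{-1}([-1,1])$. Let $\mu_K$ be the equilibrium measure of $K$, let $(a_n)_{n=1}^\infty$ be the sequence of recurrence coefficients for $\mu_K$, and let $(a_n')_{n=1}^\infty$ be the periodic limit of $(a_n)_{n=1}^\infty$, i.e. the $N$-periodic sequence with $a_n-a_n'\to 0$ as $n\to\infty$. Then: (a) $\displaystyle\liminf_{n\to\infty} W_n(\mu_K)=\sqrt{2}$. (b) $W_n(\mu_K)\ge 1$ for each $n\in\mathbb{N}$. (c) $\displaystyle \inf_{l\in\mathbb{N}} \frac{a_1'\cdots a_l'}{\mathrm{Cap}(K)^l}= \frac{a_1'\cdots a_N'}{\mathrm{Cap}(K)^N} =1.$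
   Context: $\mathbb{N}=\{1,2,\dots\}$. $\mathrm{Cap}(\cdot)$ denotes logarithmic capacity. For a non-polar compact set $K\subset\mathbb{R}$ (i.e. $\mathrm{Cap}(K)>0$), $\mu_K$ denotes its equilibrium measure: the unique Borel probability measure on $K$ minimizing the logarithmic energy $\iint \log\frac{1}{|x-y|}\,d\mu(x)\,d\mu(y)$. A real polynomial $T_N$ of degree $N\ge 2$ is called admissible if it has $N$ real and simple zeros $x_1<\dots<x_N$ and its $N-1$ critical points $y_1<\dots<y_{N-1}$ satisfy $|T_N(y_i)|\ge 1$ for each $i\in\{1,\dots,N-1\}$. In this case $T_N^{-1}([-1,1])$ is a union of at most $N$ disjoint compact real intervals. Let $\mu$ be a unit Borel measure with infinite compact support on $\mathbb{R}$. For $n\in\mathbb{N}$, $P_n(\cdot;\mu)$ is the $n$-th monic orthogonal polynomial for $\mu$, i.e. the monic real polynomial of degree $n$ with minimal $L^2(\mu)$ norm among all monic real polynomials of degree $n$. With $P_{-1}(x;\mu):=0$ and $P_0(x;\mu):=1$, these satisfy $$P_{n+1}(x;\mu)=(x-b_{n+1})P_n(x;\mu)-a_n^2P_{n-1}(x;\mu),\qquad n\in\mathbb{N}\cup\{0\},$$ with $a_n>0$ and $b_n\in\mathbb{R}$; the $a_n$ ($n\ge1$) are the recurrence coefficients for $\mu$ referred to here. One defines $$W_n(\mu):=\frac{\|P_n(\cdot;\mu)\|_{L^2(\mu)}}{\mathrm{Cap}(\mathrm{supp}(\mu))^n}.$$ It holds that $\mathrm{Cap}(\mathrm{supp}(\mu_K))=\mathrm{Cap}(K)$.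 Periodic limit: if $K=T_N^{-1}([-1,1])$ for an admissible polynomial $T_N$ of degree $N$, it is known that there is a sequence $(a_n')_{n=1}^\infty$ with $a_{k+N}'=a_k'$ for every $k\in\mathbb{N}$ such that $a_n-a_n'\to0$ as $n\to\infty$, where $(a_n)$ are the recurrence coefficients for $\mu_K$; $(a_n')$ is called the periodic limit of $(a_n)$. *)

(* Defs.v *)
From HB Require Import structures.
From mathcomp Require Import all_boot all_order all_algebra.
From mathcomp Require Import all_classical all_reals all_analysis.
Set Implicit Arguments.
Unset Strict Implicit.
Unset Printing Implicit Defensive.
Import Order.TTheory GRing.Theory Num.Theory.
Import numFieldNormedType.Exports.

Local Open Scope classical_set_scope.
Local Open Scope ring_scope.

(* The kernel log(1/|x - y|) is written - log|x - y|, with lne 0 = -oo, so that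
   it takes the value +oo on the diagonal. *)
Definition log_energy (R : realType) (mu : probability (measurableTypeR R) R)
    : \bar R :=
  (\int[mu]_x \int[mu]_y (- lne `|x - y|%:E))%E.

(* A Borel probability measure on K is a Borel probability measure mu on the
   line with mu K = 1. *)
Definition min_log_energy (R : realType) (K : set R) : \bar R :=
  ereal_inf [set log_energy mu |
    mu in [set mu : probability (measurableTypeR R) R | mu K = 1%E]].

(* Logarithmic capacity exp(- inf energy), meant for compact K: the infimum is
   then greater than -oo, so that the exponential is finite; the infimum is +oo,
   and the capacity 0, exactly when K is polar. *)
Definition capacity (R : realType) (K : set R) : R :=
  fine (expeR (- min_log_energy K)%E).

(* Meant for non-polar compact K, for which there is exactly one such mu. *)
Definition is_equilibrium_measure (R : realType) (K : set R)
    (mu : probability (measurableTypeR R) R) : Prop :=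
  mu K = 1%E /\
  forall nu : probability (measurableTypeR R) R,
    nu K = 1%E -> (log_energy mu <= log_energy nu)%E.

Definition msupport (R : realType) (mu : probability (measurableTypeR R) R)
    : set R :=
  [set x | forall U : set R, open U -> U x -> (0 < mu U)%E].

Definition admissible (R : realType) (N : nat) (T : {poly R}) : Prop :=
  [/\ (2 <= N)%N,
      size T = N.+1,
      exists xs : N.-tuple R,
        sorted <%R xs /\ (forall x, x \in xs -> mup x T = 1%N)
    & exists ys : N.-1.-tuple R,
        [/\ sorted <%R ys,
            forall y, y \in ys -> root T^`() y
          & forall y, y \in ys -> 1 <= `|T.[y]| ] ].

Definition poly_preimage (R : realType) (T : {poly R}) : set R :=
  [set x | T.[x] \in `[-1, 1] ].

Definition L2norm (R : realType) (mu : probability (measurableTypeR R) R)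
    (P : {poly R}) : \bar R :=
  Lnorm mu 2%:E (fun x : R => (P.[x])%:E).

Definition is_orthopoly (R : realType) (mu : probability (measurableTypeR R) R)
    (n : nat) (P : {poly R}) : Prop :=
  [/\ P \is monic, size P = n.+1
    & forall Q : {poly R}, Q \is monic -> size Q = n.+1 ->
        (L2norm mu P <= L2norm mu Q)%E].

(* The polynomial P_n( . ; mu); the default value 0 is irrelevant when mu has
   infinite compact support. *)
Definition orthopoly (R : realType) (mu : probability (measurableTypeR R) R)
    (n : nat) : {poly R} :=
  xget 0 [set P | is_orthopoly mu n P].

(* P_{n-1}, with P_{-1} = 0. *)
Definition orthopoly_pred (R : realType)
    (mu : probability (measurableTypeR R) R) (n : nat) : {poly R} :=
  if n is m.+1 then orthopoly mu m else 0.

(* Only the entries a n with n >= 1 are meaningful: a 0 multiplies P_{-1}. *)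
Definition is_recurrence_coeffs (R : realType)
    (mu : probability (measurableTypeR R) R) (a : nat -> R) : Prop :=
  (forall n, (1 <= n)%N -> 0 < a n) /\
  exists b : nat -> R, forall n,
    orthopoly mu n.+1 =
      ('X - (b n.+1)%:P) * orthopoly mu n
      - (a n ^+ 2)%:P * orthopoly_pred mu n.

Definition widom_factor (R : realType)
    (mu : probability (measurableTypeR R) R) (n : nat) : \bar R :=
  (L2norm mu (orthopoly mu n) * (capacity (msupport mu) ^- n)%:E)%E.

(* Sequences are indexed from 1; the entry a' 0 is irrelevant. *)
Definition is_periodic_limit (R : realType) (N : nat) (a a' : nat -> R)
    : Prop :=
  (forall k, (1 <= k)%N -> a' (k + N)%N = a' k) /\
  (fun n => a n - a' n) @ \oo --> (0 : R).

(* (a_1 ... a_l) / Cap(K)^l *)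
Definition coeff_ratio (R : realType) (K : set R) (a : nat -> R) (l : nat) : R :=
  (\prod_(1 <= i < l.+1) a i) / capacity K ^+ l.

(* Main.v *)
(* The equilibrium measure of K = T^{-1}([-1, 1]) is the average, over the N
   inverse branches of T, of the arcsine law: the Chebyshev expansion of the
   logarithmic kernel, regularized and passed to the limit by Fatou's lemma, shows
   that its potential is constant on K, so that Cap(K)^N = 1/(2|c|), and that
   energy minimizers have the same polynomial moments.

   Let q_0 be monic of degree n > deg q_1, ..., deg q_J, and write
   T(x) = (t + 1/t)/2 with |t| = 1.  AM-GM over the N points of a fibre of T bounds
   the mean of |sum_i q_i(x) t^i|^2 from below by a product over the fibre, which is
   the modulus of a resultant, polynomial in t; the mean value property in t then
   bounds it by the value at t = 0, so that the mean is at least Cap(K)^{2n}.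

   J = 0 gives W_n >= 1, hence the lower bound in (c).  The monic Chebyshev
   polynomials of T have norm sqrt 2 Cap(K)^{lN}, so W_{lN} <= sqrt 2, which forces
   the products a'_1 ... a'_N = Cap(K)^N.  Finally, for q_i a multiple of
   P_{n - iN} with weights 1, -1/J, ..., -1/J, the mixed terms are computed by
   orthogonality, and because W_{n - iN}/W_{n - jN} -> 1 the bound becomes
   W_n^2 (1 + 1/J)/2 >= 1 - o(1), whence liminf W_n >= sqrt 2. *)
Require Import Defs.
From HB Require Import structures.
From mathcomp Require Import all_boot all_order all_algebra.
From mathcomp Require Import all_classical all_reals all_analysis.
From mathcomp Require cyclic polyrcf.
From mathcomp Require Import separable cyclotomic complex.
From mathcomp Require Import measurable_realfun ring lra zify.
Set Implicit Arguments.
Unset Strict Implicit.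
Unset Printing Implicit Defensive.
Import Order.TTheory GRing.Theory Num.Theory.
Import numFieldNormedType.Exports.

Local Open Scope ring_scope.

(** * A resultant and its mean value *)

(** Two restrictions shape the argument. The inverse branches are under control only over the open
    band -1 < w < 1, so circle averages are replaced by finite averages over rotated roots of unity,
    exact below their order, with a rotation that keeps every point off the real axis. And the given
    measure is known only as an energy minimizer: all later estimates see it through the functional
    [Ex] on polynomials, so agreement of polynomial moments takes the place of uniqueness of the
    equilibrium measure.

    The constant in the lower bound arises as follows. Because deg q_i < n for i > 0, the sum of the
    q_i(x) t^i is monic of degree n in x; its resultant with T - w, times t^n, is then a polynomial
    in t whose value at 0 has modulus 2^-n. The fibre product differs from the resultant by |c|^n,
    which leaves (2|c|)^-n = Cap(K)^(nN), and AM-GM over the fibre removes the exponent N. *)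

Lemma exists_char_poly (S : comNzRingType) n (p : {poly S}) :
  p \is monic -> size p = n.+1 -> exists A : 'M[S]_n, char_poly A = p.
Proof.
move=> pm sp; have e : (size p).-1 = n by rewrite sp.
by case: n / e {sp}; exists (companionmx p); exact: companionmxK.
Qed.

Lemma horner_char_poly (S : comNzRingType) n (A : 'M[S]_n) x :
  (char_poly A).[x] = \det (x%:M - A).
Proof.
rewrite -[_.[x]]/(horner_eval x _) -det_map_mx; congr (\det _).
by apply/matrixP => i j; rewrite !mxE /= /horner_eval hornerD hornerN hornerMn hornerX hornerC.
Qed.

(** The determinant of [T(A) - w] is the resultant of [T - w] and the characteristic polynomial of
    [A]. In this form it is polynomial in the entries of [A], so it commutes with evaluating entries
    that depend on t. *)
Lemma det_horner_mx_prod (S : comNzRingType) n (A : 'M[S]_n.+1) (T : {poly S})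
    (w c : S) N (xs : 'I_N -> S) :
  T - w%:P = c *: \prod_i ('X - (xs i)%:P) ->
  \det (horner_mx A T - w%:M)
    = c ^+ n.+1 * \prod_i ((- 1) ^+ n.+1 * (char_poly A).[xs i]).
Proof.
move=> e; have -> : horner_mx A T - w%:M = horner_mx A (T - w%:P).
  by rewrite rmorphB /= horner_mx_C.
rewrite e -mul_polyC rmorphM /= horner_mx_C -mulmxE detM det_scalar; congr (_ * _).
rewrite rmorph_prod /= (big_morph (fun B : 'M[S]_n.+1 => \det B) (@detM _ _) (det1 _ _)).
apply: eq_bigr => i _; rewrite rmorphB /= horner_mx_X horner_mx_C.
by rewrite horner_char_poly -detZ scaleN1r opprB.
Qed.

(* With w = (t + 1/t) / 2, the resultant of h_t and T - w, cleared of negative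
   powers of t, is a polynomial in t whose constant term does not depend on h. *)
Lemma joukowski_resultant (C : numClosedFieldType) n (h : {poly {poly C}})
    (T : {poly C}) :
  h \is monic -> size h = n.+2 ->
  exists2 F : {poly C}, F.[0] = (- 2^-1) ^+ n.+1 &
    forall t c N (xs : 'I_N -> C), t != 0 ->
      T - ((t + t^-1) / 2)%:P = c *: \prod_i ('X - (xs i)%:P) ->
      F.[t] = (t * c) ^+ n.+1 * \prod_i ((- 1) ^+ n.+1
                * (map_poly (horner_eval t) h).[xs i]).
Proof.
move=> hm sh; have [A hA] := exists_char_poly hm sh.
(* [B] is t (T(A) - w) for w = (t + 1/t)/2, free of 1/t. At t = 0 it is the scalar matrix -1/2,
   whatever [A] is. *)
pose B := 'X%:M * horner_mx A (map_poly polyC T) - (2^-1 *: ('X^2 + 1))%:M.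
have BE t : map_mx (horner_eval t) B
    = t%:M * horner_mx (map_mx (horner_eval t) A) T - ((t ^+ 2 + 1) / 2)%:M.
  rewrite map_mxB map_scalar_mx -mulmxE map_mxM map_scalar_mx map_horner_mx /=.
  have -> : map_poly (horner_eval t) (map_poly polyC T) = T.
    by apply/polyP => i; rewrite !coef_map /= /horner_eval hornerC.
  by rewrite /horner_eval !hornerE [_ / 2]mulrC.
exists (\det B) => [|t c N xs t0 e].
  rewrite -[_.[0]]/(horner_eval 0 _) -det_map_mx BE.
  have -> : 0%:M = 0 :> 'M[C]_n.+1 by apply/matrixP => i j; rewrite !mxE mul0rn.
  by rewrite mul0r sub0r expr0n add0r mul1r -raddfN det_scalar.
rewrite -[_.[t]]/(horner_eval t _) -det_map_mx BE.
have -> : t%:M * horner_mx (map_mx (horner_eval t) A) T - ((t ^+ 2 + 1) / 2)%:M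
   = t%:M *m (horner_mx (map_mx (horner_eval t) A) T - ((t + t^-1) / 2)%:M).
  rewrite mulmxBr -mulmxE -scalar_mxM; congr (_ - _%:M); field.
  by [].
rewrite det_mulmx det_scalar (det_horner_mx_prod _ e) mulrA -exprMn.
by rewrite -map_char_poly hA.
Qed.

Lemma sum_expr_eq0 (F : fieldType) (Q : nat) (z : F) :
  z != 1 -> z ^+ Q = 1 -> \sum_(k < Q) z ^+ k = 0.
Proof.
move=> z1 zQ; apply: (mulfI (x := z - 1)); first by rewrite subr_eq0.
by rewrite -subrX1 zQ subrr mulr0.
Qed.

Lemma sum_prim_expr (F : fieldType) (Q : nat) (z : F) j :
  (0 < j < Q)%N -> Q.-primitive_root z -> \sum_(k < Q) (z ^+ k) ^+ j = 0.
Proof.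
move=> /andP[j0 jQ] pz.
under eq_bigr do rewrite exprAC.
apply: sum_expr_eq0; last by rewrite exprAC (prim_expr_order pz) expr1n.
by rewrite -(prim_order_dvd pz) gtnNdvd.
Qed.

(** The finite substitute for a circle average: summing over the Q-th roots of unity annihilates
    every power t^j with 0 < j < Q, and the rotation [eta] merely multiplies such a sum by
    [eta ^+ j]. *)
Lemma mean_prim_root (F : fieldType) (Q : nat) (z eta : F) (G : {poly F}) :
  (size G <= Q)%N -> Q.-primitive_root z ->
  \sum_(k < Q) G.[z ^+ k * eta] = G.[0] *+ Q.
Proof.
move=> sG pz; under eq_bigr do rewrite (horner_coef_wide _ sG).
rewrite exchange_big /=; case: Q => [|Q] in sG pz *; first by rewrite big_ord0.
rewrite big_ord_recl /= [X in _ + X]big1 ?addr0 => [|i _].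
  under eq_bigr do rewrite expr0 mulr1.
  by rewrite sumr_const card_ord horner_coef0.
under eq_bigr do rewrite exprMn mulrCA.
rewrite -mulr_suml sum_prim_expr ?mul0r //.
by have := ltn_ord i; rewrite /bump leq0n; lia.
Qed.

Lemma exists_prim_root (C : numClosedFieldType) n : (0 < n)%N ->
  exists z : C, n.-primitive_root z.
Proof.
move=> n0; pose p : {poly C} := 'X^n - 1.
have [r Dp] := closed_field_poly_normal p.
have sp : size p = n.+1 by rewrite size_XnsubC.
move: Dp; rewrite (monicP _) ?monicXnsubC // scale1r => Dp.
have rn : all n.-unity_root r by apply/allP => x; rewrite unity_rootE -root_prod_XsubC -Dp /root !hornerE subr_eq0.
have ur : uniq r.
  rewrite -separable_prod_XsubC -Dp separable_Xn_sub_1 // pnatr_eq0.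
  by rewrite -lt0n.
have sr : (n <= size r)%N by move: sp; rewrite Dp size_prod_XsubC => -[->].
by have /hasP[z _ pz] := cyclic.has_prim_root n0 rn ur sr; exists z.
Qed.

Lemma norm_root1 (C : numClosedFieldType) (z : C) n : (0 < n)%N ->
  `|z ^+ n| = 1 -> `|z| = 1.
Proof. by move=> n0 /eqP; rewrite normrX pexpr_eq1 // => /eqP. Qed.

(* Mean value property for the polynomial tau |-> prod_k F(z^k tau), on
   points tau whose powers of order Q equal 'i, so that z^k tau <> 1, -1. *)
Lemma exists_rotated_roots (C : numClosedFieldType) (F : {poly C}) (M : nat)
    (z : C) : M.-primitive_root z ->
  exists2 tau : C, `|tau| = 1 /\ (forall k, ~~ (z ^+ k * tau \is Num.real)) &
    `|F.[0]| ^+ M <= \prod_(k < M) `|F.[z ^+ k * tau]|.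
Proof.
move=> pz; have M0 := prim_order_gt0 pz.
pose G := \prod_(k < M) (F \Po (z ^+ k *: 'X)).
have GE t : G.[t] = \prod_(k < M) F.[z ^+ k * t].
  by rewrite horner_prod; apply: eq_bigr => k _; rewrite horner_comp !hornerE.
pose Q := (M * (size G).+1)%N.
have Q0 : (0 < Q)%N by rewrite muln_gt0 M0.
have sG : (size G <= Q)%N by rewrite /Q; nia.
have [x px] := exists_prim_root C Q0.
pose eta : C := Q.-root 'i.
have etaQ : eta ^+ Q = 'i by rewrite rootCK.
have m := mean_prim_root eta sG px.
have [k hk] : exists k : 'I_Q, `|G.[0]| <= `|G.[x ^+ k * eta]|.
  apply/existsP; apply: contraT; rewrite negb_exists => /forallP h.
  have : `|\sum_(k < Q) G.[x ^+ k * eta]| < \sum_(k < Q) `|G.[0]|.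
    apply: le_lt_trans (ler_norm_sum _ _ _) _.
    apply: ltr_sum; first by apply/hasP; exists (Ordinal Q0); rewrite ?mem_index_enum.
    move=> i _; rewrite real_ltNge ?normr_real //; exact: h.
  by rewrite m sumr_const card_ord normrMn ltxx.
have tQ j : (z ^+ j * (x ^+ k * eta)) ^+ Q = 'i.
  rewrite exprMn exprAC {1}/Q exprM (prim_expr_order pz) !expr1n mul1r.
  by rewrite exprMn exprAC (prim_expr_order px) expr1n mul1r.
exists (x ^+ k * eta); last first.
  apply: le_trans (_ : `|G.[0]| <= _).
    rewrite GE normr_prod; under eq_bigr do rewrite mulr0.
    by rewrite prodr_const card_ord.
  by rewrite (le_trans hk) // GE normr_prod.
split; first by apply: (norm_root1 Q0); have := tQ 0%N; rewrite expr0 mul1r => ->; rewrite normCi.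
move=> j; apply/negP => /(rpredX Q); rewrite tQ.
by move/Creal_ImP; rewrite Im_i => /eqP; rewrite oner_eq0.
Qed.

(** * Chebyshev polynomials *)

Fixpoint cheb_pair (R : comNzRingType) (n : nat) : {poly R} * {poly R} :=
  if n is m.+1 then
    let pq := cheb_pair R m in (pq.2, 'X *+ 2 * pq.2 - pq.1)
  else (1, 'X).

Definition cheb (R : comNzRingType) n : {poly R} := (cheb_pair R n).1.

Section Chebyshev.
Variable R : comNzRingType.

Lemma cheb0 : cheb R 0 = 1. Proof. by []. Qed.
Lemma cheb1 : cheb R 1 = 'X. Proof. by []. Qed.
Lemma chebSS n : cheb R n.+2 = 'X *+ 2 * cheb R n.+1 - cheb R n.
Proof. by []. Qed.

Lemma cheb_ind2 (P : nat -> Prop) :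
  P 0%N -> P 1%N -> (forall n, P n -> P n.+1 -> P n.+2) -> forall n, P n.
Proof.
move=> P0 P1 PS n; suff : P n /\ P n.+1 by case.
by elim: n => [|n [? ?]]; split => //; apply: PS.
Qed.

End Chebyshev.

Lemma map_cheb (R S : comNzRingType) (f : {rmorphism R -> S}) n :
  map_poly f (cheb R n) = cheb S n.
Proof.
elim/cheb_ind2: n => [||n IH1 IH2]; rewrite ?rmorph1 ?map_polyX //.
by rewrite !chebSS rmorphB rmorphM rmorphMn /= map_polyX IH1 IH2.
Qed.

Lemma horner_cheb_joukowski (F : numFieldType) (t : F) k : t != 0 ->
  (cheb F k).[(t + t^-1) / 2] = (t ^+ k + t ^- k) / 2.
Proof.
move=> t0; elim/cheb_ind2: k => [||n IH1 IH2].
- by rewrite cheb0 hornerC !expr0 invr1; field.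
- by rewrite cheb1 hornerX !expr1.
rewrite chebSS hornerD hornerN hornerM hornerMn hornerX IH1 IH2 !exprS.
by field; rewrite t0 expf_neq0.
Qed.

Lemma size_lead_cheb (R : idomainType) n : 2%:R != 0 :> R ->
  size (cheb R n.+1) = n.+2 /\ lead_coef (cheb R n.+1) = 2 ^+ n.
Proof.
move=> two0; suff : (size (cheb R n.+1) = n.+2 /\ lead_coef (cheb R n.+1) = 2 ^+ n)
    /\ (size (cheb R n) = n.+1) by case.
elim: n => [|n [[s l] s']].
  by rewrite cheb1 cheb0 size_polyX lead_coefX size_poly1.
have e : 'X *+ 2 * cheb R n.+1 = 2 *: (cheb R n.+1 * 'X).
  by rewrite mulrnAl mulrC scaler_nat.
have n0 : cheb R n.+1 != 0 by rewrite -size_poly_gt0 s.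
have ss : size ('X *+ 2 * cheb R n.+1) = n.+3.
  by rewrite e size_scale // size_mulX // s.
rewrite chebSS; split; last by [].
have lt : (size (- cheb R n)%R < size ('X *+ 2 * cheb R n.+1)%R)%N.
  by rewrite ss size_polyN s'.
rewrite size_polyDl ?lead_coefDl //; split => //.
by rewrite e lead_coefZ lead_coefMX l exprS.
Qed.

(* Since cheb k has mean 0 for k > 0, alpha 0 is the mean of A. *)
Lemma cheb_decomposition (R : numFieldType) (A : {poly R}) :
  exists (m : nat) (alpha : nat -> R),
    A = (alpha 0%N)%:P + \sum_(1 <= j < m) alpha j *: cheb R j.
Proof.
have [m] := ubnP (size A); elim: m A => // m IH A; rewrite ltnS => sA.
case: m => [|m] in IH sA *.
  exists 0%N, (fun=> 0); rewrite big_geq // addr0; apply/eqP.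
  by rewrite -size_poly_eq0 -leqn0.
case: m => [|m] in IH sA *.
  by exists 0%N, (fun=> A`_0); rewrite big_geq // addr0; apply: size1_polyC.
have two0 : 2 != 0 :> R by rewrite pnatr_eq0.
have [ss ls] := size_lead_cheb m two0.
pose b := A`_m.+1 / 2 ^+ m.
have [] := IH (A - b *: cheb R m.+1).
  rewrite ltnS; apply/leq_sizeP => j; rewrite leq_eqVlt => /orP[/eqP<-|mj].
    have -> : (A - b *: cheb R m.+1)`_m.+1 = A`_m.+1 - b * lead_coef (cheb R m.+1).
      by rewrite coefB coefZ /lead_coef ss.
    by rewrite ls divfK ?subrr // expf_neq0 // pnatr_eq0.
  by rewrite coefB coefZ !nth_default ?mulr0 ?subr0 ?ss // (leq_trans sA).
move=> k [al e]; exists (maxn k m.+2),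
  (fun j => (if (j < k)%N || (j == 0%N) then al j else 0) + b * (j == m.+1)%:R).
rewrite mulr0 addr0 orbT /=.
rewrite -[LHS](subrK (b *: cheb R m.+1)) e -addrA; congr (_ + _).
under eq_bigr do rewrite scalerDl.
rewrite big_split /=; congr (_ + _).
  case: (posnP k) => [->|k0].
    rewrite big_geq // big_nat big1 // => j /andP[j1 _].
    by rewrite ltn0 (gtn_eqF j1) scale0r.
  rewrite [RHS](big_cat_nat (n := k)) //= ?leq_maxl //.
  rewrite [X in _ = _ + X]big_nat [X in _ = _ + X]big1 ?addr0; last first.
    move=> j /andP[kj _]; rewrite ltnNge kj /= gtn_eqF ?scale0r //.
    exact: leq_trans kj.
  by apply: eq_big_nat => j /andP[_ ->].
rewrite (bigD1_seq m.+1) ?iota_uniq //=; last first.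
  by rewrite mem_index_iota /= leq_max ltnSn orbT.
by rewrite eqxx mulr1 big1 ?addr0 // => j /negPf->; rewrite mulr0 scale0r.
Qed.

(** The dimension is a parameter separate from [p], so that specializing the coefficients gives a
    matrix of the same type. *)
Definition companion (S : nzRingType) n (p : seq S) : 'M[S]_n :=
  \matrix_(i, j) if i == n.-1 :> nat then - p`_j else (i.+1 == j)%:R.

Lemma companion_Vandermonde (S : comNzRingType) n (p : {poly S}) (a : 'rV[S]_n.+1) :
  p \is monic -> size p = n.+2 -> (forall j, root p (a 0 j)) ->
  companion n.+1 p *m Vandermonde n.+1 a = Vandermonde n.+1 a *m diag_mx a.
Proof.
move=> pm sp pr; apply/matrixP => i j.
rewrite mul_mx_diag !mxE; have [ein|nein] := eqVneq (i : nat) n.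
  under eq_bigr do rewrite !mxE ein eqxx mulNr.
  rewrite sumrN ein /= -exprSr; apply/eqP; rewrite eq_sym -subr_eq0 opprK.
  have /rootP := pr j; rewrite horner_coef sp big_ord_recr /=.
  by have := monicP pm; rewrite lead_coefE sp /= => ->; rewrite mul1r addrC => ->.
have lt : (i.+1 < n.+1)%N by have := ltn_ord i; lia.
under eq_bigr do rewrite !mxE (negPf nein).
rewrite (bigD1 (Ordinal lt)) //= eqxx mul1r big1 ?addr0 ?exprSr // => k.
by rewrite -val_eqE /= eq_sym => /negPf->; rewrite mul0r.
Qed.

(** The fibre sum is the trace of [f] at the companion matrix of (T - w)/c, whose entries are
    polynomials in w. As the roots are distinct, conjugation by their Vandermonde matrix
    diagonalizes it. *)
Lemma sum_fibre_poly (F : fieldType) (T f : {poly F}) n : size T = n.+2 ->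
  exists A : {poly F}, forall w (xs : 'I_n.+1 -> F), injective xs ->
    T - w%:P = lead_coef T *: \prod_i ('X - (xs i)%:P) ->
    \sum_i f.[xs i] = A.[w].
Proof.
move=> sT; set c := lead_coef T.
have c0 : c != 0 by rewrite lead_coef_eq0 -size_poly_gt0 sT.
pose h : {poly {poly F}} := map_poly polyC (c^-1 *: T) - (c^-1 *: 'X)%:P.
have hE j : h`_j = (c^-1 * T`_j)%:P - (if j == 0%N then c^-1 *: 'X else 0).
  by rewrite /h coefB coef_map coefZ coefC.
pose A0 := companion n.+1 h.
exists (\tr (horner_mx A0 (map_poly polyC f))) => w xs ixs e.
rewrite -[_.[w]]/(horner_eval w _) -trace_map_mx map_horner_mx.
have -> : map_poly (horner_eval w) (map_poly polyC f) = f.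
  by apply/polyP => i; rewrite !coef_map /= /horner_eval hornerC.
pose p : {poly F} := c^-1 *: (T - w%:P).
have pE : p = \prod_i ('X - (xs i)%:P) by rewrite /p e scalerA mulVf // scale1r.
have pEj j : p`_j = c^-1 * T`_j - (if j == 0%N then c^-1 * w else 0).
  by rewrite /p coefZ coefB coefC mulrBr; case: ifP; rewrite ?mulr0.
have -> : map_mx (horner_eval w) A0 = companion n.+1 p.
  apply/matrixP => i j; rewrite !mxE; case: ifP => _; rewrite /horner_eval.
    by rewrite hornerN hE hornerD hornerN pEj hornerC; case: ifP; rewrite ?hornerZ ?hornerX ?horner0.
  by rewrite -polyC_natr hornerC.
have pm : p \is monic by rewrite pE monic_prod // => i _; rewrite monicXsubC.
have sp : size p = n.+2.
  by rewrite pE size_prod_XsubC /index_enum -enumT size_enum_ord.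
pose a := \row_i xs i.
have aE i : a 0 i = xs i by rewrite mxE.
have ra j : root p (a 0 j).
  by rewrite aE pE -(big_map xs xpredT (fun z => 'X - z%:P)) root_prod_XsubC map_f ?mem_index_enum.
have eV := companion_Vandermonde pm sp ra.
have uV : Vandermonde n.+1 a \in unitmx.
  rewrite unitmxE det_Vandermonde unitfE; apply/prodf_neq0 => i _.
  apply/prodf_neq0 => j ij; rewrite !aE subr_eq0 (inj_eq ixs).
  by apply/eqP => ji; rewrite ji ltnn in ij.
have -> : companion n.+1 p = Vandermonde n.+1 a *m diag_mx a *m invmx (Vandermonde n.+1 a).
  by rewrite -eV mulmxK.
rewrite horner_mx_uconj // mxtrace_mulC mulmxA mulVmx // mul1mx horner_mx_diag.
by rewrite mxtrace_diag; apply: eq_bigr => i _; rewrite !mxE.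
Qed.

(** * A Jensen inequality *)

(* With T x = (t + 1/t)/2 and |t| = 1, this is |sum_i q_i(x) t^i|^2 averaged over
   t and 1/t. *)
Definition cheb_gram (R : comNzRingType) (T : {poly R}) (J : nat)
    (q : nat -> {poly R}) : {poly R} :=
  \sum_(i < J.+1) \sum_(j < J.+1)
    q i * q j * (cheb R (i - j + (j - i)) \Po T).

Section Jensen.
Local Open Scope complex_scope.
Variable R : rcfType.
Local Notation C := R[i].
Local Notation toC := (real_complex R).

Lemma invc_unit_circle (t : C) : `|t| = 1 -> t^-1 = t^*.
Proof. by move=> t1; rewrite invc_norm t1 expr1n invr1 mul1r. Qed.

Lemma Re_unit_circle (t : C) : `|t| = 1 ->
  (complex.Re t)%:C = (t + t^-1) / 2.
Proof. by move=> t1; rewrite ReJ_add (invc_unit_circle t1). Qed.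

Lemma Re_unit_circle_lt1 (t : C) : `|t| = 1 -> t \isn't Num.real ->
  -1 < complex.Re t < 1.
Proof.
case: t => a b; rewrite complex_real normc_def /= => -[h] b0.
have : a ^+ 2 + b ^+ 2 = 1 by rewrite -[LHS]sqr_sqrtr ?h ?expr1n // addr_ge0 ?sqr_ge0.
have : 0 < b ^+ 2 by rewrite exprn_even_gt0.
by move=> *; nra.
Qed.

Lemma cheb_Re (t : C) k : `|t| = 1 ->
  ((cheb R k).[complex.Re t])%:C = (t ^+ k + t ^- k) / 2.
Proof.
move=> t1; have t0 : t != 0 by rewrite -normr_gt0 t1.
rewrite -horner_cheb_joukowski // -Re_unit_circle // -(map_cheb toC).
by rewrite horner_map.
Qed.

(** On the unit circle the conjugate of t is 1/t, so the square expands into powers t^(i-j).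
    Exchanging i and j symmetrizes them to (t^(i-j) + t^(j-i))/2, the Chebyshev polynomial of index
    |i - j| at Re t. *)
Lemma sqr_norm_eval (t : C) (x : R) T J (q : nat -> {poly R}) : `|t| = 1 -> T.[x] = complex.Re t ->
  `|\sum_(i < J.+1) t ^+ i * ((q i).[x])%:C| ^+ 2
    = ((cheb_gram T J q).[x])%:C.
Proof.
move=> t1 Tx; have t0 : t != 0 by rewrite -normr_gt0 t1.
rewrite sqr_normc rmorph_sum /= big_distrlr /=.
rewrite /cheb_gram horner_sum rmorph_sum /=.
under [RHS]eq_bigr => i _ do rewrite horner_sum rmorph_sum /=.
have cE i j : ((q i * q j * (cheb R (i - j + (j - i)) \Po T)).[x])%:C
   = ((q i).[x])%:C * ((q j).[x])%:C * ((t ^+ i / t ^+ j + t ^+ j / t ^+ i) / 2).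
  rewrite !hornerM horner_comp Tx !rmorphM /= cheb_Re //; congr (_ * (_ / 2)).
  (* Subtraction is truncated: one of the two differences is 0, and the index is |i - j|. *)
  wlog ij : i j / (i <= j)%N.
    move=> H; case: (leqP i j) => [/H//|/ltnW /H].
    by rewrite addnC => ->; rewrite addrC.
  rewrite (eqP ij) add0n -{3 4}(subnK ij) exprD.
  by field; rewrite !expf_neq0.
under [RHS]eq_bigr => i _ do under eq_bigr => j _ do rewrite cE.
have eL : \sum_(i < J.+1) \sum_(j < J.+1)
      ((q i).[x])%:C * ((q j).[x])%:C * (t ^+ i / t ^+ j) =
    \sum_(i < J.+1) \sum_(j < J.+1)
      ((q i).[x])%:C * ((q j).[x])%:C * (t ^+ j / t ^+ i).
  rewrite exchange_big /=; apply: eq_bigr => i _; apply: eq_bigr => j _.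
  by rewrite [X in X * _]mulrC.
transitivity (\sum_(i < J.+1) \sum_(j < J.+1)
      ((q i).[x])%:C * ((q j).[x])%:C * (t ^+ i / t ^+ j)).
  apply: eq_bigr => i _; apply: eq_bigr => j _.
  rewrite rmorphM rmorphXn /=.
  rewrite oppr0 complexr0 -[conjc t]invc_unit_circle // exprVn.
  by ring.
transitivity ((\sum_(i < J.+1) \sum_(j < J.+1)
      ((q i).[x])%:C * ((q j).[x])%:C * (t ^+ i / t ^+ j) +
    \sum_(i < J.+1) \sum_(j < J.+1)
      ((q i).[x])%:C * ((q j).[x])%:C * (t ^+ j / t ^+ i)) / 2).
  by rewrite -eL -mulr2n -[_ *+ 2]mulr_natr mulfK // pnatr_eq0.
rewrite -big_split /= mulr_suml; apply: eq_bigr => i _.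
rewrite -big_split /= mulr_suml; apply: eq_bigr => j _.
by rewrite -mulrDr mulrA.
Qed.

Lemma cheb_gram_ge0 T J (q : nat -> {poly R}) (x : R) : -1 <= T.[x] <= 1 ->
  0 <= (cheb_gram T J q).[x].
Proof.
move=> /andP[h1 h2]; pose t : C := Complex T.[x] (Num.sqrt (1 - T.[x] ^+ 2)).
have t1 : `|t| = 1.
  rewrite normc_def /= sqr_sqrtr; last by rewrite subr_ge0; nra.
  by rewrite addrCA subrr addr0 sqrtr1.
rewrite -lecR -(sqr_norm_eval (t := t) (T := T)) //; exact: exprn_ge0.
Qed.

Lemma sum_inv_unit_circle M (t : 'I_M -> C) j : (forall k, `|t k| = 1) ->
  \sum_k t k ^+ j = 0 -> \sum_k t k ^- j = 0.
Proof.
move=> t1 s0; have := congr1 (@conjc R) s0; rewrite rmorph_sum rmorph0 => {2}<-.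
by apply: eq_bigr => k _; rewrite rmorphXn /= -invc_unit_circle // exprVn.
Qed.

Lemma sqr_norm_twisted_prod (t : C) (c : R) m N (y : 'I_N -> C)
    (f : 'I_N -> R) : `|t| = 1 -> (forall i, `|y i| ^+ 2 = (f i)%:C) ->
  `|(t * c%:C) ^+ m * \prod_i ((- 1) ^+ m * y i)| ^+ 2
    = ((c ^+ 2) ^+ m * \prod_i f i)%:C.
Proof.
move=> t1 hf; rewrite normrM normrX normrM t1 mul1r normr_prod exprMn.
rewrite rmorphM rmorphXn rmorph_prod /=; congr (_ * _).
  by rewrite exprAC -add_Re2_Im2 /= expr0n addr0.
rewrite -prodrXl; apply: eq_bigr => i _.
by rewrite normrM normrX normrN1 expr1n mul1r.
Qed.

Variables (T : {poly R}) (N : nat) (g : 'I_N -> R -> R).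
Hypothesis splitT : forall w : R, -1 < w < 1 ->
  T - w%:P = lead_coef T *: \prod_i ('X - (g i w)%:P).

Lemma horner_split i (w : R) : -1 < w < 1 -> T.[g i w] = w.
Proof.
move=> hw; have /(congr1 (horner^~ (g i w))) := splitT hw.
rewrite hornerD hornerN hornerC hornerZ horner_prod (bigD1 i) //=.
by rewrite hornerXsubC subrr mul0r mulr0 => /eqP; rewrite subr_eq0 => /eqP.
Qed.

(** [al 0] is the fibre sum averaged over the circle. |F(0)| is 2^-(d+1), and |F(t)|^2 is c^(2(d+1))
    times the product of the Gram polynomial over the fibre of Re t; dividing out c gives the
    constant on the left. *)
Lemma jensen_mean (d J m : nat) (q : nat -> {poly R}) (al : nat -> R) :
  (0 < N)%N -> T != 0 ->
  q 0%N \is monic -> size (q 0%N) = d.+2 ->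
  (forall i, (0 < i <= J)%N -> (size (q i) <= d.+1)%N) ->
  (forall w : R, -1 < w < 1 -> \sum_i (cheb_gram T J q).[g i w]
     = al 0%N + \sum_(1 <= j < m) al j * (cheb R j).[w]) ->
  ((2 * `|lead_coef T|)^-1) ^+ (2 * d.+1) <= (al 0%N / N%:R) ^+ N.
Proof.
move=> N0 T0 qm sq0 sqi hA; set c := lead_coef T; set f := cheb_gram T J q.
have c0 : c != 0 by rewrite lead_coef_eq0.
(* Above every index j of the expansion, so that the terms with j >= 1 average to 0 over the [M]
   points; the successor keeps [M] positive when [m] is 0. *)
pose M := m.+1.
have [z pz] := exists_prim_root C (ltn0Sn m : (0 < M)%N).
pose h : {poly {poly C}} :=
  \sum_(i < J.+1) ('X^i)%:P * map_poly (polyC \o toC) (q i).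
have sh0 : size (map_poly (polyC \o toC) (q 0%N)) = d.+2.
  by rewrite size_map_poly.
pose r : {poly {poly C}} :=
  \sum_(i < J) ('X^(i.+1))%:P * map_poly (polyC \o toC) (q i.+1).
have hE : h = map_poly (polyC \o toC) (q 0%N) + r.
  by rewrite /h big_ord_recl expr0 mul1r.
have slt : (size r < size (map_poly (polyC \o toC) (q 0%N)))%N.
  rewrite sh0 ltnS; apply: (leq_trans (size_sum _ _ _)).
  apply/bigmax_leqP => i _; rewrite mul_polyC.
  apply: (leq_trans (size_scale_leq _ _)); apply: (leq_trans (size_poly _ _)).
  by apply: sqi; rewrite /= ltn_ord.
have sh : size h = d.+2 by rewrite hE size_polyDl // sh0.
have hm : h \is monic.
  by rewrite monicE hE lead_coefDl // -monicE map_monic.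
have [F F0 FE] := joukowski_resultant (map_poly toC T) hm sh.
have [tau [tau1 ntau] Fge] := exists_rotated_roots F pz.
pose t (k : 'I_M) := z ^+ k * tau.
have z1 : `|z| = 1.
  by apply: (norm_root1 (prim_order_gt0 pz)); rewrite prim_expr_order // normr1.
have t1 k : `|t k| = 1 by rewrite /t normrM normrX z1 expr1n mul1r.
have t0 k : t k != 0 by rewrite -normr_gt0 t1.
pose w k := complex.Re (t k).
have hw k : -1 < w k < 1 by apply: Re_unit_circle_lt1 => //; exact: ntau.
have htE k (x : R) : (map_poly (horner_eval (t k)) h).[x%:C]
    = \sum_(i < J.+1) t k ^+ i * ((q i).[x])%:C.
  rewrite /h rmorph_sum /= horner_sum; apply: eq_bigr => i _.
  rewrite rmorphM hornerM /=; congr (_ * _).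
    by rewrite map_polyC /= hornerC /horner_eval hornerXn.
  rewrite -horner_map /=; congr (_.[_]); apply/polyP => j.
  by rewrite !coef_map /= /horner_eval hornerC.
have FN k : `|F.[t k]| ^+ 2 = ((c ^+ 2) ^+ d.+1 * \prod_i f.[g i (w k)])%:C.
  have e : map_poly toC T - ((t k + (t k)^-1) / 2)%:P
      = c%:C *: \prod_i ('X - ((g i (w k))%:C)%:P).
    rewrite -Re_unit_circle // -map_polyC -rmorphB /= splitT ?hw //.
    rewrite map_polyZ rmorph_prod /=; congr (_ *: _); apply: eq_bigr => i _.
    by rewrite rmorphB /= map_polyX map_polyC.
  rewrite (FE _ _ _ _ (t0 k) e); apply: sqr_norm_twisted_prod => // i.
  by rewrite htE; apply: sqr_norm_eval => //; apply: horner_split.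
have f0 k i : 0 <= f.[g i (w k)].
  rewrite -lecR -(sqr_norm_eval (t := t k) (T := T)) ?exprn_ge0 //.
  exact: horner_split.
have key : (2^-1 ^+ 2) ^+ (d.+1 * M)
     <= ((c ^+ 2) ^+ d.+1) ^+ M * \prod_k \prod_i f.[g i (w k)].
  rewrite -lecR; apply: (@le_trans _ _ ((`|F.[0]| ^+ M) ^+ 2)).
    rewrite F0 normrX normrN -exprM -exprM mulnC exprM.
    rewrite ger0_norm ?invr_ge0 //.
    by rewrite rmorphXn rmorphXn /= fmorphV rmorph_nat exprM -!exprM mulnA.
  apply: (@le_trans _ _ ((\prod_(k < M) `|F.[z ^+ k * tau]|) ^+ 2)).
    by rewrite ler_pXn2r // nnegrE ?exprn_ge0 // prodr_ge0.
  rewrite -prodrXl; under eq_bigr do rewrite FN.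
  rewrite -rmorph_prod /= lecR big_split /= prodr_const card_ord //.
have sumA : \sum_k \sum_i f.[g i (w k)] = al 0%N *+ M.
  under eq_bigr do rewrite hA //.
  rewrite big_split /= sumr_const card_ord exchange_big /= big_nat big1 ?addr0 //.
  move=> j /andP[j1 jm]; rewrite -mulr_sumr.
  suff -> : \sum_(k < M) (cheb R j).[w k] = 0 by rewrite mulr0.
  apply: complexI; rewrite rmorph_sum rmorph0 /=.
  under eq_bigr do rewrite cheb_Re //.
  have s0 : \sum_(k < M) t k ^+ j = 0.
    under eq_bigr do rewrite exprMn.
    by rewrite -mulr_suml sum_prim_expr ?mul0r // j1 ltnS ltnW.
  rewrite -mulr_suml big_split /= s0 add0r.
  suff -> : \sum_(k < M) t k ^- j = 0 by rewrite mul0r.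
  exact: sum_inv_unit_circle.
(* AM-GM is applied to all [M * N] values at once; their sum is [al 0 *+ M]. *)
have := @leif_AGM R ('I_M * 'I_N)%type xpredT (fun p => f.[g p.2 (w p.1)])
  (fun p _ => f0 _ _).
rewrite card_prod !card_ord -(pair_bigA _ (fun k i => f.[g i (w k)])) /=.
rewrite -(pair_bigA _ (fun k i => f.[g i (w k)])) /= sumA => -[AGM _].
have al0 : 0 <= al 0%N.
  rewrite -(pmulrn_lge0 _ (ltn0Sn m)) -/M -sumA.
  by apply: sumr_ge0 => k _; apply: sumr_ge0.
have M0 : (0 < M)%N by [].
rewrite -(ler_pXn2r M0) ?nnegrE ?exprn_ge0 ?divr_ge0 ?ler0n ?invr_ge0 ?mulr_ge0 //.
have -> : (al 0%N / N%:R) ^+ N ^+ M = (al 0%N *+ M / (M * N)%:R) ^+ (M * N).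
  rewrite -exprM mulnC; congr (_ ^+ _); rewrite natrM -mulr_natr.
  by field; rewrite !pnatr_eq0 -!lt0n N0.
apply: le_trans AGM.
have c2 : c ^+ 2 = `|c| ^+ 2 by rewrite real_normK ?num_real.
have cp : 0 < ((c ^+ 2) ^+ d.+1) ^+ M.
  by do 2 apply: exprn_gt0; rewrite exprn_even_gt0.
rewrite -(ler_pM2l cp) (le_trans _ key) // c2 -!exprM !mulnA -exprMn.
by rewrite invfM mulrCA mulfV ?normr_eq0 // mulr1.
Qed.

End Jensen.

(** * Orthogonal polynomials of a positive functional *)

Section Orthogonal.
Variables (R : realFieldType) (E : {poly R} -> R).
Hypotheses (ED : forall p q : {poly R}, E (p + q) = E p + E q)
  (EZ : forall a (p : {poly R}), E (a *: p) = a * E p)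
  (Epos : forall p : {poly R}, p != 0 -> 0 < E (p * p)).

Definition orthogonal_monic n (P : {poly R}) :=
  [/\ P \is monic, size P = n.+1 &
      forall q : {poly R}, (size q <= n)%N -> E (P * q) = 0].

Lemma functional0 : E 0 = 0.
Proof. by rewrite -(scale0r (0 : {poly R})) EZ mul0r. Qed.

Lemma functionalB p q : E (p - q) = E p - E q.
Proof. by rewrite ED -scaleN1r EZ mulN1r. Qed.

Lemma functional_sum (I : Type) (s : seq I) (F : I -> {poly R}) :
  E (\sum_(i <- s) F i) = \sum_(i <- s) E (F i).
Proof.
by elim/big_rec2: _ => [|i y x _ <-]; [exact: functional0 | rewrite ED].
Qed.

Lemma functional_sqr_ge0 p : 0 <= E (p * p).
Proof.
have [->|p0] := eqVneq p 0; first by rewrite mul0r functional0.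
exact: ltW (Epos p0).
Qed.

Lemma size_sub_monic n (p q : {poly R}) : p \is monic -> q \is monic ->
  size p = n.+1 -> size q = n.+1 -> (size (p - q)%R <= n)%N.
Proof.
move=> pm qm sp sq; apply/leq_sizeP => j; rewrite leq_eqVlt => /orP[/eqP<-|nj].
  have := monicP pm; have := monicP qm; rewrite !lead_coefE sp sq /= => h1 h2.
  by rewrite coefB h1 h2 subrr.
by rewrite coefB !nth_default ?subrr // ?sp ?sq.
Qed.

Lemma orthogonal_span n (O : nat -> {poly R}) (P : {poly R}) :
  (forall k, (k < n)%N -> O k \is monic /\ size (O k) = k.+1) ->
  (forall k, (k < n)%N -> E (P * O k) = 0) ->
  forall q : {poly R}, (size q <= n)%N -> E (P * q) = 0.
Proof.
move=> hO hP q; have [m] := ubnP (size q); elim: m q => // m IH q.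
rewrite ltnS => qm qn; have [->|q0] := eqVneq q 0; first by rewrite mulr0 functional0.
have s0 : (0 < size q)%N by rewrite size_poly_gt0.
set k := (size q).-1; have kn : (k < n)%N by rewrite prednK.
have [Om Os] := hO k kn.
have -> : q = (q - lead_coef q *: O k) + lead_coef q *: O k by rewrite subrK.
have lt : (size (q - lead_coef q *: O k)%R <= k)%N.
  apply/leq_sizeP => j; rewrite leq_eqVlt => /orP[/eqP<-|kj].
    have := monicP Om; rewrite lead_coefE Os /= => h.
    by rewrite coefB coefZ h mulr1 lead_coefE subrr.
  rewrite coefB coefZ !nth_default ?mulr0 ?subr0 ?Os //.
  by rewrite -(prednK s0).
rewrite mulrDr ED -scalerAr EZ (hP _ kn) mulr0 addr0; apply: IH.
  by apply: leq_trans qm; rewrite -(prednK s0) ltnS.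
exact: leq_trans lt (ltnW kn).
Qed.

Lemma exists_orthogonal_monic n : exists P, orthogonal_monic n P.
Proof.
suff [B hO] : exists B : nat -> {poly R}, forall k, (k < n.+1)%N -> orthogonal_monic k (B k).
  by exists (B n); exact: hO.
elim: n.+1 => {n} [|n [B hO]]; first by exists (fun=> 0).
pose P := 'X^n - \sum_(k < n) (E ('X^n * B k) / E (B k * B k)) *: B k.
have hs : (size (\sum_(k < n) (E ('X^n * B k) / E (B k * B k)) *: B k)%R <= n)%N.
  apply: (leq_trans (size_sum _ _ _)); apply/bigmax_leqP => k _.
  apply: (leq_trans (size_scale_leq _ _)).
  by have [_ -> _] := hO k (ltn_ord k).
have Ps : size P = n.+1 by rewrite size_polyDl size_polyXn // size_polyN ltnS.
have Pm : P \is monic.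
  by rewrite monicE lead_coefDl ?lead_coefXn // size_polyN size_polyXn ltnS.
exists (fun k => if k == n then P else B k) => k; rewrite ltnS leq_eqVlt.
case: eqP => [-> _|_ /= kn]; last exact: hO.
split => //; apply: (orthogonal_span (O := B)).
  by move=> j jn; have [? ? _] := hO j jn.
move=> j jn; have [Om Os Oo] := hO j jn.
rewrite mulrBl functionalB mulr_suml functional_sum.
rewrite (bigD1 (Ordinal jn)) //= big1 ?addr0 => [|i ij].
  rewrite -scalerAl EZ divfK ?subrr // gt_eqF // Epos //.
  by rewrite -size_poly_gt0 Os.
rewrite -scalerAl EZ; have [Om' Os' Oo'] := hO i (ltn_ord i).
have : (i != j :> nat) by move: ij; rewrite -val_eqE.
rewrite neq_ltn => /orP[lt|lt]; last by rewrite (Oo' (B j)) ?Os ?mulr0.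
by rewrite [B i * B j]mulrC (Oo (B i)) ?Os' ?mulr0.
Qed.

(** Pythagoras: [Q - P] has lower degree, hence is orthogonal to [P]. This links the definition by
    minimal norm to orthogonality. *)
Lemma orthogonal_monic_min n P Q : orthogonal_monic n P ->
  Q \is monic -> size Q = n.+1 -> E (Q * Q) = E (P * P) + E ((Q - P) * (Q - P)).
Proof.
move=> [Pm Ps Po] Qm Qs; have h := Po _ (size_sub_monic Qm Pm Qs Ps).
have -> : Q * Q = P * P + (Q - P) * (Q - P) + 2 *: (P * (Q - P)).
  by rewrite scaler_nat; ring.
by rewrite !ED EZ h mulr0 addr0.
Qed.

Lemma orthogonal_monic_unique n P Q : orthogonal_monic n P ->
  Q \is monic -> size Q = n.+1 -> E (Q * Q) <= E (P * P) -> Q = P.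
Proof.
move=> hP Qm Qs; rewrite (orthogonal_monic_min hP Qm Qs) gerDl => le0.
apply/eqP; rewrite -subr_eq0; apply: contraTT le0 => /Epos.
by rewrite -ltNge.
Qed.

Lemma functional_orthogonal_monic n (P Q : {poly R}) : orthogonal_monic n P ->
  size Q = n.+1 -> E (P * Q) = lead_coef Q * E (P * P).
Proof.
move=> [Pm Ps Po] Qs; have hs : (size (Q - lead_coef Q *: P)%R <= n)%N.
  apply/leq_sizeP => j; rewrite leq_eqVlt => /orP[/eqP<-|nj].
    have := monicP Pm; rewrite lead_coefE Ps /= => h.
    by rewrite coefB coefZ h mulr1 lead_coefE Qs subrr.
  by rewrite coefB coefZ !nth_default ?mulr0 ?subrr // ?Ps ?Qs.
have -> : P * Q = P * (Q - lead_coef Q *: P) + lead_coef Q *: (P * P).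
  by rewrite mulrBr -scalerAr subrK.
by rewrite ED (Po _ hs) add0r EZ.
Qed.

(** Pair the recurrence with [P0]: ['X * P0] is monic of the degree of [P1], so its product with
    [P1] has the mean of [P1 * P1]. Hence a product of recurrence coefficients is a norm. *)
Lemma orthogonal_recurrence n P0 P1 P2 b a2 :
  orthogonal_monic n P0 -> orthogonal_monic n.+1 P1 -> orthogonal_monic n.+2 P2 ->
  P2 = ('X - b%:P) * P1 - a2%:P * P0 -> E (P1 * P1) = a2 * E (P0 * P0).
Proof.
move=> [m0 s0 o0] h1 [m2 s2 o2] e; have [m1 s1 o1] := h1.
have n0 : P0 != 0 by rewrite monic_neq0.
have : E (P2 * P0) = 0 by rewrite o2 // s0.
have -> : P2 * P0 = P1 * ('X * P0) - b *: (P1 * P0) - a2 *: (P0 * P0).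
  by rewrite e -!mul_polyC; ring.
have sX : size ('X * P0)%R = n.+2 by rewrite mulrC size_mulX // s0.
rewrite !functionalB !EZ (functional_orthogonal_monic h1 sX).
rewrite (o1 P0) ?s0 // mulr0 subr0 ['X * _]mulrC lead_coefMX (monicP m0) mul1r.
by move/eqP; rewrite subr_eq0 => /eqP.
Qed.

End Orthogonal.

Local Open Scope classical_set_scope.
Local Open Scope ring_scope.

(** * Lower limits of extended real sequences *)

Section LimInf.
Variable R : realType.
Implicit Types u : (\bar R)^nat.

Lemma limn_einf_ge u (x : \bar R) : (\forall n \near \oo, (x <= u n)%E) ->
  (x <= limn_einf u)%E.
Proof.
move=> [n0 _ h]; rewrite limn_einf_lim.
apply: lime_ge; first exact: is_cvg_einfs.
exists n0 => // n /= n0n; apply: le_ereal_inf_tmp => _ [k /= nk <-].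
by apply: h => /=; apply: leq_trans nk.
Qed.

Lemma lt_limn_einf u (x : \bar R) : (x < limn_einf u)%E ->
  \forall n \near \oo, (x < u n)%E.
Proof.
rewrite limn_einf_lim => xu.
have [n0 h] : exists n0, (x < einfs u n0)%E.
  apply/not_existsP => h; move: xu; apply/negP; rewrite -leNgt.
  apply: lime_le; first exact: is_cvg_einfs.
  by apply: nearW => n; rewrite leNgt; apply/negP; exact: h.
exists n0 => // n /= n0n; apply: (lt_le_trans h).
by apply: ereal_inf_lbound; exists n.
Qed.

End LimInf.

(** * The logarithmic kernel *)

Section Kernel.
Variable R : realType.
Implicit Types (c s r x y a : R) (m n k : nat).

Lemma cheb_cos k a : (cheb R k).[cos a] = cos (k%:R * a).
Proof.
elim/cheb_ind2: k => [||n IH1 IH2].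
- by rewrite cheb0 hornerC mul0r cos0.
- by rewrite cheb1 hornerX mul1r.
rewrite chebSS hornerD hornerN hornerM hornerMn hornerX IH1 IH2.
have -> : n.+2%:R * a = n.+1%:R * a + a by rewrite -addn1 natrD mulrDl mul1r.
have -> : n%:R * a = n.+1%:R * a - a by rewrite -[n.+1]addn1 natrD mulrDl mul1r addrK.
by rewrite cosB cosD mulr2n; ring.
Qed.

Lemma normr_cheb_le1 k x : `|x| <= 1 -> `|(cheb R k).[x]| <= 1.
Proof.
rewrite ler_norml => hx; rewrite -[x]acosK ?in_itv //= cheb_cos.
by rewrite ler_norml cos_geN1 cos_le1.
Qed.

(** The truncation, with its exact remainder, of the generating series sum_k s^(k-1) T_k(c) = (c -
    s)/(1 - 2sc + s^2). *)
Lemma cheb_generating c s m :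
  (1 - 2 * s * c + s ^+ 2) * \sum_(1 <= k < m.+1) s ^+ k.-1 * (cheb R k).[c]
  = c - s - s ^+ m * (cheb R m.+1).[c] + s ^+ m.+1 * (cheb R m).[c].
Proof.
elim: m => [|m IH].
  by rewrite big_geq // cheb1 cheb0 hornerX hornerC expr0 expr1; ring.
rewrite big_nat_recr //= mulrDr IH chebSS hornerD hornerN hornerM hornerMn hornerX.
by rewrite !exprS mulr2n; ring.
Qed.

Lemma poisson_denom_gt0 c s : `|c| <= 1 -> 0 <= s < 1 ->
  (1 - s) ^+ 2 <= 1 - 2 * s * c + s ^+ 2.
Proof. by rewrite ler_norml => *; nra. Qed.

(** As a function of r the difference vanishes at 0, and by [cheb_generating] its derivative is a
    remainder of order r^m over 1 - 2rc + r^2. The mean value theorem concludes. *)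
Lemma ln_poisson_approx c r m : `|c| <= 1 -> 0 <= r < 1 ->
  `|- 2^-1 * ln (1 - 2 * r * c + r ^+ 2)
    - \sum_(1 <= k < m.+1) r ^+ k / k%:R * (cheb R k).[c]|
  <= 2 * r ^+ m.+1 / (1 - r) ^+ 2.
Proof.
move=> c1 /andP[r0 r1].
pose q : {poly R} := 1 - (2 * c) *: 'X + 'X^2.
pose p : {poly R} := \sum_(1 <= k < m.+1) ((cheb R k).[c] / k%:R) *: 'X^k.
have qE s : q.[s] = 1 - 2 * s * c + s ^+ 2.
  by rewrite /q !hornerE; ring.
have pE s : p.[s] = \sum_(1 <= k < m.+1) s ^+ k / k%:R * (cheb R k).[c].
  rewrite /p horner_sum; apply: eq_bigr => k _.
  by rewrite hornerZ hornerXn; ring.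
have dpE s : p^`().[s] = \sum_(1 <= k < m.+1) s ^+ k.-1 * (cheb R k).[c].
  rewrite /p linear_sum horner_sum; apply: eq_big_nat => k /andP[k1 _].
  rewrite /= derivZ derivXn hornerZ hornerMn hornerXn -mulr_natr.
  by field; rewrite pnatr_eq0 -lt0n.
have dqE s : q^`().[s] = 2 * (s - c).
  rewrite /q derivD derivB derivZ derivX derivXn derivC.
  by rewrite sub0r hornerD hornerN hornerZ hornerMn hornerXn hornerC; ring.
have q_ge s : 0 <= s < 1 -> 0 < q.[s].
  move=> hs; rewrite qE; apply: lt_le_trans (poisson_denom_gt0 c1 hs).
  by rewrite exprn_gt0 // subr_gt0; case/andP: hs.
pose f (s : R) : R := - 2^-1 * ln q.[s] - p.[s].
pose df (s : R) : R := - 2^-1 * ((q.[s])^-1 * q^`().[s]) - p^`().[s].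
have dpoly (t : {poly R}) s : is_derive s 1 (horner t) t^`().[s].
  by apply: DeriveDef; [exact: derivable_horner | rewrite derivE derive1E].
have fdf s : 0 <= s < 1 -> is_derive s 1 f (df s).
  move=> hs; have qs := q_ge s hs.
  have h1 : is_derive s 1 (@ln R \o horner q : R -> R) ((q.[s])^-1 * q^`().[s]).
    by apply: is_derive1_comp; exact: is_derive1_ln.
  have h2 : is_derive s 1 ((- 2^-1 : R) \*: (@ln R \o horner q : R -> R)) (- 2^-1 *: ((q.[s])^-1 * q^`().[s])).
    exact: is_deriveZ.
  exact: (is_deriveB h2 (dpoly p s)).
have [u /andP[u0 ur] e] : exists2 u, 0 <= u <= r & f r - f 0 = df u * (r - 0).
  apply: (@MVT_segment R f df 0 r r0).
  - move=> u; rewrite in_itv /= => /andP[u0 ur]; apply: fdf.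
    by rewrite ltW //= (lt_trans ur).
  - apply: derivable_within_continuous => u; rewrite in_itv /= => /andP[u0 ur].
    by have [] := fdf u _; rewrite ?u0 ?(le_lt_trans ur).
have f0 : f 0 = 0.
  rewrite /f qE pE mulr0 mul0r subr0 expr0n addr0 ln1 mulr0 sub0r.
  rewrite big_nat big1 ?oppr0 // => k /andP[k1 _].
  by rewrite expr0n (gtn_eqF k1) !mul0r.
rewrite -qE -pE -/(f r).
have -> : f r = df u * r by rewrite -[LHS]subr0 -f0 e subr0.
have u1 : u < 1 := le_lt_trans ur r1.
have qu := q_ge u (introT andP (conj u0 u1)).
have dfu : df u = (u ^+ m * (cheb R m.+1).[c] - u ^+ m.+1 * (cheb R m).[c]) / q.[u].
  have := cheb_generating c u m; rewrite -dpE -qE /df dqE => h.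
  have -> : p^`().[u] = (q.[u] * p^`().[u]) / q.[u].
    by rewrite mulrAC mulfV ?mul1r // gt_eqF.
  by rewrite h; field; rewrite gt_eqF.
rewrite normrM (ger0_norm r0) dfu normrM normfV (gtr0_norm qu).
have b1 : `|u ^+ m * (cheb R m.+1).[c] - u ^+ m.+1 * (cheb R m).[c]| <= 2 * r ^+ m.
  apply: le_trans (ler_normB _ _) _; rewrite mulr_natl mulr2n.
  rewrite !normrM !(ger0_norm (exprn_ge0 _ u0)).
  have um : u ^+ m <= r ^+ m by rewrite lerXn2r // nnegrE.
  have um0 : 0 <= u ^+ m by rewrite exprn_ge0.
  apply: lerD; apply: le_trans um; first by rewrite ler_piMr // normr_cheb_le1.
  apply: (@le_trans _ _ (u ^+ m.+1)); first by rewrite ler_piMr ?exprn_ge0 // normr_cheb_le1.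
  by rewrite exprS ler_piMl // ltW.
have b2 : (q.[u])^-1 <= ((1 - r) ^+ 2)^-1.
  rewrite lef_pV2 ?posrE // ?exprn_gt0 ?subr_gt0 //.
  rewrite qE (le_trans _ (poisson_denom_gt0 c1 _)) ?u0 //.
  by rewrite lerXn2r ?nnegrE ?subr_ge0 ?(ltW u1) ?(ltW r1) // lerB.
have -> : 2 * r ^+ m.+1 / (1 - r) ^+ 2 = (2 * r ^+ m) * ((1 - r) ^+ 2)^-1 * r.
  by rewrite exprSr; ring.
by apply: ler_wpM2r => //; apply: ler_pM => //; rewrite invr_ge0 ltW.
Qed.

(* The Poisson-regularized logarithmic kernel: at r = 1 it is
   4 (x - y)^2, and for r < 1 it factors as |1 - r e^(i(a+b))|^2 |1 - r e^(i(a-b))|^2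
   with x = cos a, y = cos b. *)
Definition regdist r x y : R :=
  4 * r ^+ 2 * (x - y) ^+ 2 + (1 - r) ^+ 2 * ((1 + r) ^+ 2 - 4 * r * x * y).

Definition cheb_kernel r m x y : R :=
  \sum_(1 <= k < m.+1) 2 / k%:R * r ^+ k * ((cheb R k).[x] * (cheb R k).[y]).

(** With x = cos a and y = cos b, the two factors of [regdist] contribute cos k(a + b) and cos k(a -
    b), whose sum is 2 T_k(x) T_k(y). *)
Lemma ln_regdist_approx r m x y : `|x| <= 1 -> `|y| <= 1 -> 0 <= r < 1 ->
  `|- 2^-1 * ln (regdist r x y) - cheb_kernel r m x y|
    <= 4 * r ^+ m.+1 / (1 - r) ^+ 2.
Proof.
move=> x1 y1 hr.
pose a := acos x; pose b := acos y.
have xa : cos a = x by rewrite acosK // in_itv /= -ler_norml.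
have yb : cos b = y by rewrite acosK // in_itv /= -ler_norml.
pose c1 := cos (a + b); pose c2 := cos (a - b).
have n1 : `|c1| <= 1 by rewrite ler_norml cos_geN1 cos_le1.
have n2 : `|c2| <= 1 by rewrite ler_norml cos_geN1 cos_le1.
pose D c := 1 - 2 * r * c + r ^+ 2.
have D0 c : `|c| <= 1 -> 0 < D c.
  move=> hc; apply: lt_le_trans (poisson_denom_gt0 hc hr).
  by rewrite exprn_gt0 // subr_gt0; case/andP: hr.
have -> : regdist r x y = D c1 * D c2.
  rewrite /D /c1 /c2 /regdist cosB cosD -xa -yb.
  have sa := cos2Dsin2 a; have sb := cos2Dsin2 b.
  have ea : sin a ^+ 2 = 1 - cos a ^+ 2 by rewrite -sa addrC addKr.
  have eb : sin b ^+ 2 = 1 - cos b ^+ 2 by rewrite -sb addrC addKr.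
  have -> : (1 - 2 * r * (cos a * cos b - sin a * sin b) + r ^+ 2) *
    (1 - 2 * r * (cos a * cos b + sin a * sin b) + r ^+ 2) =
    (1 + r ^+ 2 - 2 * r * cos a * cos b) ^+ 2 - 4 * r ^+ 2 * sin a ^+ 2 * sin b ^+ 2 by ring.
  by rewrite ea eb; ring.
have -> : cheb_kernel r m x y =
  \sum_(1 <= k < m.+1) r ^+ k / k%:R * (cheb R k).[c1] +
  \sum_(1 <= k < m.+1) r ^+ k / k%:R * (cheb R k).[c2].
  rewrite -big_split /=; apply: eq_bigr => k _.
  by rewrite -xa -yb !cheb_cos mulrDr mulrBr cosB cosD; ring.
rewrite lnM ?posrE ?D0 //.
have -> : - 2^-1 * (ln (D c1) + ln (D c2)) -
  (\sum_(1 <= k < m.+1) r ^+ k / k%:R * (cheb R k).[c1] +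
   \sum_(1 <= k < m.+1) r ^+ k / k%:R * (cheb R k).[c2]) =
  (- 2^-1 * ln (D c1) - \sum_(1 <= k < m.+1) r ^+ k / k%:R * (cheb R k).[c1]) +
  (- 2^-1 * ln (D c2) - \sum_(1 <= k < m.+1) r ^+ k / k%:R * (cheb R k).[c2]) by ring.
apply: le_trans (ler_normD _ _) _.
have -> : 4 * r ^+ m.+1 / (1 - r) ^+ 2 =
  2 * r ^+ m.+1 / (1 - r) ^+ 2 + 2 * r ^+ m.+1 / (1 - r) ^+ 2 by ring.
by apply: lerD; apply: ln_poisson_approx.
Qed.

End Kernel.

Section LogKernel.
Variable R : realType.
Implicit Types (r x y : R) (m n k : nat).

(** The scaling makes the kernel positive on [-1, 1]. Dividing by 4 rather than 2 leaves enough room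
    for the regularized kernels, shifted by ln 8, to be nonnegative as well, which Fatou's lemma
    requires. *)
Definition logker x y : \bar R := (- lne (`|x - y| / 4)%:E)%E.

Lemma logkerxx x : logker x x = +oo%E.
Proof. by rewrite /logker subrr normr0 mul0r /= lexx. Qed.

Lemma logker_neq x y : x != y -> logker x y = (- ln (`|x - y| / 4))%:E.
Proof.
by move=> xy; rewrite /logker lne_EFin // divr_gt0 // normr_gt0 subr_eq0.
Qed.

Lemma lt_logker (z : R) x y : (z%:E < logker x y)%E -> `|x - y| < 4 * expR (- z).
Proof.
have [->|xy] := eqVneq x y; first by rewrite subrr normr0 mulr_gt0 ?expR_gt0.
have d0 : 0 < `|x - y| / 4 by rewrite divr_gt0 // normr_gt0 subr_eq0.
rewrite logker_neq // lte_fin ltrNr => h.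
rewrite mulrC -ltr_pdivrMr // -ltr_ln ?posrE ?expR_gt0 //.
by rewrite expRK.
Qed.

Lemma lnX2 x : 0 < x -> 2^-1 * ln (x ^+ 2) = ln x.
Proof. by move=> x0; rewrite lnXn // mulr2n; field. Qed.

Lemma logker_ge r m x y : `|x| <= 1 -> `|y| <= 1 -> 0 < r < 1 ->
  ((cheb_kernel r m x y + ln (8 * r) - 4 * r ^+ m.+1 / (1 - r) ^+ 2)%:E
    <= logker x y)%E.
Proof.
move=> x1 y1 /andP[r0 r1]; have [->|xy] := eqVneq x y; first by rewrite logkerxx leey.
have hr : 0 <= r < 1 by rewrite ltW.
have /= := ln_regdist_approx m x1 y1 hr.
rewrite ler_distl => /andP[h _].
rewrite logker_neq // lee_fin.
have d0 : 0 < `|x - y| by rewrite normr_gt0 subr_eq0.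
set d := `|x - y| in d0 *.
have dd : (x - y) ^+ 2 = d ^+ 2 by rewrite real_normK ?num_real.
have hd : (2 * r * d) ^+ 2 <= regdist r x y.
  rewrite /regdist dd; have := x1; have := y1; rewrite !ler_norml => *.
  have : 0 <= (1 - r) ^+ 2 * ((1 + r) ^+ 2 - 4 * r * x * y).
    apply: mulr_ge0; rewrite ?sqr_ge0 //.
    suff : x * y <= 1 by move=> ?; nra.
    by nra.
  by rewrite !exprMn; lra.
have p0 : 0 < 2 * r * d by rewrite !mulr_gt0.
have h2 : ln (2 * r * d) <= 2^-1 * ln (regdist r x y).
  rewrite -lnX2 // ler_pM2l // ler_ln ?posrE ?exprn_gt0 //.
  by apply: lt_le_trans hd; rewrite exprn_gt0.
have -> : ln (8 * r) = ln (2 * r * d) - ln (d / 4).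
  rewrite -ln_div ?posrE ?divr_gt0 //; congr ln; field.
  by rewrite gt_eqF.
by lra.
Qed.

(** Since r^2 <= 1 and (1 + r)^2 - 4rxy <= 8, [regdist] exceeds 4 (x - y)^2 by at most 8 (1 - r)^2,
    which tends to 0 with 1 - r uniformly in x and y. *)
Lemma cheb_kernel_ge r m x y : `|x| <= 1 -> `|y| <= 1 -> 0 < r < 1 ->
  - 2^-1 * ln (4 * (x - y) ^+ 2 + 8 * (1 - r) ^+ 2)
    <= cheb_kernel r m x y + 4 * r ^+ m.+1 / (1 - r) ^+ 2.
Proof.
move=> x1 y1 /andP[r0 r1].
have hr : 0 <= r < 1 by rewrite ltW.
have /= := ln_regdist_approx m x1 y1 hr.
rewrite ler_distl => /andP[_]; apply: le_trans.
have r10 : 0 < (1 - r) ^+ 2 by rewrite exprn_gt0 // subr_gt0.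
move: x1 y1; rewrite !ler_norml => /andP[xa xb] /andP[ya yb].
have xyb : -1 <= x * y <= 1 by nra.
rewrite !mulNr lerN2 ler_pM2l // ler_ln ?posrE.
- have : 4 * r ^+ 2 * (x - y) ^+ 2 <= 4 * (x - y) ^+ 2.
    by rewrite ler_wpM2r ?sqr_ge0 //; nra.
  have : (1 - r) ^+ 2 * ((1 + r) ^+ 2 - 4 * r * x * y) <= (1 - r) ^+ 2 * 8.
    by rewrite ler_wpM2l ?sqr_ge0 //; nra.
  by rewrite /regdist; lra.
- apply: ltr_wpDl; first by rewrite mulr_ge0 ?sqr_ge0 // mulr_ge0 // sqr_ge0.
  apply: mulr_gt0 => //; have : 0 <= r * (1 - x * y) by rewrite mulr_ge0; lra.
  by nra.
- apply: ltr_wpDl; first by rewrite mulr_ge0 ?sqr_ge0.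
  by rewrite mulr_gt0.
Qed.

(** The minorants serve lower bounds on energies, the nonnegative approximants serve Fatou's lemma.
    Once [r n] is fixed, [m n] is taken so large that the truncation error [e n] is at most 1/(n+1);
    [n <= m n] brings each Chebyshev index eventually into the sum. *)
Lemma logker_approx : exists (r e : R^nat) (m : nat -> nat),
  [/\ forall n, 2^-1 <= r n < 1 /\ (n <= m n)%N, r @ \oo --> (1 : R),
      e @ \oo --> (0 : R) &
      forall x y, `|x| <= 1 -> `|y| <= 1 ->
      [/\ forall n, ((cheb_kernel (r n) (m n) x y + ln (8 * r n) - e n)%:E
            <= logker x y)%E,
          forall n, 0 <= cheb_kernel (r n) (m n) x y + ln 8 + e n &
          (logker x y <= limn_einf (fun n =>
            (cheb_kernel (r n) (m n) x y + ln 8 + e n)%:E))%E]].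
Proof.
pose r n : R := 1 - harmonic n.+1.
have hr n : 2^-1 <= r n < 1.
  rewrite /r /harmonic /= ltrBlDr ltrDl invr_gt0 ltr0n andbT lerBrDr -lerBrDl.
  rewrite (_ : 1 - 2^-1 = 2^-1); last by field.
  by rewrite lef_pV2 ?posrE ?ltr0n // ler_nat.
have hr0 n : 0 < r n < 1 by have /andP[a ->] := hr n; rewrite (lt_le_trans _ a).
pose d n m := 4 * r n ^+ m.+1 / (1 - r n) ^+ 2.
have hd n : exists m, (n <= m)%N /\ d n m <= harmonic n.
  have /andP[r0 r1] := hr0 n.
  have nr : `|r n| < 1 by rewrite gtr0_norm.
  have : (fun m => 4 / (1 - r n) ^+ 2 * r n ^+ m) @ \oo --> 4 / (1 - r n) ^+ 2 * 0.
    by apply: cvgMr; apply: cvg_expr.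
  rewrite mulr0 => /cvgrPdist_le /(_ (harmonic n)) [|k _ /(_ (maxn k n) (leq_maxl _ _))].
    by rewrite /harmonic /= invr_gt0.
  rewrite /= sub0r normrN => h; exists (maxn k n); split; first exact: leq_maxr.
  apply: le_trans h; rewrite /d.
  apply: le_trans (ler_norm _); rewrite exprS mulrAC mulrA.
  apply: ler_wpM2r; first by rewrite exprn_ge0 // ltW.
  by rewrite ler_piMr ?divr_ge0 ?sqr_ge0 // ltW.
have [m hm'] := choice hd.
have hm n : d n (m n) <= harmonic n by case: (hm' n).
pose e n : R := d n (m n).
have e0 n : 0 <= e n.
  have /andP[r0 _] := hr0 n.
  by rewrite /e /d divr_ge0 ?sqr_ge0 // mulr_ge0 // exprn_ge0 // ltW.
have r1 : r @ \oo --> (1 : R).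
  rewrite -[X in _ --> X]subr0; apply: cvgB; first exact: cvg_cst.
  by rewrite (cvg_shiftS (@harmonic R : nat -> R)); exact: cvg_harmonic.
exists r, e, m; split => //; first by move=> n; split=> //; case: (hm' n).
  apply: (@squeeze_cvgr _ _ _ _ (cst 0) harmonic); first last.
  - exact: cvg_harmonic.
  - exact: cvg_cst.
  by apply: nearW => n; rewrite e0 hm.
move=> x y x1 y1.
have ge0 n : 0 <= cheb_kernel (r n) (m n) x y + ln 8 + e n.
  have /andP[r0 r1'] := hr0 n.
  have := cheb_kernel_ge (m n) x1 y1 (hr0 n); rewrite -/(d _ _) -/(e n) => h.
  suff : - ln 8 <= - 2^-1 * ln (4 * (x - y) ^+ 2 + 8 * (1 - r n) ^+ 2) by lra.
  rewrite mulNr lerN2 -(lnX2 (x := 8)) // ler_pM2l // ler_ln ?posrE //.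
    move: x1 y1; rewrite !ler_norml => /andP[xa xb] /andP[ya yb].
    have : (x - y) ^+ 2 <= 4 by nra.
    have : (1 - r n) ^+ 2 <= 1 by nra.
    by lra.
  apply: ltr_wpDl; first by rewrite mulr_ge0 ?sqr_ge0.
  by rewrite mulr_gt0 // exprn_gt0 // subr_gt0.
split => [n|n|]; [exact: logker_ge|exact: ge0|].
(* A real [z] strictly between the lower limit and the kernel would force |x - y| < 4 exp(-z); this
   strict inequality leaves a [gap] that absorbs 8 (1 - r n)^2 for large n. *)
- set u := fun n => _; rewrite leNgt; apply/negP => lt.
  have [z lz zk] : exists2 z : R, (limn_einf u < z%:E)%E & (z%:E < logker x y)%E.
    have : (0 <= limn_einf u)%E.
      apply: limn_einf_ge; apply: nearW => n; rewrite lee_fin; exact: ge0.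
    case: (limn_einf u) lt => [l||] //; last by rewrite ltNge leey.
    case: (logker x y) => [k| |] // lk _.
      move: lk; rewrite lte_fin => lk; exists ((l + k) / 2); rewrite lte_fin.
        by rewrite ltr_pdivlMr //; lra.
      by rewrite ltr_pdivrMr //; lra.
    by exists (l + 1); [rewrite lte_fin ltrDl | rewrite ltry].
  move: lz; apply/negP; rewrite -leNgt; apply: limn_einf_ge.
  have d4 := lt_logker zk.
  have gap : 0 < (64 * expR (- z) ^+ 2 - 4 * `|x - y| ^+ 2) / 8.
    rewrite divr_gt0 // subr_gt0.
    have : `|x - y| ^+ 2 < (4 * expR (- z)) ^+ 2.
      by rewrite ltrXn2r // nnegrE // mulr_ge0 // expR_ge0.
    by rewrite exprMn; lra.
  have : (fun n => (1 - r n) ^+ 2) @ \oo --> ((1 - 1) ^+ 2 : R).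
    by apply: cvgM; (apply: cvgB; [exact: cvg_cst|exact: r1]).
  rewrite subrr expr0n => /cvgrPdist_lt /(_ _ gap).
  apply: filterS => n; rewrite sub0r normrN ger0_norm ?sqr_ge0 // => hn.
  have := cheb_kernel_ge (m n) x1 y1 (hr0 n); rewrite -/(d _ _) -/(e n) => h.
  rewrite /u lee_fin.
  have /andP[r0' r1'] := hr0 n.
  suff : z - ln 8 <= - 2^-1 * ln (4 * (x - y) ^+ 2 + 8 * (1 - r n) ^+ 2) by lra.
  have -> : z - ln 8 = - 2^-1 * ln ((8 * expR (- z)) ^+ 2).
    by rewrite mulNr lnX2 ?mulr_gt0 ?expR_gt0 // lnM ?posrE ?expR_gt0 // expRK; lra.
  rewrite !mulNr lerN2 ler_pM2l // ler_ln ?posrE.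
  - move: hn; rewrite ltr_pdivlMr // real_normK ?num_real // exprMn; lra.
  - apply: ltr_wpDl; first by rewrite mulr_ge0 ?sqr_ge0.
    by rewrite mulr_gt0 // exprn_gt0 // subr_gt0.
  - by rewrite exprn_gt0 // mulr_gt0 // expR_gt0.
Qed.

End LogKernel.

(** * Integrals against a probability measure carried by a set *)

Section FullMeasure.
Context (d : measure_display) (T : measurableType d) (R : realType).
Variable nu : probability T R.
Implicit Types (B : set T) (f g : T -> \bar R).

Lemma ae_full B : measurable B -> nu B = 1%E -> {ae nu, forall x, B x}.
Proof.
move=> mB nB; exists (~` B); split; first exact: measurableC.
  by rewrite probability_setC // nB subee.
by [].
Qed.

Lemma integral_full B f : measurable B -> nu B = 1%E ->
  measurable_fun setT f -> (\int[nu]_x f x = \int[nu]_(x in B) f x)%E.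
Proof.
move=> mB nB mf; rewrite [RHS]integral_mkcond; apply: ae_eq_integral => //.
  apply/(measurable_restrictT _ mB).1; exact: measurable_funTS.
have := ae_full mB nB; apply: filterS => x Bx _.
by rewrite patchE mem_set.
Qed.

Lemma eq_integral_full B f g : measurable B -> nu B = 1%E ->
  measurable_fun setT f -> measurable_fun setT g ->
  (forall x, B x -> f x = g x) -> (\int[nu]_x f x = \int[nu]_x g x)%E.
Proof.
move=> mB nB mf mg fg; rewrite (integral_full mB) // [RHS](integral_full mB) //.
by apply: eq_integral => x /set_mem /fg.
Qed.

Lemma ge0_le_integral_full B f g : measurable B -> nu B = 1%E ->
  measurable_fun setT f -> measurable_fun setT g ->
  (forall x, B x -> (0 <= f x)%E) ->
  (forall x, B x -> (f x <= g x)%E) -> (\int[nu]_x f x <= \int[nu]_x g x)%E.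
Proof.
move=> mB nB mf mg f0 fg; rewrite (integral_full mB) // [leRHS](integral_full mB) //.
by apply: ge0_le_integral => //; exact: measurable_funTS.
Qed.

(** The positive part of [h] lies below [f] because [f] is nonnegative on [B], and the negative part
    only lowers the left side. *)
Lemma le_integral_ge0 B f (h : T -> R) : measurable B -> nu B = 1%E ->
  measurable_fun setT f -> measurable_fun setT h ->
  (forall x, B x -> (0 <= f x)%E) ->
  (forall x, B x -> ((h x)%:E <= f x)%E) ->
  (\int[nu]_x (h x)%:E <= \int[nu]_x f x)%E.
Proof.
move=> mB nB mf mh f0 hf.
have mh' : measurable_fun setT (EFin \o h) by exact/measurable_EFinP.
rewrite integralE; apply: (@le_trans _ _ (\int[nu]_x (EFin \o h)^\+ x)%E).
  rewrite -[leRHS]sube0 leeB //; apply: integral_ge0 => x _; exact: funeneg_ge0.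
apply: (ge0_le_integral_full mB) => //; first exact: measurable_funepos.
by move=> x Bx; rewrite funeposE ge_max hf // f0.
Qed.

(** The integral of [f] may be infinite. The identity g^+ + C = f + g^- for g = f - C involves
    nonnegative functions only, and the integral of g^- is at most C, so it can be cancelled. *)
Lemma integral_subC f (C : R) : 0 <= C -> measurable_fun setT f ->
  (forall x, (0 <= f x)%E) -> 
  (\int[nu]_x (f x - C%:E) = \int[nu]_x f x - C%:E)%E.
Proof.
move=> C0 mf f0.
pose g x := (f x - C%:E)%E.
have mg : measurable_fun setT g by apply: emeasurable_funB => //; exact: measurable_cst.
have e : (\int[nu]_x (g^\+ x) + C%:E = \int[nu]_x f x + \int[nu]_x g^\- x)%E.
  have -> : C%:E = (\int[nu]_x (cst C%:E x))%E.
    by rewrite integral_cst //= probability_setT mule1.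
  have mp : measurable_fun setT g^\+%E by exact: measurable_funepos.
  have mn : measurable_fun setT g^\-%E by exact: measurable_funeneg.
  rewrite -!ge0_integralD //.
  apply: eq_integral => x _; rewrite funeposE funenegE /g.
  case: (f x) (f0 x) => [y| |] //= y0.
  - rewrite -EFinD -!EFin_max -!EFinD; congr EFin.
    by rewrite !maxEle; case: ifP; case: ifP => *; lra.
  - have -> : (+oo + (- C)%:E)%E = +oo%E :> \bar R by [].
    by rewrite maxye maxNye.
have gC : (\int[nu]_x g^\- x <= C%:E)%E.
  have -> : C%:E = (\int[nu]_x (cst C%:E x))%E.
    by rewrite integral_cst //= probability_setT mule1.
  apply: ge0_le_integral => //; first exact: measurable_funeneg.
  move=> x _; rewrite funenegE /g ge_max lee_fin C0 andbT.
  case: (f x) (f0 x) => [y| |] //=; rewrite ?leNye // lee_fin => y0.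
  by rewrite lee_fin; lra.
have g0 : (0 <= \int[nu]_x g^\- x)%E by apply: integral_ge0.
rewrite integralE -/g; move: e gC g0.
case: (\int[nu]_x g^\- x)%E => [b| |] //; case: (\int[nu]_x f x)%E => [F| |] //;
  case: (\int[nu]_x g^\+ x)%E => [A| |] //= [e] _ _.
by congr EFin; lra.
Qed.

End FullMeasure.

(** * Expectations of polynomials *)

Section Expectation.
Variable R : realType.
Local Notation proba := (probability (measurableTypeR R) R).

Lemma measurable_horner (p : {poly R}) :
  measurable_fun setT (horner p : measurableTypeR R -> R).
Proof. by apply: continuous_measurable_fun; exact: continuous_horner. Qed.

Definition Ex (nu : proba) (p : {poly R}) : R := \int[nu]_x p.[x].

Section Bounded.
Variables (nu : proba) (S : set (measurableTypeR R)) (L : R).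
Hypotheses (mS : measurable S) (nS : nu S = 1%E)
  (SL : forall x, S x -> `|x| <= L).

Lemma horner_bounded (p : {poly R}) : exists M, forall x, S x -> `|p.[x]| <= M.
Proof.
exists (\sum_(i < size p) `|p`_i| * L ^+ i) => x Sx.
rewrite horner_coef (le_trans (ler_norm_sum _ _ _)) //; apply: ler_sum => i _.
rewrite normrM normrX ler_wpM2l // lerXn2r ?nnegrE // ?SL //.
by rewrite (le_trans _ (SL Sx)).
Qed.

Lemma integrable_bounded (f : measurableTypeR R -> R) (M : R) : measurable_fun setT f ->
  (forall x, S x -> `|f x| <= M) -> nu.-integrable setT (EFin \o f).
Proof.
move=> mf fM; apply/integrableP; split; first exact/measurable_EFinP.
apply: (@le_lt_trans _ _ (\int[nu]_x (cst M%:E x))%E).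
  apply: (ge0_le_integral_full mS nS) => //.
    by apply: measurableT_comp => //; exact/measurable_EFinP.
by rewrite integral_cst //= probability_setT mule1 ltry.
Qed.

Lemma integrable_poly p : nu.-integrable setT (EFin \o horner p).
Proof.
have [M hM] := horner_bounded p.
by apply: integrable_bounded hM; exact: measurable_horner.
Qed.

Lemma integral_poly p : (\int[nu]_x (p.[x])%:E = (Ex nu p)%:E)%E.
Proof.
by rewrite /Ex /Rintegral fineK // integrable_fin_num // integrable_poly.
Qed.

Lemma ExD p q : Ex nu (p + q) = Ex nu p + Ex nu q.
Proof.
rewrite /Ex -RintegralD //; try exact: integrable_poly.
by apply: eq_Rintegral => x _; rewrite hornerD.
Qed.

Lemma ExZ a p : Ex nu (a *: p) = a * Ex nu p.
Proof.
rewrite /Ex -RintegralZl //; last exact: integrable_poly.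
by apply: eq_Rintegral => x _; rewrite hornerZ.
Qed.

Lemma ExC a : Ex nu a%:P = a.
Proof.
rewrite /Ex; under eq_Rintegral do rewrite hornerC.
by rewrite Rintegral_cst //= probability_setT mulr1.
Qed.

Lemma Ex_sum (I : Type) (s : seq I) (P : pred I) (F : I -> {poly R}) :
  Ex nu (\sum_(i <- s | P i) F i) = \sum_(i <- s | P i) Ex nu (F i).
Proof.
elim/big_rec2: _ => [|i y x _ <-]; first by rewrite -[0]/(0%:P) ExC.
by rewrite ExD.
Qed.

Lemma le_Ex p q : (forall x, S x -> p.[x] <= q.[x]) -> Ex nu p <= Ex nu q.
Proof.
move=> pq; rewrite -lee_fin -!integral_poly.
rewrite (integral_full mS nS); last first.
  by apply/measurable_EFinP; exact: measurable_horner.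
rewrite [leRHS](integral_full mS nS); last first.
  by apply/measurable_EFinP; exact: measurable_horner.
apply: le_integral => //; try by apply: integrableS (integrable_poly _).
by move=> x /set_mem Sx; rewrite lee_fin pq.
Qed.

End Bounded.
End Expectation.

(** * Logarithmic energy *)

Section Energy.
Variable R : realType.
Local Notation RT := (measurableTypeR R).
Local Notation proba := (probability RT R).

Lemma measurable_lne_EFin : measurable_fun setT (fun r : RT => lne r%:E).
Proof.
apply: measurable_fun_ifT => //.
  by apply: measurable_fun_ler => //; exact: measurable_cst.
apply/measurable_EFinP; exact: measurable_ln.
Qed.

Lemma measurable_dist2 :
  measurable_fun setT (fun z : RT * RT => (`|z.1 - z.2| : RT)).
Proof.
apply: measurableT_comp; first exact: normr_measurable.
by apply: measurable_funB; [exact: measurable_fst|exact: measurable_snd].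
Qed.

Lemma measurable_fun_limn_einf D (f : (RT -> \bar R)^nat) :
  (forall n, measurable_fun D (f n)) ->
  measurable_fun D (fun x => limn_einf (f ^~ x)).
Proof.
move=> mf; apply: measurableT_comp; first exact: oppe_measurable.
apply: (measurable_fun_limn_esup (f := fun n x => (- f n x)%E)) => n.
by apply: measurableT_comp; first exact: oppe_measurable.
Qed.

Lemma measurable_neg_lne_dist (a : R) :
  measurable_fun setT (fun z : RT * RT => - lne (a * `|z.1 - z.2|)%:E)%E.
Proof.
have h : measurable_fun setT (fun z : RT * RT => (a * `|z.1 - z.2| : RT)).
  by apply: measurable_funM; [exact: measurable_cst|exact: measurable_dist2].
have h' := measurableT_comp measurable_lne_EFin h.
by apply: measurableT_comp h'; exact: oppe_measurable.
Qed.

Variable L : R.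
Hypothesis L1 : 1 <= L.
Let L0 : 0 < L := lt_le_trans ltr01 L1.

(** On [-L, L] the truncation at 0 changes nothing; elsewhere it keeps the kernel nonnegative, so
    that Tonelli's theorem applies on the whole plane. *)
Definition gker (x y : RT) : \bar R := maxe (logker (x / L) (y / L)) 0.

Lemma gker_ge0 x y : (0 <= gker x y)%E.
Proof. by rewrite /gker le_max lexx orbT. Qed.

Lemma gkerE x y : gker x y = maxe (- lne ((4 * L)^-1 * `|x - y|)%:E)%E 0.
Proof.
rewrite /gker /logker; congr (maxe (- lne _%:E) 0)%E.
rewrite -mulrBl normrM [`|L^-1|]gtr0_norm ?invr_gt0 //; field.
by rewrite gt_eqF.
Qed.

Lemma measurable_gker2 : measurable_fun setT (fun z : RT * RT => gker z.1 z.2).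
Proof.
rewrite (_ : (fun _ => _) =
  fun z : RT * RT => maxe (- lne ((4 * L)^-1 * `|z.1 - z.2|)%:E)%E 0); last first.
  by apply/funext => z; rewrite gkerE.
apply: measurable_maxe; first exact: measurable_neg_lne_dist.
exact: measurable_cst.
Qed.

Lemma measurable_gker x : measurable_fun setT (gker x).
Proof.
exact: (measurable_fun_pair2 x measurable_gker2).
Qed.

Lemma measurable_potential (mu : proba) :
  measurable_fun setT (fun x => \int[mu]_y gker x y)%E.
Proof.
apply: (@measurable_fun_fubini_tonelli_F _ _ RT RT R mu (fun z => gker z.1 z.2)).
  exact: measurable_gker2.
by move=> z; exact: gker_ge0.
Qed.

Lemma scaled_le1 (x : R) : `|x| <= L -> `|x / L| <= 1.
Proof.
by move=> xL; rewrite normrM normfV (gtr0_norm L0) ler_pdivrMr ?mul1r.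
Qed.

Lemma gker_logker (x y : R) : `|x| <= L -> `|y| <= L ->
  gker x y = logker (x / L) (y / L).
Proof.
move=> /scaled_le1 xL /scaled_le1 yL; rewrite /gker max_l //.
have [->|xy] := eqVneq (x / L) (y / L); first by rewrite logkerxx leey.
rewrite logker_neq // lee_fin oppr_ge0 ln_le0 // ler_pdivrMr // mul1r.
by apply: le_trans (ler_normB _ _) _; lra.
Qed.

Definition scaleX : {poly R} := L^-1 *: 'X.

Definition moment (nu : proba) k := Ex nu (cheb R k \Po scaleX).

Lemma horner_scaleX p x : (p \Po scaleX).[x] = p.[x / L].
Proof. by rewrite horner_comp hornerZ hornerX mulrC. Qed.

(** The regularized energy as a diagonal form with nonnegative weights; [u] and [v] are Chebyshev
    moments of a measure or Chebyshev values at a point. *)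
Definition ksum (r : R) m (u v : nat -> R) :=
  \sum_(1 <= k < m.+1) 2 / k%:R * r ^+ k * (u k * v k).

Definition kpoly (r : R) m (u : nat -> R) C : {poly R} :=
  \sum_(1 <= k < m.+1) (2 / k%:R * r ^+ k * u k) *: (cheb R k \Po scaleX) + C%:P.

Lemma horner_kpoly r m u C x :
  (kpoly r m u C).[x] = ksum r m u (fun k => (cheb R k).[x / L]) + C.
Proof.
rewrite hornerD hornerC horner_sum; congr (_ + _); apply: eq_bigr => k _.
by rewrite hornerZ horner_scaleX mulrA.
Qed.

Lemma horner_kpoly_cheb r m C x y :
  (kpoly r m (fun k => (cheb R k).[x / L]) C).[y] =
    cheb_kernel r m (x / L) (y / L) + C.
Proof. by rewrite horner_kpoly. Qed.

Lemma ksumC r m u v : ksum r m u v = ksum r m v u.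
Proof. by apply: eq_bigr => k _; rewrite [u k * _]mulrC. Qed.

Variable S : set RT.
Hypotheses (mS : measurable S) (SL : forall x, S x -> `|x| <= L).

Section OneMeasure.
Variable mu : proba.
Hypothesis muS : mu S = 1%E.

Lemma Ex_kpoly r m u C : Ex mu (kpoly r m u C) = ksum r m u (moment mu) + C.
Proof.
rewrite (ExD mS muS SL) ExC (Ex_sum mS muS SL); congr (_ + _).
by apply: eq_bigr => k _; rewrite (ExZ mS muS SL) mulrA.
Qed.

Lemma potential_ge r m C (x : R) : `|x| <= L ->
  (forall x y, `|x| <= 1 -> `|y| <= 1 ->
     ((cheb_kernel r m x y + C)%:E <= logker x y)%E) ->
  ((ksum r m (fun k => (cheb R k).[x / L]) (moment mu) + C)%:E
     <= \int[mu]_y gker x y)%E.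
Proof.
move=> xL h; rewrite -Ex_kpoly -(integral_poly mS muS SL).
apply: (le_integral_ge0 mS muS).
- exact: measurable_gker.
- exact: measurable_horner.
- by move=> y _; exact: gker_ge0.
- move=> y Sy; rewrite horner_kpoly_cheb gker_logker ?(SL Sy) //.
  by apply: h; apply: scaled_le1 => //; exact: SL.
Qed.

Lemma potential_le_liminf (r C : R^nat) (m : nat -> nat) (x : R) : `|x| <= L ->
  (forall x y, `|x| <= 1 -> `|y| <= 1 ->
     (forall n, 0 <= cheb_kernel (r n) (m n) x y + C n) /\
     (logker x y <= limn_einf (fun n => (cheb_kernel (r n) (m n) x y + C n)%:E))%E) ->
  (\int[mu]_y gker x y <= limn_einf (fun n =>
    (ksum (r n) (m n) (fun k => (cheb R k).[x / L]) (moment mu) + C n)%:E))%E.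
Proof.
move=> xL h.
pose f n (y : RT) := ((kpoly (r n) (m n) (fun k => (cheb R k).[x / L]) (C n)).[y])%:E.
have mf n : measurable_fun setT (f n) by apply/measurable_EFinP; exact: measurable_horner.
have f0 n y : S y -> (0 <= f n y)%E.
  move=> Sy; rewrite lee_fin horner_kpoly_cheb.
  by have [] := h _ _ (scaled_le1 xL) (scaled_le1 (SL Sy)).
rewrite (integral_full mS muS); last exact: measurable_gker.
apply: (@le_trans _ _ (\int[mu]_(y in S) limn_einf (f^~ y))%E).
  apply: ge0_le_integral => //.
  - by move=> y _; exact: gker_ge0.
  - by apply: measurable_funTS; exact: measurable_gker.
  - by apply: measurable_fun_limn_einf => n; exact: measurable_funTS.
  - move=> y Sy; rewrite gker_logker ?(SL Sy) //.
    have [_] := h _ _ (scaled_le1 xL) (scaled_le1 (SL Sy)).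
    by rewrite /f; under eq_fun do rewrite -horner_kpoly_cheb.
apply: le_trans (fatou mu mS (fun n => measurable_funTS (mf n)) f0) _.
rewrite le_eqVlt; apply/orP; left; apply/eqP; congr limn_einf.
apply/funext => n.
by rewrite -(integral_full mS muS) // (integral_poly mS muS SL) Ex_kpoly.
Qed.

End OneMeasure.

Lemma energy_ge (nu mu : proba) r m C : nu S = 1%E -> mu S = 1%E ->
  (forall x y, `|x| <= 1 -> `|y| <= 1 ->
     ((cheb_kernel r m x y + C)%:E <= logker x y)%E) ->
  ((ksum r m (moment nu) (moment mu) + C)%:E
     <= \int[nu]_x \int[mu]_y gker x y)%E.
Proof.
move=> nuS muS h; rewrite ksumC -(Ex_kpoly nuS) -(integral_poly mS nuS SL).
apply: (le_integral_ge0 mS nuS).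
- exact: measurable_potential.
- exact: measurable_horner.
- by move=> x _; apply: integral_ge0 => y _; exact: gker_ge0.
- move=> x Sx; rewrite horner_kpoly ksumC; apply: potential_ge => //; exact: SL.
Qed.

Lemma energy_le_liminf (nu mu : proba) (r C : R^nat) (m : nat -> nat) :
  nu S = 1%E -> mu S = 1%E ->
  (forall x y, `|x| <= 1 -> `|y| <= 1 ->
     (forall n, 0 <= cheb_kernel (r n) (m n) x y + C n) /\
     (logker x y <= limn_einf (fun n => (cheb_kernel (r n) (m n) x y + C n)%:E))%E) ->
  (\int[nu]_x \int[mu]_y gker x y <= limn_einf (fun n =>
    (ksum (r n) (m n) (moment nu) (moment mu) + C n)%:E))%E.
Proof.
move=> nuS muS h.
pose f n (x : RT) := ((kpoly (r n) (m n) (moment mu) (C n)).[x])%:E.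
have mf n : measurable_fun setT (f n) by apply/measurable_EFinP; exact: measurable_horner.
have f0 n x : S x -> (0 <= f n x)%E.
  move=> Sx; rewrite lee_fin horner_kpoly ksumC -(Ex_kpoly muS).
  rewrite -[leLHS](ExC mu) (le_Ex mS muS SL) // => y Sy.
  rewrite hornerC horner_kpoly_cheb.
  by have [] := h _ _ (scaled_le1 (SL Sx)) (scaled_le1 (SL Sy)).
rewrite (integral_full mS nuS); last exact: measurable_potential.
apply: (@le_trans _ _ (\int[nu]_(x in S) limn_einf (f^~ x))%E).
  apply: ge0_le_integral => //.
  - by move=> x _; apply: integral_ge0 => y _; exact: gker_ge0.
  - by apply: measurable_funTS; exact: measurable_potential.
  - by apply: measurable_fun_limn_einf => n; exact: measurable_funTS.
  - move=> x Sx; apply: le_trans (potential_le_liminf muS (SL Sx) h) _.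
    by rewrite /f; under [in leRHS]eq_fun do rewrite horner_kpoly ksumC.
apply: le_trans (fatou nu mS (fun n => measurable_funTS (mf n)) f0) _.
rewrite le_eqVlt; apply/orP; left; apply/eqP; congr limn_einf.
apply/funext => n.
by rewrite -(integral_full mS nuS) // (integral_poly mS nuS SL) Ex_kpoly // ksumC.
Qed.

(** The potential of [mu] is constant, so both its own energy and its mutual energy with [nu] are V.
    Expand the diagonal form at the difference of the moments: the two square terms are bounded
    above by energies, the cross term below through Fatou's lemma. So the form is at most E - V +
    o(1), with E the energy of [nu], and each of its terms is nonnegative. *)
Lemma energy_compare (nu mu : proba) (V : R) : nu S = 1%E -> mu S = 1%E ->
  (forall x, S x -> \int[mu]_y gker x y = V%:E)%E ->
  (V%:E <= \int[nu]_x \int[nu]_y gker x y)%E /\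
  ((\int[nu]_x \int[nu]_y gker x y <= V%:E)%E ->
    forall k, (0 < k)%N -> moment nu k = moment mu k).
Proof.
move=> nuS muS hV.
have EV (la : proba) : la S = 1%E -> (\int[la]_x \int[mu]_y gker x y = V%:E)%E.
  move=> laS; rewrite (eq_integral_full mS laS (g := cst V%:E)) //.
    by rewrite integral_cst //= probability_setT mule1.
  exact: measurable_potential.
have [r [e [m [hrm r1 e0 happ]]]] := logker_approx R.
pose E := (\int[nu]_x \int[nu]_y gker x y)%E.
pose dif k := moment nu k - moment mu k.
(* Of the 8 [del], two come from [ln (r n)], four from [e n] and two from the cross term. The power
   of 1/2 is the lower bound on [r n ^+ k]. *)
have key X : (E <= X%:E)%E -> forall (del : R) k, 0 < del -> (0 < k)%N ->
    V - 8 * del + 2 / k%:R * 2^-1 ^+ k * dif k ^+ 2 <= X.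
  move=> EX del k del0 k0.
  have cross : (V%:E <= limn_einf (fun n =>
      (ksum (r n) (m n) (moment nu) (moment mu) + (ln 8 + e n))%:E))%E.
    rewrite -(EV _ nuS); apply: energy_le_liminf => // x y x1 y1.
    have [_ h1 h2] := happ x y x1 y1; split => [n|]; first by rewrite addrA.
    by under [in leRHS]eq_fun do rewrite addrA.
  have Vlt : ((V - del)%:E < limn_einf (fun n =>
      (ksum (r n) (m n) (moment nu) (moment mu) + (ln 8 + e n))%:E))%E.
    by apply: lt_le_trans cross; rewrite lte_fin ltrBlDr ltrDl.
  have lnr : (fun n => ln (r n)) @ \oo --> (0 : R).
    rewrite -(ln1 R); apply: (continuous_cvg _ (continuous_ln ltr01)).
    exact: r1.
  move/cvgrPdist_le : lnr => /(_ _ del0) N1.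
  move/cvgrPdist_le : e0 => /(_ _ del0) N2.
  have N3 := lt_limn_einf Vlt.
  have N4 : \forall n \near \oo, (k <= n)%N by exists k.
  have [n [[n1 n2] [n3 n4]]] := filter_ex (filterI (filterI N1 N2) (filterI N3 N4)).
  have [/andP[rn rn1] nm] := hrm n.
  have rn0 : 0 < r n by apply: lt_le_trans rn; rewrite invr_gt0.
  have lb x y : `|x| <= 1 -> `|y| <= 1 ->
      ((cheb_kernel (r n) (m n) x y + (ln (8 * r n) - e n))%:E <= logker x y)%E.
    by move=> x1 y1; have [h _ _] := happ x y x1 y1; rewrite addrA.
  have lbn := le_trans (energy_ge nuS nuS lb) EX.
  have lbm := energy_ge muS muS lb; rewrite (EV _ muS) in lbm.
  rewrite lee_fin in lbn; rewrite lee_fin in lbm; rewrite lte_fin in n3.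
  have l8 : ln (8 * r n) = ln 8 + ln (r n) by rewrite lnM ?posrE.
  have De : ksum (r n) (m n) dif dif = ksum (r n) (m n) (moment nu) (moment nu)
     - 2 * ksum (r n) (m n) (moment nu) (moment mu)
     + ksum (r n) (m n) (moment mu) (moment mu).
    rewrite /ksum mulr_sumr -sumrB -big_split /=; apply: eq_bigr => j _.
    by rewrite /dif; ring.
  have Dk : 2 / k%:R * 2^-1 ^+ k * dif k ^+ 2 <= ksum (r n) (m n) dif dif.
    rewrite /ksum (bigD1_seq k) ?iota_uniq //=; last first.
      by rewrite mem_index_iota k0 ltnS (leq_trans n4).
    rewrite -[leLHS]addr0 lerD //; last first.
      apply: sumr_ge0 => j _; rewrite -expr2 mulr_ge0 ?sqr_ge0 //.
      by rewrite mulr_ge0 ?divr_ge0 // exprn_ge0 // ltW.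
    rewrite -expr2 ler_wpM2r ?sqr_ge0 // ler_wpM2l ?divr_ge0 //.
    by rewrite lerXn2r ?nnegrE ?invr_ge0 // ltW.
  move: n1 n2; rewrite !sub0r !normrN !ler_norml => /andP[? ?] /andP[? ?].
  by lra.
have lim (X Y : R) : (forall del : R, 0 < del -> Y - 8 * del <= X) -> Y <= X.
  move=> h; apply/ler_addgt0Pr => eps eps0.
  have e8 : 0 < eps / 8 by rewrite divr_gt0.
  by have := h _ e8; lra.
have ge0 k : 0 <= 2 / k%:R * 2^-1 ^+ k * dif k ^+ 2.
  by rewrite mulr_ge0 ?sqr_ge0 // mulr_ge0 ?divr_ge0 // exprn_ge0 // invr_ge0.
have E0 : (0 <= E)%E.
  by apply: integral_ge0 => x _; apply: integral_ge0 => y _; exact: gker_ge0.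
split.
  rewrite -/E; case: E E0 key => [X| |] // _ key; last by rewrite leey.
  rewrite lee_fin; apply: lim => del del0.
  by have := key X (lexx _) del 1%N del0 isT; have := ge0 1%N; lra.
move=> EV' k k0.
have : 2 / k%:R * 2^-1 ^+ k * dif k ^+ 2 <= 0.
  apply: lim => del del0; have := key V EV' del k del0 k0; lra.
move=> le0; apply/eqP; rewrite -subr_eq0 -/(dif k) -(sqrf_eq0 (dif k)).
rewrite eq_le sqr_ge0 andbT; move: le0; rewrite pmulr_rle0 //.
by rewrite mulr_gt0 ?divr_gt0 ?ltr0n // exprn_gt0 // invr_gt0.
Qed.

Lemma log_energyE (nu : proba) : nu S = 1%E ->
  (log_energy nu = \int[nu]_x \int[nu]_y gker x y - (ln (4 * L))%:E)%E.
Proof.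
move=> nuS; pose C := ln (4 * L).
have C0 : 0 <= C.
  by rewrite ln_ge0 // (le_trans L1) // ler_peMl ?ler1n // ltW.
have L40 : 0 < 4 * L by rewrite mulr_gt0.
have m1 : measurable_fun setT (fun z : RT * RT => - lne `|z.1 - z.2|%:E)%E.
  have := measurable_neg_lne_dist 1; congr measurable_fun.
  by apply/funext => z; rewrite mul1r.
have gE (x y : R) : `|x| <= L -> `|y| <= L ->
    (- lne `|x - y|%:E)%E = (gker x y - C%:E)%E.
  move=> xL yL; rewrite gker_logker //.
  have [->|xy] := eqVneq x y; first by rewrite logkerxx subrr normr0 /= lexx.
  have xy' : x / L != y / L.
    by rewrite (inj_eq (mulIf _)) // invr_neq0 // gt_eqF.
  have d0 : 0 < `|x - y| by rewrite normr_gt0 subr_eq0.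
  rewrite logker_neq // lne_EFin // -EFinN -EFinB; congr EFin.
  have -> : `|x / L - y / L| / 4 = `|x - y| / (4 * L).
    rewrite -mulrBl normrM [`|L^-1|]gtr0_norm ?invr_gt0 //; field.
    by rewrite gt_eqF.
  by rewrite ln_div ?posrE // /C; lra.
(* Tonelli's theorem concerns nonnegative kernels, so the inner integral is split into its positive
   and negative parts. *)
have mG : measurable_fun setT (fun x : RT => \int[nu]_y (- lne `|x - y|%:E))%E.
  rewrite (_ : (fun _ => _) = (fun x : RT =>
     \int[nu]_y ((fun z : RT * RT => - lne `|z.1 - z.2|%:E)^\+ (x, y)) -
     \int[nu]_y ((fun z : RT * RT => - lne `|z.1 - z.2|%:E)^\- (x, y)))%E); last first.
    apply/funext => x; rewrite integralE; congr (_ - _)%E; apply: eq_integral => y _.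
      by rewrite !funeposE.
    by rewrite !funenegE.
  apply: emeasurable_funB.
    apply: (@measurable_fun_fubini_tonelli_F _ _ RT RT R nu) => //.
    exact: measurable_funepos.
  apply: (@measurable_fun_fubini_tonelli_F _ _ RT RT R nu) => //.
  exact: measurable_funeneg.
rewrite /log_energy -integral_subC //; last 2 first.
- exact: measurable_potential.
- by move=> x; apply: integral_ge0 => y _; exact: gker_ge0.
apply: (eq_integral_full mS nuS) => //.
  by apply: emeasurable_funB; [exact: measurable_potential|exact: measurable_cst].
move=> x Sx; rewrite -integral_subC //; last 2 first.
- exact: measurable_gker.
- by move=> y; exact: gker_ge0.
apply: (eq_integral_full mS nuS) => //.
- exact: (measurable_fun_pair2 x m1).
- by apply: emeasurable_funB; [exact: measurable_gker|exact: measurable_cst].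
- by move=> y Sy; apply: gE; exact: SL.
Qed.

End Energy.

(** * Pushforwards, mixtures and the arcsine law *)

Section Measures.
Variable R : realType.
Local Notation RT := (measurableTypeR R).
Local Notation proba := (probability RT R).

Lemma exists_pushforward (P : proba) (f : RT -> RT) : measurable_fun setT f ->
  exists Q : proba, forall h : RT -> \bar R, measurable_fun setT h ->
    (forall x, (0 <= h x)%E) -> (\int[Q]_x h x = \int[P]_x h (f x))%E.
Proof.
move=> mf; pose F : {mfun RT >-> RT} := HB.pack f (isMeasurableFun.Build _ _ _ _ f mf).
exists (distribution P F) => h mh h0.
by rewrite ge0_integral_distribution.
Qed.

Lemma exists_mixture (N : nat) (Q : nat -> proba) : (0 < N)%N ->
  exists mu : proba, forall h : RT -> \bar R, measurable_fun setT h ->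
    (forall x, (0 <= h x)%E) ->
    (\int[mu]_x h x = (N%:R^-1)%:E * \sum_(i < N) \int[Q i]_x h x)%E.
Proof.
move=> N0.
have iN0 : 0 <= N%:R^-1 :> R by rewrite invr_ge0.
pose m : measure RT R := mscale (NngNum iN0) (msum (fun i => Q i : measure RT R) N).
have m1 : m setT = 1%E.
  rewrite /m /= /mscale /= /msum /=.
  under eq_bigr do rewrite probability_setT.
  rewrite sumEFin sumr_const card_ord -EFinM mulVf //.
  by rewrite pnatr_eq0 -lt0n.
exists (mnormalize m (Q 0%N)) => h mh h0.
transitivity (\int[m]_x h x)%E.
  apply: eq_measure_integral => A _ _; rewrite /= /mnormalize m1.
  by rewrite onee_eq0 /= invr1 mule1.
by rewrite ge0_integral_mscale //= ge0_integral_measure_sum.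
Qed.

Lemma sin_natpi n : sin (n%:R * pi : R) = 0.
Proof.
elim: n => [|n IH]; first by rewrite mul0r sin0.
by rewrite -addn1 natrD mulrDl mul1r sinDpi IH oppr0.
Qed.

(** The image of the uniform law on [0, 1] under s -> cos(pi s). The endpoints -1 and 1 are reached
    only at s = 1 and s = 0, and T_k becomes cos(k pi s), of mean 0. *)
Lemma exists_arcsine : exists ac : proba,
  ac `]-1, 1[%classic = 1%E /\ forall k, (0 < k)%N -> Ex ac (cheb R k) = 0.
Proof.
have mcos : measurable_fun setT (fun s : RT => cos (s * pi) : RT).
  apply: continuous_measurable_fun => s.
  apply: (@continuous_comp _ _ _ (fun s : R => s * pi) (@cos R)).
    by apply: mulrr_continuous.
  exact: continuous_cos.
pose U : proba := uniform_prob (@ltr01 R).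
have [ac acE] := exists_pushforward U mcos.
have acE' (h : RT -> \bar R) : measurable_fun setT h -> (forall x, (0 <= h x)%E) ->
    (\int[ac]_x h x = \int[lebesgue_measure]_(s in `[0%R, 1%R]) h (cos (s * pi)))%E.
  move=> mh h0; rewrite acE // integral_uniform //; last exact: measurableT_comp.
  by rewrite subr0 invr1 mul1e.
have acI : ac `]-1, 1[%classic = 1%E.
  have mI : measurable (`]-1, 1[%classic : set RT) by exact: measurable_itv.
  apply/eqP; rewrite eq_le probability_le1 //=.
  have -> : ac `]-1, 1[%classic = (\int[ac]_x (\1_(`]-1, 1[%classic) x)%:E)%E.
    by rewrite integral_indic // setIT.
  rewrite acE'; last 2 first.
  - by apply/measurable_EFinP; exact: measurable_indic.
  - by move=> x; rewrite lee_fin.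
  have m01 : measurable (`]0, 1[%classic : set RT) by exact: measurable_itv.
  apply: (@le_trans _ _ (\int[lebesgue_measure]_(s in `]0%R, 1%R[)
      (\1_(`]-1, 1[%classic) (cos (s * pi) : RT) : R)%:E)%E).
    rewrite (eq_integral (cst 1%E)) => [|s]; last first.
      rewrite inE /= in_itv /= => /andP[s0 s1].
      have sp : s * pi \in `[0, pi].
        rewrite in_itv /=; apply/andP; split; first by rewrite mulr_ge0 ?pi_ge0 // ltW.
        by rewrite -[leRHS]mul1r ler_wpM2r ?pi_ge0 // ltW.
      rewrite indicE mem_set //= in_itv /= !lt_neqAle cos_geN1 cos_le1 !andbT.
      apply/andP; split; apply/eqP.
        move=> /(congr1 (@acos R)); rewrite acosN1 cosK // => /eqP.
        rewrite -subr_eq0 -[X in X - _]mul1r -mulrBl mulf_eq0 gt_eqF ?subr_gt0 //.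
        by rewrite gt_eqF // pi_gt0.
      move=> /(congr1 (@acos R)); rewrite acos1 cosK // => /eqP.
      by rewrite mulf_eq0 !gt_eqF // pi_gt0.
    by rewrite integral_cst //= lebesgue_measure_itv /= lte_fin ltr01 sube0 mule1.
  apply: ge0_subset_integral => //.
  - apply: measurable_funTS; apply/measurable_EFinP.
    by apply: measurableT_comp mcos; exact: measurable_indic.
  - by move=> x /=; rewrite !in_itv /= => /andP[a b]; rewrite !ltW.
exists ac; split => // k k0.
have cos1 (s : RT) : `]-1, 1[%classic s -> `|s| <= 1.
  by rewrite /= in_itv /= ler_norml => /andP[a b]; rewrite !ltW.
have miv : measurable (`]-1, 1[%classic : set RT) by exact: measurable_itv.
(* The change of variables is available for nonnegative functions; adding 1 makes T_k nonnegative on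
   [-1, 1]. *)
pose p : {poly R} := 1%:P + cheb R k.
have p0 (s : R) : `|s| <= 1 -> 0 <= p.[s].
  move=> s1; rewrite hornerD hornerC; have := normr_cheb_le1 k s1.
  by rewrite ler_norml => /andP[a b]; lra.
suff : Ex ac p = 1.
  by rewrite (ExD miv acI cos1) ExC => e; lra.
apply: EFin_inj; rewrite -(integral_poly miv acI cos1).
pose h (x : RT) : \bar R := (Num.max p.[x] 0)%:E.
have mh : measurable_fun setT h.
  apply/measurable_EFinP; apply: measurable_maxr; last exact: measurable_cst.
  exact: measurable_horner.
have h0 x : (0 <= h x)%E by rewrite lee_fin le_max lexx orbT.
transitivity (\int[ac]_x h x)%E.
  apply: (eq_integral_full miv acI) => //.
    by apply/measurable_EFinP; exact: measurable_horner.
  by move=> x /cos1 x1; rewrite /h max_l // p0.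
rewrite acE' //.
pose kp : R := k%:R * pi.
have kp0 : kp != 0 by rewrite mulf_neq0 ?pnatr_eq0 -?lt0n // gt_eqF // pi_gt0.
pose F : R -> R := id + kp^-1 \*: (@sin R \o (kp \*: id)).
pose f (s : R) : R := 1 + kp^-1 *: (cos (kp * s) * (kp *: 1)).
have FE (s : R) : F s = s + kp^-1 * sin (kp * s) by [].
have fE (s : R) : f s = 1 + cos (kp * s).
  by rewrite /f /GRing.scale /= mulr1 mulrCA mulVf // mulr1.
have hf (s : R) : h (cos (s * pi)) = (f s)%:E.
  rewrite /h max_l; last by rewrite p0 // ler_norml cos_geN1 cos_le1.
  by rewrite hornerD hornerC cheb_cos fE /kp mulrAC mulrA.
under eq_integral do rewrite hf.
have dF (s : R) : is_derive s 1 F (f s).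
  apply: is_deriveD; apply: is_deriveZ; apply: is_derive1_comp.
have cF (s : R) : {for s, continuous F}.
  by apply/differentiable_continuous/derivable1_diffP; have [] := dF s.
rewrite (@continuous_FTC2 R f F 0 1) //.
- by rewrite !FE mulr1 mulr0 sin0 sin_natpi !mulr0 !addr0 sube0.
- apply: continuous_subspaceT => s; rewrite (_ : f = fun s => 1 + cos (kp * s)).
    apply: cvgD; first exact: cvg_cst.
    apply: (@continuous_comp _ _ _ (fun s : R => kp * s) (@cos R)).
      exact: mulrl_continuous.
    exact: continuous_cos.
  by apply/funext => x; rewrite fE.
- split; first by move=> s _; have [] := dF s.
    by apply: cvg_at_right_filter; exact: cF.
  by apply: cvg_at_left_filter; exact: cF.
- by move=> s _; rewrite derive1E; have [_] := dF s.
Qed.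

End Measures.

(** * The equilibrium measure of a polynomial preimage *)

Section Equilibrium.
Variable R : realType.
Local Notation RT := (measurableTypeR R).
Local Notation proba := (probability RT R).

Lemma measurable_itvoo1 : measurable (`]-1, 1[%classic : set RT).
Proof. exact: measurable_itv. Qed.

Lemma itvoo1_le1 (x : RT) : `]-1, 1[%classic x -> `|x| <= 1.
Proof. by rewrite /= in_itv /= ler_norml => /andP[a b]; rewrite !ltW. Qed.

Lemma integral_addC (mu : proba) (f : RT -> \bar R) (D : R) :
  measurable_fun setT f -> (forall x, (0 <= f x)%E) ->
  (\int[mu]_x (f x + D%:E) = \int[mu]_x f x + D%:E)%E.
Proof.
move=> mf f0; have [D0|D0] := leP 0 D.
  rewrite ge0_integralD //; first by rewrite integral_cst //= probability_setT mule1.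
have e : D%:E = (- (- D)%:E)%E by rewrite -EFinN opprK.
rewrite e; apply: integral_subC => //; rewrite oppr_ge0; exact: ltW.
Qed.

Lemma ge0_integral_sum_ord (mu : proba) N (f : nat -> RT -> \bar R) :
  (forall i, measurable_fun setT (f i)) -> (forall i x, (0 <= f i x)%E) ->
  (\sum_(i < N) \int[mu]_x f i x = \int[mu]_x \sum_(i < N) f i x)%E.
Proof.
move=> mf f0; under eq_integral do rewrite -(big_mkord xpredT (fun i => f i _)).
rewrite -(big_mkord xpredT (fun i => \int[mu]_x f i x)%E).
by rewrite ge0_integral_sum.
Qed.

Variable ac : proba.
Hypotheses (ac1 : ac `]-1, 1[%classic = 1%E)
  (acT : forall k, (0 < k)%N -> Ex ac (cheb R k) = 0).

(** All moments of positive index vanish, so the approximants reduce to constants tending to ln 8: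
    the classical ln 2 for [-1, 1] plus the ln 4 built into [logker]. *)
Lemma arcsine_potential (w : R) : `|w| <= 1 ->
  (\int[ac]_v gker 1 w v = (ln 8)%:E)%E.
Proof.
move=> w1; have m1 := measurable_itvoo1; have b1 := itvoo1_le1.
have [r [e [m [hrm r1 e0 happ]]]] := logker_approx R.
have m0 k : (0 < k)%N -> moment 1 ac k = 0.
  move=> k0; rewrite /moment /scaleX invr1 scale1r comp_polyXr; exact: acT.
have ks0 s n u : ksum s n u (moment 1 ac) = 0.
  rewrite /ksum big_nat big1 // => k /andP[k1 _].
  by rewrite m0 // !mulr0.
have e8 : (fun n => ln 8 + e n) @ \oo --> (ln 8 : R).
  by rewrite -[X in _ --> X]addr0; apply: cvgD => //; exact: cvg_cst.
apply/eqP; rewrite eq_le; apply/andP; split.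
  have := @potential_le_liminf R 1 (lexx _) _ m1 b1 ac ac1 r (fun n => ln 8 + e n) m w w1.
  move=> h; apply: (le_trans (h _)).
    move=> x y x1 y1; have [_ h1 h2] := happ x y x1 y1; split => [n|].
      by rewrite addrA.
    by under [in leRHS]eq_fun do rewrite addrA.
  under [in leLHS]eq_fun do rewrite ks0 add0r.
  have c : (fun n => (ln 8 + e n)%:E) @ \oo --> (ln 8)%:E.
    by apply: cvg_EFin => //; exact: nearW.
  by have [-> _] := cvg_limn_einf_sup c.
have lnr : (fun n => ln (r n)) @ \oo --> (0 : R).
  by rewrite -(ln1 R); apply: (continuous_cvg _ (continuous_ln ltr01)).
have c : (fun n => (ln 8 + ln (r n) - e n)%:E) @ \oo --> (ln 8)%:E.
  apply: cvg_EFin; first exact: nearW.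
  rewrite -[X in _ --> X]subr0; apply: cvgB => //.
  by rewrite -[X in _ --> X]addr0; apply: cvgD => //; exact: cvg_cst.
rewrite -(cvg_lim _ c) //; apply: lime_le; first by apply/cvg_ex; exists (ln 8)%:E.
apply: nearW => n; have [/andP[rn rn1] _] := hrm n.
have rn0 : 0 < r n by apply: lt_le_trans rn; rewrite invr_gt0.
have := @potential_ge R 1 (lexx _) _ m1 b1 ac ac1 (r n) (m n) (ln (8 * r n) - e n) w w1.
rewrite ks0 add0r lnM ?posrE //; apply => x y x1 y1.
by have [h _ _] := happ x y x1 y1; rewrite -lnM ?posrE // addrA.
Qed.

Lemma sum_ln (I : finType) (f : I -> R) : (forall i, 0 < f i) ->
  \sum_i ln (f i) = ln (\prod_i f i).
Proof.
move=> f0; suff : \sum_i ln (f i) = ln (\prod_i f i) /\ 0 < \prod_i f i by case.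
elim/big_rec2: _ => [|i y x _ [-> x0]]; first by rewrite ln1.
by rewrite lnM ?posrE // mulr_gt0.
Qed.

Variables (T : {poly R}) (N : nat) (g : nat -> R -> R) (L : R).
Hypotheses (N0 : (0 < N)%N) (T0 : T != 0)
  (mg : forall i, measurable_fun setT (g i : RT -> RT))
  (splitT : forall w : R, -1 < w < 1 ->
     T - w%:P = lead_coef T *: \prod_(i < N) ('X - (g i w)%:P))
  (L1 : 1 <= L) (KL : forall x, poly_preimage T x -> `|x| <= L).

Local Notation K := (poly_preimage T : set RT).
Local Notation c := (lead_coef T).

Let c0 : 0 < `|c|. Proof. by rewrite normr_gt0 lead_coef_eq0. Qed.
Let L0 : 0 < L. Proof. exact: lt_le_trans ltr01 L1. Qed.

Lemma measurable_poly_preimage : measurable K.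
Proof.
rewrite (_ : K = horner T @^-1` `[-1, 1]%classic); last by [].
by rewrite -[X in measurable X]setTI; apply: measurable_horner => //; exact: measurable_itv.
Qed.

Lemma horner_sub_split x w : -1 < w < 1 ->
  T.[x] - w = c * \prod_(i < N) (x - g i w).
Proof.
move=> /splitT /(congr1 (horner^~ x)); rewrite hornerD hornerN hornerC => ->.
rewrite hornerZ horner_prod; congr (_ * _); apply: eq_bigr => i _.
by rewrite hornerXsubC.
Qed.

Lemma root_in_preimage i w : (i < N)%N -> -1 < w < 1 -> K (g i w).
Proof.
move=> iN hw; have := horner_sub_split (g i w) hw.
rewrite (bigD1 (Ordinal iN)) //= subrr mul0r mulr0 => /eqP.
rewrite subr_eq0 => /eqP; rewrite /poly_preimage /= => ->.
by rewrite in_itv /=; case/andP: hw => a b; rewrite !ltW.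
Qed.

(** The logarithm of T(x) - w = c prod_i (x - g_i(w)), with both sides infinite when T(x) = w. The
    constants come from the scalings of the kernels, 4L on the left and 4 on the right, and from
    c. *)
Lemma sum_gker_roots (x w : R) : K x -> -1 < w < 1 ->
  (\sum_(i < N) gker L x (g i w) =
   gker 1 T.[x] w + (N%:R * ln (4 * L) + ln `|c| - ln 4)%:E)%E.
Proof.
move=> Kx hw; have e := horner_sub_split x hw.
have Tx : `|T.[x]| <= 1 by move: Kx; rewrite /poly_preimage /= in_itv /= ler_norml.
have w1 : `|w| <= 1 by rewrite ler_norml; case/andP: hw => a b; rewrite !ltW.
have gK (i : 'I_N) : `|g i w| <= L by apply: KL; exact: root_in_preimage.
rewrite [gker 1 _ _]gker_logker // !divr1.
have [Tw|Tw] := eqVneq T.[x] w.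
  rewrite Tw logkerxx addye //.
  have : \prod_(i < N) (x - g i w) == 0.
    have := e; rewrite Tw subrr => /esym/eqP; rewrite mulf_eq0.
    by rewrite lead_coef_eq0 (negPf T0).
  move=> /prodf_eq0 [i _]; rewrite subr_eq0 => /eqP xi.
  rewrite (bigD1 i) //= -xi gker_logker ?(KL Kx) // logkerxx addye //.
  rewrite gt_eqF // (lt_le_trans (ltNyr 0)) // sume_ge0 // => j _; exact: gker_ge0.
have xg (i : 'I_N) : x != g i w.
  apply: contraNneq Tw => xi; rewrite -subr_eq0 e (bigD1 i) //= -xi subrr.
  by rewrite mul0r mulr0.
have L40 : 0 < 4 * L by rewrite mulr_gt0.
have gE (i : 'I_N) : gker L x (g i w) = (- ln (`|x - g i w| / (4 * L)))%:E.
  rewrite gker_logker ?(KL Kx) ?gK // logker_neq; last first.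
    by rewrite (inj_eq (mulIf _)) // invr_neq0 // gt_eqF.
  do 3 congr (_ _); rewrite -mulrBl normrM [`|L^-1|]gtr0_norm ?invr_gt0 //; field.
  by rewrite gt_eqF.
under eq_bigr do rewrite gE.
rewrite sumEFin sumrN sum_ln; last first.
  by move=> i; rewrite divr_gt0 // normr_gt0 subr_eq0.
have pE : \prod_(i < N) (`|x - g i w| / (4 * L)) =
    `|T.[x] - w| / `|c| / (4 * L) ^+ N.
  rewrite big_split /= -normr_prod prodr_const card_ord exprVn; congr (_ / _).
  by rewrite e normrM mulrAC mulfV ?mul1r // gt_eqF.
have d0 : 0 < `|T.[x] - w| by rewrite normr_gt0 subr_eq0.
rewrite pE logker_neq // -EFinD; congr EFin.
rewrite !ln_div ?posrE ?divr_gt0 ?exprn_gt0 // lnXn // mulr_natl.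
by lra.
Qed.

(** The Robin constant of the preimage, that is, minus the logarithm of its capacity. *)
Definition robin : R := N%:R^-1 * ln (2 * `|c|).

Lemma exists_equilibrium : exists mu : proba,
  [/\ mu K = 1%E,
      forall x, K x -> (\int[mu]_y gker L x y = (robin + ln (4 * L))%:E)%E &
      forall p A : {poly R}, (forall w, -1 < w < 1 -> \sum_(i < N) p.[g i w] = A.[w]) ->
        Ex mu p = N%:R^-1 * Ex ac A].
Proof.
have m1 := measurable_itvoo1; have b1 := itvoo1_le1.
have mK := measurable_poly_preimage.
have hg i : {Q : proba | forall h : RT -> \bar R, measurable_fun setT h ->
    (forall x, (0 <= h x)%E) -> (\int[Q]_x h x = \int[ac]_x h (g i x))%E}.
  exact: cid (exists_pushforward ac (mg i)).
have [mu muE0] := exists_mixture (fun i => sval (hg i)) N0.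
have muE (h : RT -> \bar R) : measurable_fun setT h -> (forall x, (0 <= h x)%E) ->
    (\int[mu]_x h x = (N%:R^-1)%:E * \int[ac]_w \sum_(i < N) h (g i w))%E.
  move=> mh h0; rewrite muE0 //; congr (_ * _)%E.
  rewrite -(ge0_integral_sum_ord ac N (f := fun i w => h (g i w))) //; last first.
    by move=> i; apply: measurableT_comp mh (mg i).
  by apply: eq_bigr => i _; rewrite (svalP (hg i)).
have muK : mu K = 1%E.
  have -> : mu K = (\int[mu]_x (\1_K x)%:E)%E by rewrite integral_indic // setIT.
  have mi : measurable_fun setT (fun x => (\1_K x : R)%:E).
    by apply/measurable_EFinP; exact: measurable_indic.
  rewrite muE //.
  rewrite (eq_integral_full m1 ac1 (g := cst N%:R%:E)) //.
  - by rewrite integral_cst //= probability_setT mule1 -EFinM mulVf // pnatr_eq0 -lt0n.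
  - by apply: emeasurable_sum => i; apply: measurableT_comp mi (mg i).
  - move=> w; rewrite /= in_itv /= => hw.
    under eq_bigr => i _ do rewrite indicE (mem_set (root_in_preimage (ltn_ord i) hw)).
    by rewrite sumEFin sumr_const card_ord.
have NN : N%:R != 0 :> R by rewrite pnatr_eq0 -lt0n.
exists mu; split => //.
- move=> x Kx.
  have mx := measurable_gker L1 x.
  have mx1 := measurable_gker (lexx (1 : R)) (T.[x] : RT).
  rewrite muE //; last by move=> y; exact: gker_ge0.
  rewrite (eq_integral_full m1 ac1 (g := fun w => gker 1 T.[x] w +
     (N%:R * ln (4 * L) + ln `|c| - ln 4)%:E)%E).
  + rewrite integral_addC //; last by move=> y; exact: gker_ge0.
    rewrite arcsine_potential; last by move: Kx; rewrite /poly_preimage /= in_itv /= ler_norml.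
    rewrite -EFinD -EFinM; congr EFin; rewrite /robin.
    have lc : ln (2 * `|c|) = ln 2 + ln `|c| by rewrite lnM ?posrE.
    have l8 : ln 8 = ln 4 + ln 2 :> R by rewrite -lnM ?posrE //; congr ln; ring.
    by rewrite l8 lc; field.
  + by apply: emeasurable_sum => i; apply: measurableT_comp mx (mg i).
  + by apply: emeasurable_funD => //; exact: measurable_cst.
  + by move=> w; rewrite /= in_itv /= => hw; rewrite sum_gker_roots.
- move=> p A hA; have [M hM] := horner_bounded KL p.
  (* The formula for [mu] holds for nonnegative functions, so [p] is shifted by a bound [M] on the
     preimage and cut off at 0 outside. *)
  pose h (x : RT) : \bar R := (Num.max (p.[x] + M) 0)%:E.
  have mh : measurable_fun setT h.
    apply/measurable_EFinP; apply: measurable_maxr; last exact: measurable_cst.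
    by apply: measurable_funD; [exact: measurable_horner|exact: measurable_cst].
  have h0 x : (0 <= h x)%E by rewrite lee_fin le_max lexx orbT.
  have hK x : K x -> h x = (p + M%:P).[x]%:E.
    move=> Kx; rewrite /h max_l ?hornerD ?hornerC //.
    by have := hM x Kx; rewrite ler_norml => /andP[]; lra.
  suff : Ex mu (p + M%:P) = N%:R^-1 * Ex ac (A + (N%:R * M)%:P).
    rewrite (ExD mK muK KL) (ExD m1 ac1 b1) !ExC => e.
    by apply: (addIr M); rewrite e mulrDr mulrA mulVf // mul1r.
  apply: EFin_inj; rewrite EFinM -(integral_poly mK muK KL) -(integral_poly m1 ac1 b1).
  transitivity (\int[mu]_x h x)%E.
    apply: (eq_integral_full mK muK) => //.
      by apply/measurable_EFinP; exact: measurable_horner.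
    by move=> x Kx; rewrite hK.
  rewrite muE //; congr (_ * _)%E; apply: (eq_integral_full m1 ac1) => //.
  + by apply: emeasurable_sum => i; apply: measurableT_comp mh (mg i).
  + by apply/measurable_EFinP; exact: measurable_horner.
  + move=> w; rewrite /= in_itv /= => hw.
    under eq_bigr => i _ do rewrite (hK _ (root_in_preimage (ltn_ord i) hw)) hornerD hornerC.
    rewrite sumEFin big_split /= hA // sumr_const card_ord.
    by rewrite hornerD hornerC mulr_natl.
Qed.

Lemma le_robin_energy (nu : proba) : nu K = 1%E -> (robin%:E <= log_energy nu)%E.
Proof.
move=> nuK; have mK := measurable_poly_preimage.
have [mu [muK pot _]] := exists_equilibrium.
have [h _] := energy_compare L1 mK KL nuK muK pot.
by rewrite (log_energyE L1 mK KL nuK) leeBrDr // -EFinD.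
Qed.

Lemma equilibrium_energy (nu : proba) : is_equilibrium_measure (poly_preimage T) nu ->
  log_energy nu = robin%:E.
Proof.
move=> [nuK nmin]; have mK := measurable_poly_preimage.
have [mu [muK pot _]] := exists_equilibrium.
apply/eqP; rewrite eq_le le_robin_energy // andbT.
apply: (le_trans (nmin _ muK)).
rewrite (log_energyE L1 mK KL muK).
rewrite (eq_integral_full mK muK (g := cst (robin + ln (4 * L))%:E)) //.
  by rewrite integral_cst //= probability_setT mule1 -EFinB addrK.
exact: measurable_potential.
Qed.

(** A minimizer has the energy of the constructed measure, so the equality case of [energy_compare]
    identifies their Chebyshev moments. Since these are moments in x/L, [p] is rescaled by L before
    it is expanded. *)
Lemma equilibrium_Ex (nu : proba) (p A : {poly R}) :
  is_equilibrium_measure (poly_preimage T) nu ->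
  (forall w, -1 < w < 1 -> \sum_(i < N) p.[g i w] = A.[w]) ->
  Ex nu p = N%:R^-1 * Ex ac A.
Proof.
move=> nueq; have en := equilibrium_energy nueq; have [nuK _] := nueq.
have mK := measurable_poly_preimage.
have [mu [muK pot muEx]] := exists_equilibrium.
have [_ h] := energy_compare L1 mK KL nuK muK pot.
move=> /muEx <-.
have mom : forall k, (0 < k)%N -> moment L nu k = moment L mu k.
  apply: h; move: en; rewrite (log_energyE L1 mK KL nuK) => en.
  by rewrite EFinD -en subeK.
have -> : p = (p \Po (L *: 'X)) \Po scaleX L.
  rewrite -comp_polyA comp_polyZ comp_polyX /scaleX scalerA mulfV ?gt_eqF //.
  by rewrite scale1r comp_polyXr.
have [m [al ->]] := cheb_decomposition (p \Po (L *: 'X)).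
rewrite comp_polyD comp_polyC raddf_sum /=.
rewrite (ExD mK nuK KL) (ExD mK muK KL) !ExC; congr (_ + _).
rewrite (Ex_sum mK nuK KL) (Ex_sum mK muK KL).
apply: eq_big_nat => k /andP[k1 _].
by rewrite comp_polyZ (ExZ mK nuK KL) (ExZ mK muK KL); congr (_ * _); exact: mom.
Qed.

End Equilibrium.

(** * Inverse branches of an admissible polynomial *)

Section Roots.
Variable R : realType.
Local Notation RT := (measurableTypeR R).

Lemma poly_preimage_bounded (T : {poly R}) : (1 < size T)%N ->
  exists2 L : R, 1 <= L & forall x, poly_preimage T x -> `|x| <= L.
Proof.
move=> sT; have [n sn] : exists n, size T = n.+2 by case: (size T) sT => [|[|n]] //; exists n.
pose c := lead_coef T; have c0 : 0 < `|c|.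
  by rewrite normr_gt0 lead_coef_eq0 -size_poly_gt0 sn.
pose s := \sum_(i < n.+1) `|T`_i|.
have s0 : 0 <= s by apply: sumr_ge0.
(* Beyond this bound |c x| > s + 1, and the leading term exceeds the others by more than 1. *)
exists (1 + (s + 1) / `|c|); first by rewrite lerDl divr_ge0 // ?addr_ge0.
move=> x; rewrite /poly_preimage /= in_itv /= -ler_norml => Tx.
rewrite leNgt; apply/negP => xL.
have x1 : 1 <= `|x|.
  apply: ltW; apply: le_lt_trans xL; rewrite lerDl divr_ge0 // addr_ge0 //.
have x0 : 0 <= `|x| ^+ n by rewrite exprn_ge0.
have cx : s + 1 < `|c| * `|x|.
  rewrite mulrC -ltr_pdivrMr //; apply: le_lt_trans xL.
  by rewrite lerDr.
have Te : T.[x] = \sum_(i < n.+1) T`_i * x ^+ i + c * x ^+ n.+1.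
  by rewrite horner_coef sn big_ord_recr /= /c lead_coefE sn.
have h1 : `|\sum_(i < n.+1) T`_i * x ^+ i| <= s * `|x| ^+ n.
  apply: le_trans (ler_norm_sum _ _ _) _; rewrite mulr_suml; apply: ler_sum => i _.
  by rewrite normrM normrX ler_wpM2l // ler_weXn2l // -ltnS.
have h2 : `|c * x ^+ n.+1| <= `|T.[x]| + s * `|x| ^+ n.
  have -> : c * x ^+ n.+1 = T.[x] - \sum_(i < n.+1) T`_i * x ^+ i by rewrite Te addrC addKr.
  by apply: le_trans (ler_normB _ _) _; rewrite lerD2l.
move: h2; rewrite normrM normrX exprS mulrA => h2.
have xn1 : 1 <= `|x| ^+ n by rewrite exprn_ege1.
have : (s + 1) * `|x| ^+ n < `|c| * `|x| * `|x| ^+ n.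
  by rewrite ltr_pM2r // (lt_le_trans _ xn1).
by nra.
Qed.

(* The last point of the sublevel set of v in [a, b]: when p a <= -1 and
   1 <= p b it is a root of p - v, and it is monotone, hence measurable, in v. *)
Definition band_root (a b : R) (p : {poly R}) (v : R) : R :=
  sup [set x | a <= x <= b /\ (x = a \/ p.[x] <= v)].

Section Band.
Variables (a b : R) (p : {poly R}).
Hypothesis ab : a <= b.

Let A v := [set x | a <= x <= b /\ (x = a \/ p.[x] <= v)].

Let Aa v : A v a. Proof. by split; [rewrite lexx | left]. Qed.

Let hasA v : has_sup (A v).
Proof.
by split; [exists a; exact: Aa | exists b => x [/andP[_ xb] _]].
Qed.

(** The alternative [x = a] keeps the set nonempty for every level, so monotonicity, and with it
    measurability, holds on the whole line. *)
Lemma band_root_nondecreasing : {homo band_root a b p : v w / v <= w}.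
Proof.
move=> v w vw; apply: sup_le_ub; first by exists a; exact: Aa.
move=> x [xab hx]; apply: sup_upper_bound; first exact: hasA.
by split => //; case: hx => [->|h]; [left|right; exact: le_trans vw].
Qed.

Lemma band_rootP v : p.[a] <= -1 -> 1 <= p.[b] -> -1 < v < 1 ->
  [/\ a < band_root a b p v, band_root a b p v < b & p.[band_root a b p v] = v].
Proof.
move=> pa pb /andP[v0 v1]; set m := band_root a b p v.
have am : a <= m by apply: sup_upper_bound; [exact: hasA|exact: Aa].
have mb : m <= b by apply: sup_le_ub; [exists a; exact: Aa|move=> x [/andP[_ xb] _]].
have cp := @continuous_horner R p m.
have pm : p.[m] = v.
  apply/eqP; rewrite eq_le; apply/andP; split; rewrite leNgt; apply/negP => h.
    have h0 : 0 < p.[m] - v by rewrite subr_gt0.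
    move/cvgrPdist_lt : cp => /(_ _ h0) [d /= d0 hd].
    have [x [xab Ax] mx] := sup_adherent d0 (hasA v).
    have {}mx : m - d < x by [].
    have xm : x <= m by apply: sup_upper_bound; [exact: hasA|].
    have /hd : ball m d x by rewrite /ball /= ger0_norm ?subr_ge0 //; move: mx; rewrite -/m; lra.
    have px : p.[x] <= v by case: Ax => // ->; lra.
    by rewrite ger0_norm; lra.
  have h0 : 0 < v - p.[m] by rewrite subr_gt0.
  move/cvgrPdist_lt : cp => /(_ _ h0) [d /= d0 hd].
  have mb' : m < b by rewrite lt_neqAle mb andbT; apply/eqP => mbe; move: h; rewrite mbe; lra.
  pose x := Num.min b (m + d / 2).
  have xm : m < x by rewrite lt_min mb' ltrDl divr_gt0.
  have xb : x <= b by rewrite ge_min lexx.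
  have xd : x <= m + d / 2 by rewrite ge_min lexx orbT.
  have /hd : ball m d x by rewrite /ball /= distrC ger0_norm; lra.
  rewrite ltr_norml => /andP[h1 h2].
  have : x <= m.
    apply: sup_upper_bound; first exact: hasA.
    by split; [rewrite xb andbT; lra | right; lra].
  by lra.
split => //.
  by rewrite lt_neqAle am andbT; apply/eqP => e; move: pm; rewrite -e; lra.
by rewrite lt_neqAle mb andbT; apply/eqP => e; move: pm; rewrite e; lra.
Qed.

End Band.

(** The points [e i] separate the zeros, and T takes there values of alternating sign and modulus at
    least 1. So T crosses the whole band in each of the N gaps, and these crossings exhaust the
    degree of T - w. *)
Lemma root_fibres (T : {poly R}) N (x e : nat -> R) : (0 < N)%N -> size T = N.+1 ->
  T = lead_coef T *: \prod_(i < N) ('X - (x i)%:P) ->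
  (forall i, (i < N)%N -> e i < x i < e i.+1) ->
  (forall i, (i <= N)%N -> 1 <= `|T.[e i]|) ->
  exists g : nat -> R -> R,
    [/\ forall i, measurable_fun setT (g i : RT -> RT),
        forall w : R, -1 < w < 1 ->
          T - w%:P = lead_coef T *: \prod_(i < N) ('X - (g i w)%:P) &
        forall w : R, -1 < w < 1 -> injective (fun i : 'I_N => g i w)].
Proof.
move=> N0 sT Tx ex eT; set c := lead_coef T in Tx *.
have c0 : c != 0 by rewrite lead_coef_eq0 -size_poly_gt0 sT.
have emono i k : (i <= k <= N)%N -> e i <= e k.
  elim: k => [|k IH]; first by rewrite leqn0 => /andP[/eqP->].
  case/andP; rewrite leq_eqVlt => /orP[/eqP->//|ik kN].
  have /andP[h1 h2] := ex k kN.
  have /IH h : (i <= k <= N)%N by rewrite -ltnS ik ltnW.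
  by rewrite (le_trans h) // ltW // (lt_trans h1).
have alt i : (i < N)%N -> T.[e i] * T.[e i.+1] < 0.
  move=> iN; rewrite Tx !hornerZ !horner_prod mulrACA -expr2 -big_split /=.
  rewrite pmulr_rlt0 ?exprn_even_gt0 // (bigD1 (Ordinal iN)) //= !hornerXsubC.
  have /andP[h1 h2] := ex i iN.
  rewrite pmulr_llt0; first by rewrite nmulr_rlt0 ?subr_lt0 // subr_gt0.
  apply: prodr_gt0 => j ji; rewrite !hornerXsubC.
  have /andP[j1 j2] := ex j (ltn_ord j).
  have : (j != i :> nat) by move: ji; rewrite -val_eqE.
  rewrite neq_ltn => /orP[lt|lt].
    have /emono h : (j.+1 <= i <= N)%N by rewrite lt ltnW.
    by rewrite mulr_gt0 // subr_gt0; lra.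
  have /emono h : (i.+1 <= j <= N)%N by rewrite lt ltnW.
  by rewrite nmulr_rgt0 subr_lt0; lra.
(* The sign makes [s i *: T] go from at most -1 to at least 1 across the gap. The maximum in [g]
   keeps its interval nonempty for i >= N too, where [g i] must still be measurable. *)
pose s i : R := Num.sg T.[e i.+1].
pose g i w := band_root (e i) (Num.max (e i) (e i.+1)) (s i *: T) (s i * w).
have gP i w : (i < N)%N -> -1 < w < 1 ->
    [/\ e i < g i w, g i w < e i.+1 & T.[g i w] = w].
  move=> iN hw; have := alt i iN; have := eT i (ltnW iN); have := eT _ iN.
  have /andP[h1 h2] := ex i iN.
  have ee : e i <= e i.+1 by rewrite ltW // (lt_trans h1).
  move=> b1 b2 ab; rewrite /g (max_r ee).
  have [sp|sn|sz] := ltrgt0P T.[e i.+1]; last by move: ab; rewrite sz mulr0 ltxx.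
  - rewrite /s gtr0_sg // scale1r mul1r.
    have Ti : T.[e i] < 0 by move: ab; rewrite pmulr_llt0.
    apply: band_rootP => //; first by move: b2; rewrite ltr0_norm //; lra.
    by move: b1; rewrite gtr0_norm.
  - rewrite /s ltr0_sg // scaleN1r mulN1r.
    have Ti : 0 < T.[e i] by move: ab; rewrite nmulr_llt0.
    have [] := @band_rootP (e i) (e i.+1) (- T) ee (- w).
    + by rewrite hornerN; move: b2; rewrite gtr0_norm //; lra.
    + by rewrite hornerN; move: b1; rewrite ltr0_norm //; lra.
    + by move: hw => /andP[? ?]; apply/andP; lra.
    by move=> ? ? ; rewrite hornerN => /oppr_inj.
have ginj w : -1 < w < 1 -> injective (fun i : 'I_N => g i w).
  move=> hw i j /= gij.
  wlog ij : i j gij / (i <= j)%N => [H|].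
    by case: (leqP i j) => [|/ltnW] ij; [exact: H|symmetry; exact: H].
  apply/val_inj/eqP; rewrite eqn_leq ij /= leqNgt; apply/negP => lt.
  have /emono h : (i.+1 <= j <= N)%N by rewrite lt ltnW.
  have [_ g1 _] := gP i w (ltn_ord i) hw; have [g2 _ _] := gP j w (ltn_ord j) hw.
  by move: g1 g2; rewrite gij; lra.
exists g; split => //.
- move=> i; have mh : measurable_fun setT (fun w : RT => s i * w : RT).
    by apply: measurable_funM; [exact: measurable_cst|exact: measurable_id].
  apply: measurableT_comp mh.
  apply: nondecreasing_measurable => // v w vw.
  by apply: band_root_nondecreasing; rewrite // le_max lexx.
- move=> w hw; pose rs := [seq g i w | i : 'I_N <- index_enum 'I_N].
  have sTw : size (T - w%:P) = N.+1.
    by rewrite size_polyDl // size_polyN sT ltnS (leq_trans (size_polyC_leq1 _)).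
  have lTw : lead_coef (T - w%:P) = c.
    by rewrite lead_coefDl // size_polyN sT ltnS (leq_trans (size_polyC_leq1 _)).
  rewrite -lTw -(big_map (fun i : 'I_N => g i w) xpredT (fun z => 'X - z%:P)).
  apply: all_roots_prod_XsubC.
  + by rewrite size_map sTw /index_enum -enumT size_enum_ord.
  + apply/allP => z /mapP[i _ ->]; have [_ _ h] := gP i w (ltn_ord i) hw.
    by rewrite /root hornerD hornerN hornerC h subrr.
  + rewrite uniq_rootsE map_inj_uniq ?index_enum_uniq //; exact: ginj.
Qed.

Lemma admissible_roots N (T : {poly R}) : admissible N T ->
  exists g : nat -> R -> R,
    [/\ forall i, measurable_fun setT (g i : RT -> RT),
        forall w : R, -1 < w < 1 ->
          T - w%:P = lead_coef T *: \prod_(i < N) ('X - (g i w)%:P) &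
        forall w : R, -1 < w < 1 -> injective (fun i : 'I_N => g i w)].
Proof.
move=> [N2 sT [xs [xs_sorted xs_mup]] [ys [ys_sorted ys_root ys_ge1]]].
have T0 : T != 0 by rewrite -size_poly_gt0 sT.
have N0 : (0 < N)%N by apply: ltnW.
pose x i := nth 0 xs i.
have xlt i j : (i < j < N)%N -> x i < x j.
  move=> /andP[ij jN]; rewrite /x lt_sorted_ltn_nth // inE size_tuple //.
  exact: ltn_trans jN.
have xroot i : (i < N)%N -> T.[x i] = 0.
  move=> iN; have /xs_mup h : x i \in xs by rewrite mem_nth // size_tuple.
  by apply/rootP; rewrite -dvdp_XsubCl XsubC_dvd // h.
have Tx : T = lead_coef T *: \prod_(i < N) ('X - (x i)%:P).
  rewrite [LHS](@all_roots_prod_XsubC _ T xs).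
  - by rewrite big_tuple; congr (_ *: _); apply: eq_bigr => i _; rewrite /x (tnth_nth 0).
  - by rewrite size_tuple.
  - by apply/allP => z /xs_mup h; rewrite -dvdp_XsubCl XsubC_dvd // h.
  - by rewrite uniq_rootsE lt_sorted_uniq.
have hz i : exists z, (i.+1 < N)%N -> [/\ x i < z, z < x i.+1 & root T^`() z].
  case: (ltnP i.+1 N) => iN; last by exists 0.
  have h1 : x i < x i.+1 by apply: xlt; rewrite ltnSn.
  have [|z] := polyrcf.rolle h1 (p := T); first by rewrite !xroot // ltnW.
  by rewrite in_itv /= => /andP[? ?] /rootP ?; exists z.
have [z zP] := choice hz.
(* T' has at most N - 1 roots and the [ys] already account for them, so the Rolle point [z i] is one
   of the [ys]. *)
have zge1 i : (i.+1 < N)%N -> 1 <= `|T.[z i]|.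
  move=> iN; apply: ys_ge1; have [_ _ rz] := zP i iN.
  apply: contraT => zys.
  have dT0 : T^`() != 0.
    apply/eqP => /(congr1 (fun p : {poly R} => p`_N.-1)) /eqP.
    rewrite coef_deriv coef0 prednK // mulrn_eq0 (gtn_eqF N0) /=.
    by rewrite -[N]/(N.+1.-1) -sT -lead_coefE lead_coef_eq0 (negPf T0).
  have h : all (root T^`()) (z i :: ys) by rewrite /= rz; apply/allP.
  have u : uniq (z i :: ys) by rewrite /= zys lt_sorted_uniq.
  have := max_poly_roots dT0 h u; rewrite /= size_tuple prednK // => h1.
  by have := lt_size_deriv T0; rewrite sT ltnS leqNgt h1.
have sT1 : (1 < size T)%N by rewrite sT ltnS.
have [L L1 KL] := poly_preimage_bounded sT1.
(* The inner separators are the critical points; the outer two, -(L + 1) and L + 1, lie outside the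
   preimage, where |T| > 1. *)
pose e i := if i is j.+1 then (if i == N then L + 1 else z j) else - (L + 1).
have xL i : (i < N)%N -> - (L + 1) < x i < L + 1.
  move=> iN; have : `|x i| <= L.
    by apply: KL; rewrite /poly_preimage /= xroot // in_itv /= lerN10 ler01.
  by rewrite ler_norml => /andP[? ?]; apply/andP; lra.
have big1 (u : R) : `|u| = L + 1 -> 1 <= `|T.[u]|.
  move=> uL; rewrite leNgt; apply/negP => h; have : `|u| <= L.
    by apply: KL; rewrite /poly_preimage /= in_itv /= -ler_norml ltW.
  by rewrite uL; lra.
apply: (@root_fibres T N x e) => //.
- move=> i iN; apply/andP; split.
    case: i iN => [|i] iN; first by have /andP[] := xL 0%N iN.
    by rewrite /= ltn_eqF //; have [] := zP i iN.
  rewrite /=; case: eqP => [iE|/eqP iE]; first by have /andP[] := xL i iN.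
  have iN' : (i.+1 < N)%N by rewrite ltn_neqAle iE.
  by have [] := zP i iN'.
- move=> [|i] iN /=.
    by apply: big1; rewrite normrN gtr0_norm //; lra.
  case: eqP => [iE|/eqP iE]; first by apply: big1; rewrite gtr0_norm //; lra.
  by apply: zge1; rewrite ltn_neqAle iE.
Qed.

End Roots.

(** * Periodic limits of recurrence coefficients *)

Section PeriodicSequences.
Variable R : realType.

(* The weights 1, -1/J, ..., -1/J sum to zero, so that against a Gram matrix close
   to (1/2)(I + ones) only half of the sum of squares, (1 + 1/J)/2, survives. *)
Definition osc_weight (J i : nat) : R := if i == 0%N then 1 else - J%:R^-1.

Lemma sum_osc_weight J : (0 < J)%N -> \sum_(i < J.+1) osc_weight J i = 0.
Proof.
move=> J0; rewrite big_ord_recl /=.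
under eq_bigr do rewrite /osc_weight /=.
rewrite sumr_const card_ord /osc_weight /= mulNrn -[_^-1 *+ _]mulr_natr mulVf ?subrr //.
by rewrite pnatr_eq0 -lt0n.
Qed.

Lemma sum_sqr_osc_weight J : (0 < J)%N ->
  \sum_(i < J.+1) osc_weight J i ^+ 2 = 1 + J%:R^-1.
Proof.
move=> J0; rewrite big_ord_recl /=.
under eq_bigr do rewrite /osc_weight /= sqrrN.
rewrite sumr_const card_ord /osc_weight /= expr1n -[_ ^+ 2 *+ _]mulr_natr expr2 -mulrA mulVf ?mulr1 //.
by rewrite pnatr_eq0 -lt0n.
Qed.

Lemma cvg_sum_ord n (f : nat -> R^nat) (l : nat -> R) :
  (forall i, (i < n)%N -> f i @ \oo --> l i) ->
  (fun m => \sum_(i < n) f i m) @ \oo --> \sum_(i < n) l i.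
Proof.
elim: n => [|n IH] h.
  by under eq_fun do rewrite big_ord0; rewrite big_ord0; exact: cvg_cst.
under eq_fun do rewrite big_ord_recr /=; rewrite big_ord_recr /=.
by apply: cvgD; [apply: IH => i ni; apply: h; exact: ltnW | exact: h].
Qed.

Lemma cvg_prod_ord n (f : nat -> R^nat) (l : nat -> R) :
  (forall i, (i < n)%N -> f i @ \oo --> l i) ->
  (fun m => \prod_(i < n) f i m) @ \oo --> \prod_(i < n) l i.
Proof.
elim: n => [|n IH] h.
  by under eq_fun do rewrite big_ord0; rewrite big_ord0; exact: cvg_cst.
under eq_fun do rewrite big_ord_recr /=; rewrite big_ord_recr /=.
by apply: cvgM; [apply: IH => i ni; apply: h; exact: ltnW | exact: h].
Qed.

Lemma cvg_comp_addn (f : R^nat) k (l : R) :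
  f @ \oo --> l -> (fun m => f (m + k)%N) @ \oo --> l.
Proof. by rewrite -(cvg_shiftn k f). Qed.

Lemma powers_ge_half (z : R) : 0 <= z -> (forall k, 2^-1 <= z ^+ k) -> 1 <= z.
Proof.
move=> z0 h; rewrite leNgt; apply/negP => z1.
have nz : `|z| < 1 by rewrite ger0_norm.
have /cvgrPdist_lt /(_ 2^-1) [|k _ /(_ k (leqnn k))] := cvg_expr nz.
  by rewrite invr_gt0.
by rewrite sub0r normrN ger0_norm ?exprn_ge0 // ltNge h.
Qed.

Variables (N : nat) (kap : R) (a a' : R^nat).
Hypotheses (N0 : (0 < N)%N) (kap0 : 0 < kap)
  (apos : forall n, (1 <= n)%N -> 0 < a n)
  (per : forall k, (1 <= k)%N -> a' (k + N)%N = a' k)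
  (lim : (fun n => a n - a' n) @ \oo --> (0 : R)).

Definition widom n : R := (\prod_(1 <= i < n.+1) a i) / kap ^+ n.

Lemma widomE n : widom n = (\prod_(i < n) a i.+1) / kap ^+ n.
Proof. by rewrite /widom big_add1 big_mkord. Qed.

Lemma widom_gt0 n : 0 < widom n.
Proof. by rewrite widomE divr_gt0 ?exprn_gt0 // prodr_gt0 // => i _; exact: apos. Qed.

Lemma widomD n k : widom (n + k) = widom n * ((\prod_(i < k) a (n + i.+1)%N) / kap ^+ k).
Proof.
elim: k => [|k IH]; first by rewrite addn0 big_ord0 expr0 divr1 mulr1.
have kn j : kap ^+ j != 0 by rewrite expf_neq0 // gt_eqF.
have WS m : widom m.+1 = widom m * (a m.+1 / kap).
  rewrite !widomE big_ord_recr /= exprS; field.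
  by rewrite kn gt_eqF.
rewrite addnS WS IH big_ord_recr /= exprS addnS; field.
by rewrite kn gt_eqF.
Qed.

Lemma period_shift m i : (1 <= i)%N -> a' (m * N + i)%N = a' i.
Proof.
move=> i1; elim: m => [|m IH]; first by rewrite mul0n.
by rewrite mulSn -addnA addnC per ?IH // addn_gt0 i1 orbT.
Qed.

Lemma cvg_coeff i : (1 <= i)%N -> (fun m => a (m * N + i)%N) @ \oo --> a' i.
Proof.
move=> i1; apply/cvgrPdist_lt => eps eps0.
move/cvgrPdist_lt : lim => /(_ _ eps0) [n0 _ h].
exists n0 => // m /= mn; have /= := h (m * N + i)%N.
rewrite sub0r opprB period_shift //; apply.
apply: leq_trans mn _; apply: leq_trans (leq_pmulr m N0) _; exact: leq_addr.
Qed.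

Lemma cvg_widom_ratio r k :
  (fun m => widom (m * N + (r + k)) / widom (m * N + r)) @ \oo -->
  (\prod_(i < k) a' (r + i.+1)%N) / kap ^+ k.
Proof.
under eq_fun do rewrite addnA widomD mulrAC mulfV ?gt_eqF ?widom_gt0 // mul1r.
apply: cvgMl; apply: (@cvg_prod_ord k (fun i m => a (m * N + r + i.+1)%N)
  (fun i => a' (r + i.+1)%N)) => i _.
under eq_fun do rewrite -addnA.
by apply: cvg_coeff; rewrite addnS.
Qed.

Lemma period_prod r : \prod_(i < N) a' (r + i.+1)%N = \prod_(i < N) a' i.+1.
Proof.
elim: r => [|r IH]; first by [].
rewrite -IH; case: N N0 per => // n _ pr.
rewrite big_ord_recr [RHS]big_ord_recl /= mulrC; congr (_ * _).
  by rewrite pr ?addn1.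
by apply: eq_bigr => i _; rewrite /bump leq0n; congr (a' _); lia.
Qed.

Hypotheses (widom_ge1 : forall n, 1 <= widom n)
  (widom_le_sqrt2 : forall l, (1 <= l)%N -> widom (l * N) <= Num.sqrt 2).

Lemma sqrt2_le2 : Num.sqrt 2 <= 2 :> R.
Proof.
rewrite -(ler_pXn2r (_ : 0 < 2)%N) ?nnegrE ?sqrtr_ge0 //.
by rewrite sqr_sqrtr //; lra.
Qed.

(** The quotient is the limit of W_((m+1)N) / W_(mN). As these factors lie between 1 and sqrt 2, all
    its powers stay in [1/2, 2], which forces the value 1. *)
Lemma period_prod_kap : (\prod_(i < N) a' i.+1) / kap ^+ N = 1.
Proof.
set Q := _ / _.
have step r : (fun m => widom (m.+1 * N + r) / widom (m * N + r)) @ \oo --> Q.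
  have := @cvg_widom_ratio r N; rewrite period_prod -/Q.
  by under eq_fun do rewrite [(r + N)%N]addnC addnA -mulSnr.
have stepk k : (fun m => widom ((m + k) * N) / widom (m * N)) @ \oo --> Q ^+ k.
  elim: k => [|k IH].
    under eq_fun do rewrite addn0 mulfV ?gt_eqF ?widom_gt0 //.
    by rewrite expr0; exact: cvg_cst.
  rewrite exprS.
  have sh : (fun m => widom ((m + k).+1 * N) / widom ((m + k) * N)) @ \oo --> Q.
    have := step 0%N; under eq_fun do rewrite !addn0.
    exact: (cvg_comp_addn (f := fun m => widom (m.+1 * N) / widom (m * N)) k).
  have -> : (fun m => widom ((m + k.+1) * N) / widom (m * N)) =
      (fun m => widom ((m + k).+1 * N) / widom ((m + k) * N) *
        (widom ((m + k) * N) / widom (m * N))).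
    by apply/funext => m; rewrite addnS mulrA divfK // gt_eqF // widom_gt0.
  exact: cvgM.
have bnd k : 2^-1 <= Q ^+ k <= 2.
  have h m : (1 <= m)%N -> 2^-1 <= widom ((m + k) * N) / widom (m * N) <= 2.
    move=> m1; have w0 := widom_gt0 (m * N).
    have mk1 : (1 <= m + k)%N by rewrite addn_gt0 m1.
    rewrite ler_pdivlMr // ler_pdivrMr //.
    have := widom_ge1 (m * N); have := widom_ge1 ((m + k) * N).
    have := widom_le_sqrt2 m1; have := widom_le_sqrt2 mk1; have := sqrt2_le2.
    by move=> *; apply/andP; lra.
  apply/andP; split.
    by apply: cvgr_to_ge (stepk k) _; exists 1%N => // m /= /h /andP[].
  by apply: cvgr_to_le (stepk k) _; exists 1%N => // m /= /h /andP[].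
have Q0 : 0 <= Q by have /andP[+ _] := bnd 1%N; rewrite expr1; apply: le_trans; rewrite invr_ge0.
have Q1 : 1 <= Q by apply: powers_ge_half => // k; have /andP[] := bnd k.
have Qp : 0 < Q := lt_le_trans ltr01 Q1.
apply/eqP; rewrite eq_le Q1 andbT -invf_ge1 //.
apply: powers_ge_half; first by rewrite invr_ge0.
move=> k; rewrite exprVn lef_pV2 ?posrE ?exprn_gt0 //.
by have /andP[] := bnd k.
Qed.

Lemma cvg_widom_shift r k l : (l <= k)%N ->
  (fun m => widom ((m + k) * N + r) / widom ((m + l) * N + r)) @ \oo --> (1 : R).
Proof.
have step : (fun m => widom (m.+1 * N + r) / widom (m * N + r)) @ \oo --> (1 : R).
  have := @cvg_widom_ratio r N; rewrite period_prod period_prod_kap.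
  by under eq_fun do rewrite [(r + N)%N]addnC addnA -mulSnr.
elim: k => [|k IH].
  rewrite leqn0 => /eqP->; under eq_fun do rewrite mulfV ?gt_eqF ?widom_gt0 //.
  exact: cvg_cst.
rewrite leq_eqVlt => /orP[/eqP->|].
  by under eq_fun do rewrite mulfV ?gt_eqF ?widom_gt0 //; exact: cvg_cst.
rewrite ltnS => /IH {}IH.
have sh : (fun m => widom ((m + k).+1 * N + r) / widom ((m + k) * N + r)) @ \oo --> (1 : R).
  exact: (cvg_comp_addn (f := fun m => widom (m.+1 * N + r) / widom (m * N + r)) k).
have -> : (fun m => widom ((m + k.+1) * N + r) / widom ((m + l) * N + r)) =
    (fun m => widom ((m + k).+1 * N + r) / widom ((m + k) * N + r) *
      (widom ((m + k) * N + r) / widom ((m + l) * N + r))).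
  by apply/funext => m; rewrite addnS mulrA divfK // gt_eqF // widom_gt0.
by rewrite -[X in _ --> X]mulr1; exact: cvgM.
Qed.

(** With n = (m + J)N + r, the normalized mixed term of P_(n-iN) and P_(n-jN); the minimum of i and
    j belongs to the larger degree. The 1/2 comes from the leading coefficient 2^(k-1) c^k of T_k(T)
    against Cap(K)^(kN) = (2|c|)^-k. *)
Definition widom_gram J r m (i j : nat) : R :=
  if i == j then 1 else
  2^-1 * (widom ((m + (J - minn i j)) * N + r) / widom ((m + (J - maxn i j)) * N + r)).

Hypothesis widom_gram_ge : forall J r m, (0 < J)%N ->
  1 <= widom ((m + J) * N + r) ^+ 2 *
    \sum_(i < J.+1) \sum_(j < J.+1)
      osc_weight J i * osc_weight J j * widom_gram J r m i j.

Lemma cvg_gram J r : (0 < J)%N ->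
  (fun m => \sum_(i < J.+1) \sum_(j < J.+1)
      osc_weight J i * osc_weight J j * widom_gram J r m i j) @ \oo
  --> ((1 + J%:R^-1) / 2 : R).
Proof.
move=> J0; have -> : (1 + J%:R^-1) / 2 = \sum_(i < J.+1) \sum_(j < J.+1)
    osc_weight J i * osc_weight J j * (if i == j :> nat then 1 else 2^-1).
  transitivity (\sum_(i < J.+1) (2^-1 * osc_weight J i ^+ 2 +
      2^-1 * (osc_weight J i * \sum_(j < J.+1) osc_weight J j))).
    rewrite sum_osc_weight // big_split /= -mulr_sumr sum_sqr_osc_weight //.
    rewrite [\sum_(i < _) _]big1 ?addr0 => [|i _]; last by rewrite !mulr0.
    by rewrite mulrC.
  apply: eq_bigr => i _; rewrite (bigD1 i) //= [RHS](bigD1 i) //= eqxx.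
  rewrite mulrDr mulrDr addrA; congr (_ + _); first by rewrite expr2; field.
  rewrite !mulr_sumr; apply: eq_bigr => j; rewrite eq_sym -val_eqE => /negPf /= ->.
  by rewrite mulrC.
apply: (cvg_sum_ord (f := fun i m => \sum_(j < J.+1)
    osc_weight J i * osc_weight J j * widom_gram J r m i j)
  (l := fun i => \sum_(j < J.+1) osc_weight J i * osc_weight J j *
    (if i == j then 1 else 2^-1))) => i iJ.
apply: (cvg_sum_ord (f := fun j m =>
    osc_weight J i * osc_weight J j * widom_gram J r m i j)
  (l := fun j => osc_weight J i * osc_weight J j *
    (if i == j then 1 else 2^-1))) => j jJ.
apply: cvgMr; rewrite /widom_gram; case: eqP => _; first exact: cvg_cst.
rewrite -[X in _ --> X]mulr1; apply: cvgMr; apply: cvg_widom_shift.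
by rewrite leq_sub2l // (leq_trans (geq_minl _ _)) // leq_maxl.
Qed.

Lemma widom_eventually_ge r (y : R) : 0 < y -> y ^+ 2 < 2 ->
  \forall m \near \oo, y <= widom (m * N + r).
Proof.
move=> y0 y2; have y20 : 0 < y ^+ 2 by rewrite exprn_gt0.
have d0 : 0 < 2 / y ^+ 2 - 1 by rewrite subr_gt0 ltr_pdivlMr // mul1r.
(* Such a [J] puts the limit (1 + 1/J)/2 of the quadratic form below 1/y^2. *)
have [J J0 hJ] : exists2 J, (0 < J)%N & J%:R^-1 < 2 / y ^+ 2 - 1.
  move/cvgrPdist_lt : (@cvg_harmonic R) => /(_ _ d0) [n _ /(_ n (leqnn n))].
  rewrite sub0r normrN => h; exists n.+1 => //.
  by apply: le_lt_trans h; exact: ler_norm.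
have lt : (1 + J%:R^-1) / 2 < (y ^+ 2)^-1 by rewrite ltr_pdivrMr //; lra.
have [n0 _ h] := cvgr_lt _ (cvg_gram r J0) _ lt.
exists (n0 + J)%N => // m /= mJ.
have mE : m = (m - J + J)%N by lia.
have /h hX : (n0 <= m - J)%N by lia.
have H := widom_gram_ge r (m - J) J0; rewrite -mE in H.
have w0 := widom_gt0 (m * N + r).
rewrite -(ler_pXn2r (_ : 0 < 2)%N) ?nnegrE ?(ltW y0) ?(ltW w0) //.
have w2 : 0 < widom (m * N + r) ^+ 2 by rewrite exprn_gt0.
have := lt_le_trans (le_lt_trans H (_ : _ < widom (m * N + r) ^+ 2 / y ^+ 2)) (lexx _).
rewrite ltr_pM2l // => /(_ hX); rewrite ltr_pdivlMr // mul1r; exact: ltW.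
Qed.

(** The ratio is the limit of W_(mN+l) / W_(mN). For m >= 1 the denominator is at most sqrt 2, while
    the numerator eventually exceeds z sqrt 2 for each positive z < 1. *)
Lemma coeff_ratio_ge1 l : 1 <= (\prod_(i < l) a' i.+1) / kap ^+ l.
Proof.
have c := @cvg_widom_ratio 0%N l; move: c => /=.
under eq_fun do rewrite add0n addn0.
under eq_bigr do rewrite add0n.
set C := _ / _ => c; rewrite leNgt; apply/negP => C1.
have s0 : 0 < Num.sqrt 2 :> R by rewrite sqrtr_gt0.
have C0 : 0 <= C.
  apply: cvgr_to_ge c _; apply: nearW => m.
  by rewrite divr_ge0 // ltW // widom_gt0.
pose z := (C + 1) / 2.
have zC : C < z by rewrite /z; lra.
have z0 : 0 < z by rewrite /z; lra.
have z1 : z < 1 by rewrite /z; lra.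
have y0 : 0 < z * Num.sqrt 2 by rewrite mulr_gt0.
have y2 : (z * Num.sqrt 2) ^+ 2 < 2.
  by rewrite exprMn sqr_sqrtr //; have : z ^+ 2 < 1 by [nra]; lra.
have [m [h1 [h2 h3]]] := filter_ex (filterI (cvgr_lt _ c _ zC)
  (filterI (widom_eventually_ge l y0 y2) (nbhs_infty_ge 1%N))).
move: h1; rewrite ltr_pdivrMr ?widom_gt0 // ltNge => /negP; apply.
apply: le_trans h2; rewrite ler_pM2l //; exact: widom_le_sqrt2.
Qed.

Lemma limn_einf_widom : limn_einf (fun n => (widom n)%:E) = (Num.sqrt 2)%:E.
Proof.
have s0 : 0 < Num.sqrt 2 :> R by rewrite sqrtr_gt0.
apply/eqP; rewrite eq_le; apply/andP; split.
  rewrite leNgt; apply/negP => /lt_limn_einf [n0 _ h].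
  have /h : (n0 <= n0.+1 * N)%N by rewrite (leq_trans (leqnSn n0)) // leq_pmulr.
  by rewrite lte_fin ltNge widom_le_sqrt2.
apply/lee_subgt0Pr => eps eps0.
have [le0|gt0] := leP (Num.sqrt 2 - eps) 0.
  apply: (@le_trans _ _ 0%E); first by rewrite -EFinB lee_fin.
  by apply: limn_einf_ge; apply: nearW => n; rewrite lee_fin ltW // widom_gt0.
have y2 : (Num.sqrt 2 - eps) ^+ 2 < 2.
  rewrite -[ltRHS](@sqr_sqrtr R 2) //; rewrite ltrXn2r ?nnegrE ?ltW //.
  by rewrite ltrBlDr ltrDl.
(* The bound is known along each residue class modulo N; finitely many classes make it uniform. *)
have hr (r : 'I_N) := widom_eventually_ge r gt0 y2.
have : \forall m \near \oo, forall r : 'I_N, Num.sqrt 2 - eps <= widom (m * N + r).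
  exact: filter_forall.
move=> [m0 _ h]; apply: limn_einf_ge; exists (m0 * N)%N => // n /= mn.
rewrite -EFinB lee_fin (divn_eq n N).
have nN : (n %% N < N)%N by rewrite ltn_mod.
by apply: (h (n %/ N)%N _ (Ordinal nN)); rewrite /= leq_divRL.
Qed.

End PeriodicSequences.

(** * Widom factors *)

Section Support.
Variable R : realType.
Local Notation RT := (measurableTypeR R).
Variable nu : probability RT R.

Definition rational_itv (k : nat) : set RT :=
  oapp (fun pq : rat * rat => `](ratr pq.1 : R), ratr pq.2[%classic) set0 (unpickle k).

Definition null_rational_itv (k : nat) : set RT :=
  if nu (rational_itv k) == 0%E then rational_itv k else set0.

Lemma rational_itv_pickle pq :
  rational_itv (pickle pq) = `](ratr pq.1 : R), ratr pq.2[%classic.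
Proof. by rewrite /rational_itv pickleK. Qed.

Lemma open_rational_itv k : open (rational_itv k : set R).
Proof.
by rewrite /rational_itv; case: unpickle => [pq|]; [exact: itv_open | exact: open0].
Qed.

Lemma measurable_null_rational_itv k : measurable (null_rational_itv k).
Proof.
rewrite /null_rational_itv; case: ifP => _; last exact: measurable0.
rewrite /rational_itv.
by case: unpickle => [pq|]; [exact: measurable_itv | exact: measurable0].
Qed.

Lemma measure_null_rational_itv k : nu (null_rational_itv k) = 0%E.
Proof. by rewrite /null_rational_itv; case: ifP => [/eqP//|_]; exact: measure0. Qed.

(** Countability of the rational intervals makes the complement of the support measurable and
    null. *)
Lemma setC_msupport : ~` msupport nu = \bigcup_k null_rational_itv k.
Proof.
apply/seteqP; split => [x|x [k _]].
  move=> /existsNP [U /not_implyP [oU /not_implyP [Ux nU]]].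
  have U0 : nu U = 0%E.
    by apply/eqP; rewrite eq_le measure_ge0 andbT leNgt; apply/negP.
  have [e e0 eU] : exists2 e : R, 0 < e & ball x e `<=` U.
    have /nbhs_ballP [e e0 eU] : nbhs x U by apply: open_nbhs_nbhs.
    by exists e.
  have [p /andP[p1 p2]] : exists p : rat, x - e < ratr p < x.
    have h : x - e < x by rewrite ltrBlDr ltrDl.
    by have [p] := rat_in_itvoo h; rewrite in_itv /=; exists p.
  have [q /andP[q1 q2]] : exists q : rat, x < ratr q < x + e.
    have h : x < x + e by rewrite ltrDl.
    by have [q] := rat_in_itvoo h; rewrite in_itv /=; exists q.
  have sub : `](ratr p : R), ratr q[%classic `<=` U.
    move=> y /=; rewrite in_itv /= => /andP[y1 y2]; apply: eU.
    by rewrite /ball /= ltr_norml; apply/andP; lra.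
  have n0 : nu `](ratr p : R), ratr q[%classic = 0%E.
    apply/eqP; rewrite eq_le measure_ge0 andbT -U0 le_measure ?inE //.
    exact: open_measurable.
  have x_in : `](ratr p : R), ratr q[%classic x by rewrite /= in_itv /= p2 q1.
  exists (pickle (p, q)); first by [].
  rewrite /null_rational_itv (rational_itv_pickle (p, q)); move: n0 x_in.
  by rewrite [(p, q).1]/fst [(p, q).2]/snd; move: `]_, _[%classic => I -> Ix; rewrite eqxx.
rewrite /null_rational_itv; case: ifP => [/eqP n0|] // xI h.
by have := h _ (@open_rational_itv k) xI; rewrite n0 ltxx.
Qed.

Lemma measurable_msupport : measurable (msupport nu : set RT).
Proof.
rewrite -[X in measurable X]setCK setC_msupport; apply: measurableC.
by apply: bigcup_measurable => k _; exact: measurable_null_rational_itv.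
Qed.

Lemma probability_msupport : nu (msupport nu) = 1%E.
Proof.
have h : nu (~` msupport nu) = 0%E.
  rewrite setC_msupport; apply/negligibleP.
    by apply: bigcup_measurable => k _; exact: measurable_null_rational_itv.
  apply: negligible_bigcup => k; apply/negligibleP.
    exact: measurable_null_rational_itv.
  exact: measure_null_rational_itv.
rewrite -[X in nu X]setCK probability_setC ?h ?sube0 //.
exact: measurableC measurable_msupport.
Qed.

Lemma msupport_subset (K : set RT) : closed (K : set R) -> nu K = 1%E -> msupport nu `<=` K.
Proof.
move=> cK nK x xs; apply: contrapT => xK.
have mK : measurable K by exact: closed_measurable.
have := xs _ (closed_openC cK) xK.
by rewrite probability_setC // nK subee // ltxx.
Qed.

End Support.

(** * Norms of orthogonal polynomials for the equilibrium measure *)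

Section Assembly.
Variables (R : realType) (N : nat) (T : {poly R}) (g : nat -> R -> R) (L : R).
Local Notation RT := (measurableTypeR R).
Variables (ac nu : probability RT R).
Hypotheses (N0 : (0 < N)%N) (sT : size T = N.+1)
  (mg : forall i, measurable_fun setT (g i : RT -> RT))
  (splitT : forall w : R, -1 < w < 1 ->
     T - w%:P = lead_coef T *: \prod_(i < N) ('X - (g i w)%:P))
  (ginj : forall w : R, -1 < w < 1 -> injective (fun i : 'I_N => g i w))
  (L1 : 1 <= L) (KL : forall x, poly_preimage T x -> `|x| <= L)
  (ac1 : ac `]-1, 1[%classic = 1%E)
  (acT : forall k, (0 < k)%N -> Ex ac (cheb R k) = 0)
  (hnu : is_equilibrium_measure (poly_preimage T) nu).

Local Notation K := (poly_preimage T).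
Local Notation c := (lead_coef T).
Local Notation E := (Ex nu).

Let T0 : T != 0. Proof. by rewrite -size_poly_gt0 sT. Qed.
Let c0 : c != 0. Proof. by rewrite lead_coef_eq0. Qed.
Let cp : 0 < 2 * `|c|. Proof. by rewrite mulr_gt0 // normr_gt0. Qed.
Let mK := measurable_poly_preimage T.
Let nuK : nu K = 1%E. Proof. by case: hnu. Qed.

Let ED p q : E (p + q) = E p + E q. Proof. exact: ExD mK nuK KL p q. Qed.
Let EZ a p : E (a *: p) = a * E p. Proof. exact: ExZ mK nuK KL a p. Qed.

Definition kap : R := expR (- robin T N).

Lemma kap_gt0 : 0 < kap. Proof. exact: expR_gt0. Qed.

Lemma kap_pow : kap ^+ N = (2 * `|c|)^-1.
Proof.
rewrite /kap /robin -expRM_natl mulrN mulrA mulfV ?pnatr_eq0 -?lt0n // mul1r.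
by rewrite expRN lnK // posrE.
Qed.

Lemma Ex_via_fibre (p A : {poly R}) :
  (forall w, -1 < w < 1 -> \sum_(i < N) p.[g i w] = A.[w]) ->
  E p = N%:R^-1 * Ex ac A.
Proof. exact: (equilibrium_Ex ac1 acT N0 T0 mg splitT L1 KL hnu). Qed.

Lemma Ex_arcsine m (al : nat -> R) :
  Ex ac ((al 0%N)%:P + \sum_(1 <= j < m) al j *: cheb R j) = al 0%N.
Proof.
have m1 := @measurable_itvoo1 R; have b1 := @itvoo1_le1 R.
rewrite (ExD m1 ac1 b1) ExC (Ex_sum m1 ac1 b1) big_nat big1 ?addr0 //.
by move=> j /andP[j1 _]; rewrite (ExZ m1 ac1 b1) acT // mulr0.
Qed.

Lemma jensen_Ex (d J : nat) (q : nat -> {poly R}) :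
  q 0%N \is monic -> size (q 0%N) = d.+2 ->
  (forall i, (0 < i <= J)%N -> (size (q i) <= d.+1)%N) ->
  kap ^+ (2 * d.+1) <= E (cheb_gram T J q).
Proof.
move=> qm sq0 sqi; set f := cheb_gram T J q.
have [n Nn] : exists n, N = n.+1 by exists N.-1; rewrite prednK.
have sT' : size T = n.+2 by rewrite sT Nn.
have [A hA] : exists A : {poly R}, forall w, -1 < w < 1 ->
    \sum_(i < N) f.[g i w] = A.[w].
  have [A hA] := sum_fibre_poly f sT'; exists A => w hw.
  move: (splitT hw) (ginj hw); rewrite Nn => h1 h2.
  exact: (hA w (fun i : 'I_n.+1 => g i w)).
have [m [al eA]] := cheb_decomposition A.
have Ef : E f = al 0%N / N%:R.
  by rewrite (Ex_via_fibre hA) eA Ex_arcsine mulrC.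
have E0 : 0 <= E f.
  rewrite -(ExC nu 0) (le_Ex mK nuK KL) // => x; rewrite /poly_preimage /= in_itv /= => hx.
  by rewrite hornerC cheb_gram_ge0.
have := @jensen_mean R T N (fun i => g i) splitT d J m q al N0 T0 qm sq0 sqi.
rewrite -Ef => /(_ _) h.
have {}h : (2 * `|c|)^-1 ^+ (2 * d.+1) <= E f ^+ N.
  apply: h => w hw; rewrite hA // eA hornerD hornerC horner_sum; congr (_ + _).
  by apply: eq_bigr => j _; rewrite hornerZ.
by move: h; rewrite -kap_pow exprAC ler_pXn2r // nnegrE // exprn_ge0 // ltW // kap_gt0.
Qed.

Lemma cheb_gram0 (q : nat -> {poly R}) : cheb_gram T 0 q = q 0%N * q 0%N.
Proof.
by rewrite /cheb_gram !big_ord1 /= cheb0 -[1]/(1%:P) comp_polyC mulr1.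
Qed.

Lemma Ex_monic_ge n (Q : {poly R}) : Q \is monic -> size Q = n.+1 ->
  kap ^+ (2 * n) <= E (Q * Q).
Proof.
case: n => [|d] Qm Qs; last by rewrite -(cheb_gram0 (fun=> Q)); apply: jensen_Ex => // -[|i].
have -> : Q = 1.
  have [a e] := size_poly1P _ (introT eqP Qs).
  by move=> Qa; move: Qm; rewrite Qa monicE lead_coefC => /eqP ->.
by rewrite muln0 expr0 mulr1 -[1 in X in _ <= X]/(1%:P) ExC.
Qed.

(** Positivity comes from the lower bound on norms of monic polynomials, after division by the
    leading coefficient. *)
Let Epos (p : {poly R}) : p != 0 -> 0 < E (p * p).
Proof.
move=> p0; have l0 : lead_coef p != 0 by rewrite lead_coef_eq0.
pose q := (lead_coef p)^-1 *: p.
have pq : p = lead_coef p *: q by rewrite scalerA mulfV // scale1r.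
have qm : q \is monic by rewrite monicE lead_coefZ mulVf.
have sq : size q = (size p).-1.+1.
  by rewrite size_scale ?invr_eq0 // prednK // size_poly_gt0.
rewrite pq -scalerAl -scalerAr !EZ mulrA mulr_gt0 //.
  by rewrite -expr2 exprn_even_gt0.
by apply: lt_le_trans (Ex_monic_ge qm sq); rewrite exprn_gt0 // kap_gt0.
Qed.

Lemma L2normE (p : {poly R}) : L2norm nu p = (Num.sqrt (E (p * p)))%:E.
Proof.
rewrite /L2norm unlock.
have -> : (\int[nu]_x (`|(p.[x])%:E| `^ 2) = (E (p * p))%:E)%E.
  rewrite -(integral_poly mK nuK KL); apply: eq_integral => x _.
  rewrite abse_EFin poweR_EFin powR_mulrn // hornerM; congr EFin.
  by rewrite real_normK ?num_real // expr2.
rewrite poweR_EFin powR12_sqrt //; exact: functional_sqr_ge0 EZ Epos _.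
Qed.

Lemma orthopolyP n : orthogonal_monic E n (orthopoly nu n).
Proof.
have [P hP] := exists_orthogonal_monic ED EZ Epos n.
have [Pm Ps _] := hP.
have oP : is_orthopoly nu n P.
  split => // Q Qm Qs; rewrite !L2normE lee_fin ler_wsqrtr //.
  by rewrite (orthogonal_monic_min ED EZ hP Qm Qs) lerDl functional_sqr_ge0.
have [Qm Qs Qmin] : is_orthopoly nu n (orthopoly nu n).
  by apply: (xgetPex 0); exists P.
suff -> : orthopoly nu n = P by [].
apply: (orthogonal_monic_unique ED EZ Epos hP Qm Qs).
have := Qmin P Pm Ps; rewrite !L2normE lee_fin ler_sqrt //.
by rewrite (functional_sqr_ge0 EZ Epos).
Qed.

(** Stated for subsets so as to cover both the preimage and the support: [nu] competes on [S], and
    every competitor on [S] is one on the preimage. *)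
Lemma capacity_subset (S : set RT) : measurable S -> S `<=` K -> nu S = 1%E ->
  capacity (S : set R) = kap.
Proof.
move=> mS SK nS; rewrite /capacity.
suff -> : min_log_energy (S : set R) = (robin T N)%:E by [].
apply/eqP; rewrite eq_le; apply/andP; split.
  apply: ereal_inf_lbound; exists nu => //.
  exact: (equilibrium_energy ac1 acT N0 T0 mg splitT L1 KL hnu).
apply: le_ereal_inf_tmp => _ [mu muS <-].
apply: (le_robin_energy ac1 acT N0 T0 mg splitT L1 KL).
apply/eqP; rewrite eq_le probability_le1 //= -muS.
by rewrite le_measure ?inE.
Qed.

Lemma capacityK : capacity K = kap.
Proof. exact: capacity_subset. Qed.

Lemma closed_poly_preimage : closed (K : set R).
Proof.
rewrite (_ : K = horner T @^-1` `[-1, 1]%classic); last by [].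
apply: preimage_closed; last exact: interval_closed.
by move=> x _; exact: continuous_horner.
Qed.

Lemma capacity_msupport : capacity (msupport nu) = kap.
Proof.
apply: capacity_subset.
- exact: measurable_msupport.
- exact: msupport_subset closed_poly_preimage nuK.
- exact: probability_msupport.
Qed.

Section Recurrence.
Variable a : nat -> R.
Hypothesis ha : is_recurrence_coeffs nu a.
Local Notation P := (orthopoly nu).
Local Notation W := (widom kap a).

Lemma Ex_orthopoly n : E (P n * P n) = (\prod_(1 <= i < n.+1) a i) ^+ 2.
Proof.
have [_ [b hb]] := ha; elim: n => [|n IH].
  have [Pm Ps _] := orthopolyP 0.
  rewrite big_geq // expr1n; have /size_poly1P [x x0 Px] := introT eqP Ps.
  by move: Pm; rewrite Px monicE lead_coefC => /eqP ->; rewrite mulr1 ExC.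
rewrite big_nat_recr //= exprMn -IH [RHS]mulrC.
apply: (orthogonal_recurrence ED EZ (orthopolyP n) (orthopolyP n.+1) (orthopolyP n.+2)).
exact: (hb n.+1).
Qed.

Lemma prod_coeffs_gt0 n : 0 < \prod_(1 <= i < n.+1) a i.
Proof.
have [ap _] := ha; rewrite big_add1 big_mkord; apply: prodr_gt0 => i _; exact: ap.
Qed.

Lemma Ex_orthopoly_widom n : E (P n * P n) = (W n * kap ^+ n) ^+ 2.
Proof.
by rewrite Ex_orthopoly /widom divfK // expf_neq0 // gt_eqF // kap_gt0.
Qed.

Lemma widom_factorE n : widom_factor nu n = (W n)%:E.
Proof.
rewrite /widom_factor L2normE Ex_orthopoly sqrtr_sqr gtr0_norm ?prod_coeffs_gt0 //.
by rewrite capacity_msupport -EFinM.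
Qed.

Let W0 n : 0 < W n.
Proof. by rewrite /widom divr_gt0 ?exprn_gt0 ?kap_gt0 // prod_coeffs_gt0. Qed.

Lemma widom_ge1 n : 1 <= W n.
Proof.
have [Pm Ps _] := orthopolyP n.
have := Ex_monic_ge Pm Ps; rewrite Ex_orthopoly_widom mulnC exprM.
have k0 : 0 < kap ^+ n by rewrite exprn_gt0 // kap_gt0.
have wk0 : 0 <= W n * kap ^+ n by rewrite mulr_ge0 // ltW.
by rewrite ler_pXn2r ?nnegrE ?(ltW k0) ?wk0 // -[leLHS]mul1r ler_pM2r.
Qed.

Lemma size_lead_cheb_comp k : (0 < k)%N ->
  size (cheb R k \Po T) = (k * N).+1 /\ lead_coef (cheb R k \Po T) = 2 ^+ k.-1 * c ^+ k.
Proof.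
case: k => // k _; have two0 : 2 != 0 :> R by rewrite pnatr_eq0.
have [s l] := size_lead_cheb k two0.
have sT1 : (1 < size T)%N by rewrite sT ltnS.
have lc : lead_coef (cheb R k.+1 \Po T) = 2 ^+ k * c ^+ k.+1.
  by rewrite lead_coef_comp // l s.
split => //; have n0 : cheb R k.+1 \Po T != 0.
  by rewrite -lead_coef_eq0 lc mulf_neq0 // expf_neq0.
rewrite -(prednK (_ : 0 < size (cheb R k.+1 \Po T))%N) ?size_poly_gt0 //.
by rewrite size_comp_poly s sT.
Qed.

Lemma sqr_cheb l (w : R) : -1 < w < 1 ->
  (cheb R l).[w] ^+ 2 = 2^-1 + 2^-1 * (cheb R (l + l)).[w].
Proof.
move=> /andP[w1 w2]; have <- : cos (acos w) = w by rewrite acosK // in_itv /= !ltW.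
rewrite !cheb_cos natrD mulrDl cosD.
have := cos2Dsin2 (l%:R * acos w); rewrite !expr2; lra.
Qed.

(** T_l^2 = (1 + T_(2l))/2 has arcsine mean 1/2. Dividing by the squared leading coefficient,
    (2|c|)^(2l)/4, gives 2 Cap(K)^(2lN), the origin of sqrt 2. *)
Lemma Ex_sqr_cheb_comp l : (0 < l)%N ->
  E ((cheb R l \Po T) * (cheb R l \Po T)) = 2^-1.
Proof.
move=> l0; pose A : {poly R} := (N%:R / 2)%:P + (N%:R / 2) *: cheb R (l + l).
have m1 := @measurable_itvoo1 R; have b1 := @itvoo1_le1 R.
rewrite (@Ex_via_fibre _ A) => [|w hw].
  rewrite (ExD m1 ac1 b1) ExC (ExZ m1 ac1 b1) acT ?addn_gt0 ?l0 // mulr0 addr0.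
  by field; rewrite pnatr_eq0 -lt0n.
under eq_bigr => i _ do rewrite hornerM horner_comp
  (@horner_split _ T N (fun i : 'I_N => g i) splitT i w hw) -expr2 sqr_cheb //.
by rewrite sumr_const card_ord hornerD hornerC hornerZ -mulr_natl; field.
Qed.

Lemma widom_le_sqrt2 l : (1 <= l)%N -> W (l * N) <= Num.sqrt 2.
Proof.
move=> l1; have [s lc] := size_lead_cheb_comp l1; set lam := lead_coef _ in lc.
have lam0 : lam != 0 by rewrite lc mulf_neq0 ?expf_neq0 // pnatr_eq0.
pose Q := lam^-1 *: (cheb R l \Po T).
have Qm : Q \is monic by rewrite monicE lead_coefZ mulVf.
have Qs : size Q = (l * N).+1 by rewrite size_scale ?invr_eq0.
have := orthogonal_monic_min ED EZ (orthopolyP (l * N)) Qm Qs => e.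
have : E (P (l * N) * P (l * N)) <= E (Q * Q).
  by rewrite e lerDl functional_sqr_ge0.
rewrite /Q -scalerAl -scalerAr !EZ Ex_sqr_cheb_comp // Ex_orthopoly_widom exprMn => h.
rewrite -(ler_pXn2r (_ : 0 < 2)%N) ?nnegrE ?sqrtr_ge0 ?(ltW (W0 _)) // sqr_sqrtr //.
have kp : 0 < (kap ^+ (l * N)) ^+ 2 by rewrite !exprn_gt0 // kap_gt0.
rewrite -(ler_pM2r kp) (le_trans h) //.
set X := (2 * `|c|) ^+ l; have X0 : X != 0 by rewrite gt_eqF // exprn_gt0.
have -> : (kap ^+ (l * N)) ^+ 2 = X ^- 2 by rewrite mulnC exprM kap_pow !exprVn.
have lX : lam ^+ 2 = X ^+ 2 / 4.
  have e2 : 2 ^+ l = 2 * 2 ^+ l.-1 :> R by rewrite -exprS prednK.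
  rewrite lc /X !exprMn e2 [(`|c| ^+ l) ^+ 2]exprAC real_normK ?num_real //.
  by rewrite [(c ^+ 2) ^+ l]exprAC; move: (2 ^+ l.-1) (c ^+ l) => u v; field.
suff -> : lam^-1 * (lam^-1 * 2^-1) = 2 * X ^- 2 by [].
by rewrite mulrA -invfM -expr2 lX; field.
Qed.

Lemma widom_gram_ge J r m : (0 < J)%N ->
  1 <= W ((m + J) * N + r) ^+ 2 * \sum_(i < J.+1) \sum_(j < J.+1)
         osc_weight R J i * osc_weight R J j * widom_gram N kap a J r m i j.
Proof.
move=> J0; pose n i := ((m + (J - i)) * N + r)%N.
pose b i := W (n i) * kap ^+ n i.
have b0 i : b i != 0 by rewrite mulf_neq0 ?gt_eqF ?exprn_gt0 ?kap_gt0.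
(* The leading coefficient of T may be negative; the factors [eps ^+ i] cancel the sign of c^k in
   the mixed terms. *)
pose eps := Num.sg c; have eps2 : eps * eps = 1 by rewrite -expr2 sqr_sg c0.
have lt_case i j : (i < j <= J)%N ->
    eps ^+ i * eps ^+ j *
      (E (P (n i) * P (n j) * (cheb R (i - j + (j - i)) \Po T)) / (b i * b j))
    = 2^-1 * (W (n i) / W (n j)).
  move=> /andP[ij jJ]; have -> : (i - j + (j - i) = j - i)%N by lia.
  set k := (j - i)%N; have k0 : (0 < k)%N by rewrite subn_gt0.
  have [sC lC] := size_lead_cheb_comp k0.
  have nij : n i = (n j + k * N)%N.
    rewrite /n; have -> : (J - i = J - j + k)%N by rewrite /k; lia.
    by rewrite addnA mulnDl addnAC.
  have [Pm Ps _] := orthopolyP (n j).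
  have sPC : size (P (n j) * (cheb R k \Po T)) = (n i).+1.
    by rewrite size_monicM // -?size_poly_gt0 ?sC // Ps nij addSn addnS.
  (* The product of [P (n j)] and T_k(T) has degree exactly [n i], so by orthogonality only its
     leading coefficient matters. *)
  rewrite -[P (n i) * _ * _]mulrA (functional_orthogonal_monic ED EZ (orthopolyP (n i)) sPC).
  rewrite lead_coefM (monicP Pm) mul1r lC Ex_orthopoly_widom -/(b i).
  have e1 : eps ^+ i * eps ^+ j * c ^+ k = `|c| ^+ k.
    have -> : eps ^+ j = eps ^+ i * eps ^+ k by rewrite -exprD subnKC // ltnW.
    by rewrite mulrA -exprMn eps2 expr1n mul1r -exprMn -normrEsg.
  have e2 : kap ^+ n i = kap ^+ n j * (2 ^+ k * `|c| ^+ k)^-1.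
    by rewrite nij exprD mulnC exprM kap_pow exprVn exprMn.
  have e3 : 2 ^+ k = 2 * 2 ^+ k.-1 :> R by rewrite -exprS prednK.
  transitivity (eps ^+ i * eps ^+ j * c ^+ k * 2 ^+ k.-1 * (b i / b j)).
    by field; rewrite !b0.
  have v0 : `|c| ^+ k != 0 by rewrite expf_neq0 // normr_eq0.
  have u0 : 2 ^+ k.-1 != 0 :> R by rewrite expf_neq0 // pnatr_eq0.
  have z0 : kap ^+ n j != 0 by rewrite expf_neq0 // gt_eqF // kap_gt0.
  have w0 : W (n j) != 0 by rewrite gt_eqF.
  rewrite e1 /b e2 e3; move: v0 u0 z0 w0.
  move: (`|c| ^+ k) (2 ^+ k.-1) (kap ^+ n j) (W (n j)) => v u z w v0 u0 z0 w0.
  by field; rewrite v0 u0 z0 w0.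
(* The factor [b 0 / b i] gives every [P (n i)] the norm of [P (n 0)] and leaves [q 0] equal to
   [P (n 0)], monic as the Jensen bound demands. *)
pose q i := (osc_weight R J i * eps ^+ i * (b 0%N / b i)) *: P (n i).
have term i j : (i <= J)%N -> (j <= J)%N ->
    E (q i * q j * (cheb R (i - j + (j - i)) \Po T)) =
    b 0%N ^+ 2 * (osc_weight R J i * osc_weight R J j * widom_gram N kap a J r m i j).
  wlog ij : i j / (i <= j)%N => [sym|] iJ jJ.
    have [/sym->//|/ltnW/sym h] := leqP i j.
    rewrite [q i * q j]mulrC addnC h // /widom_gram eq_sym minnC maxnC.
    by rewrite [osc_weight R J i * _]mulrC.
  rewrite /q; set C := cheb R _ \Po T.
  have scal (x y : R) (p0 q0 : {poly R}) : (x *: p0) * (y *: q0) * C = (x * y) *: (p0 * q0 * C).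
    by rewrite -!mul_polyC polyCM; ring.
  rewrite scal EZ /widom_gram /C {C scal}.
  have := b0 i; have := b0 j => bj bi.
  move: ij; rewrite leq_eqVlt => /orP[/eqP ij|ij].
    rewrite -ij eqxx subnn cheb0 -[X in X \Po T]/(1%:P) comp_polyC mulr1.
    rewrite Ex_orthopoly_widom -/(b i).
    transitivity ((eps * eps) ^+ i * (b 0%N ^+ 2 * (osc_weight R J i * osc_weight R J i))).
      rewrite [(eps * eps) ^+ i]exprMn; move: (b i) (b 0%N) bi => u v u0.
      by field.
    by rewrite eps2 expr1n mulr1 mul1r.
  rewrite ltn_eqF // (minn_idPl (ltnW ij)) (maxn_idPr (ltnW ij)) -/(n i) -/(n j).
  rewrite -(lt_case i j) ?ij //; move: (b i) (b j) (b 0%N) bi bj => u u' v u0 u'0.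
  by field; rewrite u0 u'0.
have q0 : q 0%N = P (n 0%N).
  by rewrite /q /osc_weight eqxx expr0 !mul1r mulfV // scale1r.
have n0 : (n 0%N).-1.+1 = n 0%N.
  by rewrite prednK // /n subn0 addn_gt0 muln_gt0 N0 addn_gt0 J0 orbT.
have [Pm Ps _] := orthopolyP (n 0%N).
have := @jensen_Ex (n 0%N).-1 J q; rewrite q0 Pm Ps n0 => /(_ isT erefl) h.
have {}h : kap ^+ (2 * n 0%N) <= E (cheb_gram T J q).
  apply: h => i /andP[i0 iJ]; have [_ Pi _] := orthopolyP (n i).
  rewrite (leq_trans (size_scale_leq _ _)) // Pi /n ltn_add2r ltn_pmul2r //.
  by rewrite ltn_add2l subn0; lia.
move: h; rewrite /cheb_gram (functional_sum ED EZ).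
under eq_bigr => i _.
  rewrite (functional_sum ED EZ).
  under eq_bigr => j _ do rewrite (term _ _ (leq_ord i) (leq_ord j)).
  rewrite -mulr_sumr; over.
rewrite -mulr_sumr mulnC exprM /b exprMn mulrAC.
have kp : 0 < (kap ^+ n 0%N) ^+ 2 by rewrite !exprn_gt0 // kap_gt0.
by move=> h; rewrite -(ler_pM2r kp) mul1r; move: h; rewrite /n subn0.
Qed.

End Recurrence.
End Assembly.

Theorem theorem1p2 (R : realType) (N : nat) (hN : (2 <= N)%N)
    (T : {poly R}) (c : R) (hT : admissible N T) (hc : lead_coef T = c)
    (K : set R) (hK : K = poly_preimage T)
    (muK : probability (measurableTypeR R) R)
    (hmuK : is_equilibrium_measure K muK)
    (a : nat -> R) (ha : is_recurrence_coeffs muK a)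
    (a' : nat -> R) (ha' : is_periodic_limit N a a') :
  [/\ limn_einf (widom_factor muK) = (Num.sqrt 2)%:E,
      forall n, (1 <= n)%N -> (1 <= widom_factor muK n)%E
    & ereal_inf [set (coeff_ratio K a' l)%:E | l in [set l | (1 <= l)%N]]
        = (coeff_ratio K a' N)%:E
      /\ coeff_ratio K a' N = 1].
Proof.
subst K c; have N0 : (0 < N)%N by exact: ltnW.
have [_ sT _ _] := hT; have [g [mg sp gi]] := admissible_roots hT.
have sT1 : (1 < size T)%N by rewrite sT ltnS.
have [L L1 KL] := poly_preimage_bounded sT1.
have [ac [ac1 acT]] := @exists_arcsine R.
have [ap _] := ha; have [per lim] := ha'; have k0 := kap_gt0 N T.
have wE : widom_factor muK = (fun n => (widom (kap N T) a n)%:E).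
  by apply/funext => n; eapply widom_factorE; eassumption.
have W1 n : 1 <= widom (kap N T) a n by eapply widom_ge1; eassumption.
have W2 l : (1 <= l)%N -> widom (kap N T) a (l * N) <= Num.sqrt 2.
  by move=> l1; eapply widom_le_sqrt2; eassumption.
have W3 J r m : (0 < J)%N ->
    1 <= widom (kap N T) a ((m + J) * N + r) ^+ 2 * \sum_(i < J.+1) \sum_(j < J.+1)
         osc_weight R J i * osc_weight R J j * widom_gram N (kap N T) a J r m i j.
  by move=> J0; eapply widom_gram_ge; eassumption.
have crE l : coeff_ratio (poly_preimage T) a' l = (\prod_(i < l) a' i.+1) / kap N T ^+ l.
  rewrite /coeff_ratio big_add1 big_mkord; congr (_ / _ ^+ _).
  by eapply capacityK; eassumption.
have crN : coeff_ratio (poly_preimage T) a' N = 1.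
  by rewrite crE; eapply period_prod_kap; eassumption.
split.
- by rewrite wE; eapply limn_einf_widom; eassumption.
- by move=> n _; rewrite wE lee_fin.
split => //; rewrite crN; apply/eqP; rewrite eq_le; apply/andP; split.
  by apply: ereal_inf_lbound; exists N => //; rewrite crN.
apply: le_ereal_inf_tmp => _ [l _ <-]; rewrite lee_fin crE.
by eapply coeff_ratio_ge1; eassumption.
Qed.
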